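(* For every $r, \Delta \in \mathbb{N}$ and $\delta, \alpha > 0$ there exist $\varepsilon, \beta > 0$ and a constant $C > 0$ (all depending only on $r,\Delta,\delta,\alpha$) such that the following holds for every positive integer $N$. Let $R$ be a graph on the vertex set $[r]=\{1,\dots,r\}$, and let $V_1,\dots,V_r$ be pairwise disjoint sets, each of size $N$. Let $G$ be a graph on $V = V_1 \cup \dots \cup V_r$ such that the pair $(V_i, V_j)$ is $(\varepsilon, \delta)$-super-regular in $G$ for each edge $\{i, j\}$ of $R$. Let $H$ be a graph with maximum degree $\Delta$ and let $h \colon H \to R$ be a graph homomorphism such that $|h^{-1}(i)| \le N$ for every $i \in [r]$. Suppose we are also given a set $W \subseteq V(H)$ of size $|W| \le \beta N$ and, for each vertex $x \in W$, a set $W_x \subseteq V_{h(x)}$ of size at least $\alpha N$. For $x \in V(H) \setminus W$, set $W_x = V_{h(x)}$. Then there exists a $\min(1, C/N)$-vertex-spread distribution $\lambda$ over embeddings $\phi \colon H \hookrightarrow G$ with the property that $\phi(x) \in W_x$ for every $x \in V(H)$.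
   Context: Graphs are finite and simple. For disjoint $X_1,X_2\subseteq V(G)$, let $e_G(X_1,X_2)$ be the number of edges of $G$ between $X_1$ and $X_2$, and let $d_G(X_1,X_2)=e_G(X_1,X_2)/(|X_1||X_2|)$ be the density of the pair. A pair of disjoint sets $(A_1,A_2)$ of vertices is $\varepsilon$-regular if for all $X_i\subseteq A_i$ with $|X_i|\ge \varepsilon|A_i|$ ($i=1,2$) we have $|d_G(X_1,X_2)-d_G(A_1,A_2)|\le\varepsilon$. A pair $(A_1,A_2)$ is $(\varepsilon,\delta)$-super-regular if it is $\varepsilon$-regular, $|A_1|=|A_2|=:N$, and for each $i\in\{1,2\}$ and each $v\in A_i$ we have $|N_G(v)\cap A_{3-i}|\ge\delta N$. An embedding $\phi:H\hookrightarrow G$ is an injective map $V(H)\to V(G)$ sending edges of $H$ to edges of $G$. Vertex-spread: let $X$ and $Y$ be finite sets and let $\lambda$ be a probability distribution over injections $\phi:X\to Y$. For $q\in[0,1]$, $\lambda$ is $q$-vertex-spread if for every $k$ and every two sequences of distinct elements $x_1,\dots,x_k\in X$ and $y_1,\dots,y_k\in Y$, $\Pr[\phi(x_i)=y_i \text{ for all } 1\le i\le k]\le q^k$. Here it is applied with $X=V(H)$ and $Y=V(G)$. *)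

(* Defs.v *)
From mathcomp Require Import all_boot all_order all_algebra reals.

Set Implicit Arguments.
Unset Strict Implicit.
Unset Printing Implicit Defensive.

Import Order.TTheory GRing.Theory Num.Theory.

Local Open Scope ring_scope.

Record sgraph (V : finType) := SGraph {
  adj :> rel V;
  adj_sym : symmetric adj;
  adj_irrefl : irreflexive adj
}.

Definition nbr (V : finType) (G : sgraph V) (v : V) : {set V} :=
  [set u | G v u].

Definition max_degree (V : finType) (G : sgraph V) : nat :=
  \max_(v : V) #|nbr G v|.

Definition is_hom (U V : finType) (H : sgraph U) (G : sgraph V) (f : U -> V) :
    Prop :=
  forall x y, H x y -> G (f x) (f y).

Definition is_embedding (U V : finType) (H : sgraph U) (G : sgraph V)
    (f : U -> V) : Prop :=
  injective f /\ is_hom H G f.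

(* Counts ordered pairs, hence each edge once as long as X1 and X2 are
   disjoint, the only case in which it is used. *)
Definition nedges (V : finType) (G : sgraph V) (X1 X2 : {set V}) : nat :=
  #|[set p in setX X1 X2 | G p.1 p.2]|.

Definition density (R : realType) (V : finType) (G : sgraph V)
    (X1 X2 : {set V}) : R :=
  (nedges G X1 X2)%:R / (#|X1|%:R * #|X2|%:R).

Definition regular_pair (R : realType) (eps : R) (V : finType) (G : sgraph V)
    (A1 A2 : {set V}) : Prop :=
  [disjoint A1 & A2] /\
  forall X1 X2 : {set V}, X1 \subset A1 -> X2 \subset A2 ->
    eps * #|A1|%:R <= #|X1|%:R -> eps * #|A2|%:R <= #|X2|%:R ->
    `|density R G X1 X2 - density R G A1 A2| <= eps.

Definition super_regular_pair (R : realType) (eps delta : R) (V : finType)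
    (G : sgraph V) (A1 A2 : {set V}) : Prop :=
  [/\ regular_pair eps G A1 A2,
      #|A1| = #|A2|,
      forall v, v \in A1 -> delta * #|A1|%:R <= #|nbr G v :&: A2|%:R &
      forall v, v \in A2 -> delta * #|A1|%:R <= #|nbr G v :&: A1|%:R].

Record fdist (R : realType) (T : finType) := FDist {
  mass :> T -> R;
  mass_ge0 : forall t, 0 <= mass t;
  mass_sum1 : \sum_t mass t = 1
}.

Definition Pr (R : realType) (T : finType) (P : fdist R T) (E : pred T) : R :=
  \sum_(t | E t) P t.

Definition supported_on (R : realType) (T : finType) (P : fdist R T)
    (A : T -> Prop) : Prop :=
  forall t, P t != 0 -> A t.

(* A distribution over injections X -> Y is a distribution on {ffun X -> Y}
   supported on injective functions. *)
Definition vertex_spread (R : realType) (X Y : finType) (q : R)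
    (lambda : fdist R {ffun X -> Y}) : Prop :=
  supported_on lambda (fun phi => injective phi) /\
  forall (k : nat) (x : 'I_k -> X) (y : 'I_k -> Y),
    injective x -> injective y ->
    Pr lambda (fun phi => [forall i, phi (x i) == y i]) <= q ^+ k.

(* Main.v *)
Require Import Defs.
From mathcomp Require Import all_boot all_order all_algebra reals.
From mathcomp Require boolp.
From mathcomp Require Import zify ring lra.

Set Implicit Arguments.
Unset Strict Implicit.
Unset Printing Implicit Defensive.

Import Order.TTheory GRing.Theory Num.Theory.

Local Open Scope ring_scope.

(** Why the theorem is true.  The vertices of [H] are placed one after the
other, each uniformly at random on a set of admissible vertices of [G] that is
never smaller than a fixed fraction of [N].  Whatever the history, a given
vertex then lands on a given place with probability [O(1/N)], so the process is
spread by design ([greedy_spread]); the work lies in keeping the admissible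
sets large and in completing the embedding.  Super-regularity enters through two
consequences: vertices have linear degree into adjacent classes, and few
vertices have a small degree into a given linear set ([super_regular_lower]).

Two reserves make the greedy process run.  In every class of [H] a linear set
of buffer vertices, pairwise at distance at least four, is left for the end; in
every class of [G] a set [Q] of about half that size is avoided as long as
possible.  The candidates of an unplaced vertex are the common neighbours of
the images of its placed neighbours.  Every vertex has a zone (its list [Wf x],
the reserve [Q], or the complement of [Q] for neighbours of the buffer), and a
place is forbidden when it would shrink the candidates of a neighbour inside
the zone of this neighbour by more than the factor [d]; lower regularity makes
forbidden places few, so no vertex ever loses its zone.  Neighbours of the
buffer come first, then [W], while little is occupied.  An ordinary vertex
avoids [Q] when it can, and otherwise falls back on it.  The fallback is rare:
the places outside [Q] that are still free at the end form a linear set [T],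
they were free at every earlier time, and hence a vertex that fell back has
atypically few candidates in [T] ([phase2]).  With high probability all linear
sets [T] have few atypical vertices ([irregular_tail]), because the exponential
moment of their number grows so slowly ([atypical_tail]) that a union bound
over all [T] is affordable.

Finally the buffer is matched with the unused vertices of [G] by a random
perfect matching ([spread_matching]): every vertex of the remaining bipartite
candidate graph picks a bounded number of random edges, and the union of these
edges satisfies Hall's condition with probability at least one half.  This
needs linear degrees on both sides.  For buffer vertices they come from the
zones.  For a vertex [v] of [G], each buffer vertex of its class has a fair
chance to get all its neighbours inside the neighbourhood of [v], and the
chances of different buffer vertices do not interact since they are far apart
([uncovered_tail]).

All tail estimates are instances of one supermartingale inequality
([Ex_potential]), and conditioning on an event of probability at least one half
costs a factor two only ([Ex_mixture]).  For bounded [N] the regularity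
hypothesis makes the pairs complete and any class-preserving injection will do
([small_embedding]); isolated vertices added to [H] make all classes have
exactly [N] vertices ([padh_card]). *)

(** * Sequential random processes *)

Section Process.

Variables (R : realType) (I : eqType) (St O : finType).
Variables (opt : I -> St -> {set O}) (upd : I -> St -> O -> St).

Implicit Types (s : seq I) (a w : St) (F : St -> R).

(** Expected value of [F] at the final state when, from state [a], every step
[t] of [s] draws an option uniformly in [opt t] of the current state.  The
recursion avoids any sample space of histories, although options may depend on
the whole past. *)
Fixpoint Ex s a F : R :=
  if s is t :: s' then
    (\sum_(o in opt t a) Ex s' (upd t a o) F) / #|opt t a|%:R
  else F a.

Fixpoint reach s a w : Prop :=
  if s is t :: s' then exists2 o, o \in opt t a & reach s' (upd t a o) w
  else w = a.

Lemma Ex_le s a F1 F2 :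
  (forall w, reach s a w -> F1 w <= F2 w) -> Ex s a F1 <= Ex s a F2.
Proof.
elim: s a => [|t s IHs] a le12 /=; first exact: le12.
rewrite ler_wpM2r ?invr_ge0 ?ler0n // ler_sum // => o oP.
by apply: IHs => w sw; apply: le12; exists o.
Qed.

Lemma eq_Ex s a F1 F2 : F1 =1 F2 -> Ex s a F1 = Ex s a F2.
Proof.
move=> eqF; apply/le_anti; rewrite !Ex_le // => w _; by rewrite eqF.
Qed.

Lemma Ex_cat s1 s2 a F :
  Ex (s1 ++ s2) a F = Ex s1 a (fun w => Ex s2 w F).
Proof.
elim: s1 a => [|t s1 IHs] a //=; congr (_ / _).
by apply: eq_bigr => o _; rewrite IHs.
Qed.

Lemma reach_cat s1 s2 a w :
  reach (s1 ++ s2) a w -> exists2 b, reach s1 a b & reach s2 b w.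
Proof.
elim: s1 a => [|t s1 IHs] a /=; first by exists a.
by case=> o oP /IHs[b ab bw]; exists b => //; exists o.
Qed.

Lemma Ex_sum (J : finType) (P : pred J) s a (F : J -> St -> R) :
  Ex s a (fun w => \sum_(j | P j) F j w) = \sum_(j | P j) Ex s a (F j).
Proof.
elim: s a => [|t s IHs] a //=.
rewrite -mulr_suml; congr (_ / _); rewrite exchange_big /=.
by apply: eq_bigr => o _; rewrite IHs.
Qed.

Lemma ExZ s a c F : Ex s a (fun w => c * F w) = c * Ex s a F.
Proof.
elim: s a => [|t s IHs] a //=.
rewrite mulrA mulr_sumr; congr (_ / _).
by apply: eq_bigr => o _; rewrite IHs.
Qed.

Lemma ExD s a F1 F2 :
  Ex s a (fun w => F1 w + F2 w) = Ex s a F1 + Ex s a F2.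
Proof.
elim: s a => [|t s IHs] a //=.
rewrite -mulrDl -big_split /=; congr (_ / _).
by apply: eq_bigr => o _; rewrite IHs.
Qed.

Lemma Ex_cst s a (c : R) :
  (forall t b, t \in s -> (0 < #|opt t b|)%N) -> Ex s a (fun=> c) = c.
Proof.
elim: s a => [|t s IHs] a //= ne.
rewrite (eq_bigr (fun=> c)) => [|o _]; last first.
  by apply: IHs => u b us; apply: ne; rewrite in_cons us orbT.
rewrite sumr_const -(mulr_natr c) mulfK // pnatr_eq0 -lt0n.
by apply: ne; rewrite mem_head.
Qed.

Lemma Ex_ge0 s a F : (forall w, 0 <= F w) -> 0 <= Ex s a F.
Proof.
move=> F_ge0; elim: s a => [|t s IHs] a //=.
by rewrite divr_ge0 ?ler0n // sumr_ge0.
Qed.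

(** The only tail inequality of this file: a potential that does not increase on
average along the steps bounds the expected value of its final form.  The
potential may depend on the steps that remain, and the invariant restricts the
average inequality to the states that can be met. *)
Lemma Ex_potential (Inv : seq I -> St -> Prop) (Psi : seq I -> St -> R) s a :
  (forall t s' b, Inv (t :: s') b ->
     [/\ (0 < #|opt t b|)%N,
         forall o, o \in opt t b -> Inv s' (upd t b o) &
         \sum_(o in opt t b) Psi s' (upd t b o)
           <= #|opt t b|%:R * Psi (t :: s') b]) ->
  Inv s a -> Ex s a (Psi [::]) <= Psi s a.
Proof.
move=> step; elim: s a => [|t s IHs] a //= /step[ne InvS leP].
rewrite ler_pdivrMr ?ltr0n // mulrC (le_trans _ leP) // ler_sum // => o oP.
exact/IHs/InvS.
Qed.

(** Draws a final state of the process conditioned on [good], then a point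
according to [nu] of this state.  Conditioning divides by the probability of
[good], whence the factor [2]. *)
Lemma Ex_mixture (T : finType) (good : pred St) (nu : St -> fdist R T) s a :
  2^-1 <= Ex s a (fun w => (good w)%:R) ->
  exists lambda : fdist R T,
    (forall f, lambda f != 0 ->
       exists w, [/\ reach s a w, good w & nu w f != 0]) /\
    forall E : pred T,
      Pr lambda E <= 2 * Ex s a (fun w => (good w)%:R * Pr (nu w) E).
Proof.
set Z := Ex s a _ => Z_ge; have Z_gt0 : 0 < Z by lra.
pose m f := Ex s a (fun w => (good w)%:R * nu w f) / Z.
have m_ge0 f : 0 <= m f.
  by rewrite divr_ge0 ?(ltW Z_gt0) // Ex_ge0 // => w; rewrite mulr_ge0 ?ler0n // mass_ge0.
have m_sum1 : \sum_f m f = 1.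
  rewrite -mulr_suml -Ex_sum -[RHS](@mulfV _ Z) ?gt_eqF //; congr (_ / _).
  by apply: eq_Ex => w; rewrite -mulr_sumr mass_sum1 mulr1.
exists (FDist m_ge0 m_sum1); split=> [f|E].
  rewrite /= /m mulf_eq0 negb_or => /andP[+ _] {m m_ge0 m_sum1}.
  elim: s a {Z Z_ge Z_gt0} => [|t s IHs] a /=.
    rewrite mulf_eq0 negb_or pnatr_eq0 eqb0 negbK => /andP[gw nw].
    by exists a; split.
  rewrite mulf_eq0 negb_or => /andP[sum_neq0 _].
  have /existsP[o /andP[oP /IHs[w [sw gw nw]]]] :
      [exists o, (o \in opt t a) &&
        (Ex s (upd t a o) (fun w => (good w)%:R * nu w f) != 0)].
    apply: contraR sum_neq0; rewrite negb_exists => /forallP no.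
    rewrite big1 // => o oP; apply/eqP; have := no o.
    by rewrite oP /= negbK.
  by exists w; split=> //; exists o.
rewrite /Pr /= -mulr_suml -Ex_sum.
have e_ge0 : 0 <= Ex s a (fun w => \sum_(f | E f) (good w)%:R * nu w f).
  by apply: Ex_ge0 => w; rewrite sumr_ge0 // => f _; rewrite mulr_ge0 ?ler0n // mass_ge0.
have -> : Ex s a (fun w => (good w)%:R * \sum_(f | E f) nu w f) =
          Ex s a (fun w => \sum_(f | E f) (good w)%:R * nu w f).
  by apply: eq_Ex => w; rewrite mulr_sumr.
rewrite mulrC ler_wpM2r // -[2]invrK lef_pV2 ?posrE //; lra.
Qed.

End Process.

(** * Hall's marriage theorem *)

Section Hall.

Variables (X Y : finType).

Implicit Types (E : X -> Y -> bool) (S B : {set X}).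

Definition nbhd E S : {set Y} := [set y | [exists x in S, E x y]].

Lemma nbhdP E S y : reflect (exists2 x, x \in S & E x y) (y \in nbhd E S).
Proof. by rewrite inE; apply: (iffP exists_inP). Qed.

(** Induction on [#|B|].  Either some proper subset [S] is tight, and then [S]
and its complement, restricted to the places outside the neighbourhood of [S],
both satisfy the hypothesis; or there is room to match one vertex arbitrarily
and to delete its partner. *)
Lemma hall (f0 : X -> Y) E B :
  (forall S, S \subset B -> (#|S| <= #|nbhd E S|)%N) ->
  exists f : {ffun X -> Y},
    [/\ forall x, x \notin B -> f x = f0 x,
        forall x, x \in B -> E x (f x) &
        {in B &, injective f}].
Proof.
have [n le_n] := ubnP #|B|; elim: n => // n IHn in E B le_n *.
rewrite ltnS in le_n => hallB.
have [->|/set0Pn[x xB]] := eqVneq B set0.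
  exists (finfun f0); split=> [x _|x|x]; by rewrite ?ffunE ?inE.
have [/existsP[S /and4P[SB S0 SnB tight]]|noS] :=
    boolP [exists S : {set X}, [&& S \subset B, S != set0, S != B &
      (#|nbhd E S| <= #|S|)%N]].
  have SpB : S \proper B by rewrite properEneq SnB.
  have ltS : (#|S| < n)%N := leq_trans (proper_card SpB) le_n.
  have [f1 [_ f1E f1I]] := IHn E S ltS (fun S' S'S => hallB S' (subset_trans S'S SB)).
  pose E2 x y := E x y && (y \notin nbhd E S).
  have ltD : (#|B :\: S| < n)%N.
    rewrite cardsD (setIidPr SB); apply: leq_trans le_n.
    by rewrite ltn_subrL !card_gt0 S0; apply/set0Pn; exists x.
  have hall2 S' : S' \subset B :\: S -> (#|S'| <= #|nbhd E2 S'|)%N.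
    rewrite subsetD => /andP[S'B dis].
    have := hallB (S' :|: S); rewrite subUset S'B SB => /(_ isT).
    rewrite cardsU (disjoint_setI0 dis) cards0 subn0 => le1.
    have sub : nbhd E (S' :|: S) \subset nbhd E2 S' :|: nbhd E S.
      apply/subsetP => y /nbhdP[z]; rewrite !in_setU => /orP[zS'|zS] Ezy.
        have [yS|yS] := boolP (y \in nbhd E S); first by rewrite orbT.
        by apply/orP; left; apply/nbhdP; exists z; rewrite // /E2 Ezy.
      by apply/orP; right; apply/nbhdP; exists z.
    have := leq_trans le1 (subset_leq_card sub).
    move/leq_trans/(_ (leq_card_setU _ _))/leq_trans.
    by move/(_ _ (leq_add (leqnn _) tight)); rewrite leq_add2r.
  have [f2 [f20 f2E f2I]] := IHn E2 (B :\: S) ltD hall2.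
  have fE z : z \in B -> z \notin S -> E2 z (f2 z).
    by move=> zB zS; apply: f2E; rewrite inE zS.
  have f1N z : z \in S -> f1 z \in nbhd E S.
    by move=> zS; apply/nbhdP; exists z => //; apply: f1E.
  exists [ffun z => if z \in S then f1 z else f2 z].
  split=> [z zB|z zB|z t zB tB]; rewrite !ffunE.
  - by rewrite (contraNF (subsetP SB z)) // f20 // inE negb_and zB orbT.
  - by case: ifPn => [/f1E|/(fE _ zB)/andP[]].
  case: ifPn => zS; case: ifPn => tS e.
  - exact: f1I.
  - by have /andP[_ /negP[]] := fE _ tB tS; rewrite -e f1N.
  - by have /andP[_ /negP[]] := fE _ zB zS; rewrite e f1N.
  - by apply: f2I; rewrite // inE ?zS ?tS.
have: (0 < #|nbhd E [set x]|)%N.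
  by apply: leq_trans (hallB [set x] _); rewrite ?cards1 ?sub1set.
rewrite card_gt0 => /set0Pn[y /nbhdP[x' /set1P-> Exy]].
pose E1 z w := E z w && (w != y).
have ltD : (#|B :\ x| < n)%N by move: le_n; rewrite (cardsD1 x B) xB.
have hall1 S : S \subset B :\ x -> (#|S| <= #|nbhd E1 S|)%N.
  rewrite subsetD1 => /andP[SB xS].
  have [->|S0] := eqVneq S set0; first by rewrite cards0.
  have SnB : S != B by apply: contraNneq xS => ->.
  move: noS; rewrite negb_exists => /forallP/(_ S).
  rewrite SB S0 SnB /= -ltnNge => ltS.
  have sub : nbhd E S \subset y |: nbhd E1 S.
    apply/subsetP => w /nbhdP[z zS Ezw]; rewrite in_setU1.
    have [//|wy] := eqVneq w y.
    by apply/nbhdP; exists z; rewrite // /E1 Ezw.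
  rewrite -ltnS; apply: leq_trans ltS _; apply: leq_trans (subset_leq_card sub) _.
  by rewrite cardsU1; case: (_ \notin _) => //; rewrite leqW.
have [f [ff0 fE fI]] := IHn E1 (B :\ x) ltD hall1.
have fE1 z : z \in B -> z != x -> E1 z (f z) by move=> zB zx; apply: fE; rewrite !inE zx.
exists [ffun z => if z == x then y else f z].
split=> [z zB|z zB|z t zB tB]; rewrite !ffunE.
- by rewrite (negPf (contraNneq _ zB)) => [|->]; rewrite // ff0 // !inE negb_and zB orbT.
- by case: ifPn => [/eqP->|/(fE1 _ zB)/andP[]].
case: ifPn => [/eqP->|zx]; case: ifPn => [/eqP->|tx] e //.
- by have /andP[_ /eqP[]] := fE1 _ tB tx.
- by have /andP[_ /eqP[]] := fE1 _ zB zx.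
- by apply: fI; rewrite // !inE ?zx ?tx.
Qed.

End Hall.

(** * Binomial and geometric estimates *)

Section Arith.

Lemma bin_le_exp2 n k : ('C(n, k) <= 2 ^ n)%N.
Proof.
have -> : (2 ^ n = #|powerset [set: 'I_n]|)%N by rewrite card_powerset cardsT card_ord.
rewrite -{1}(card_ord n) -cardsT -cards_draws subset_leq_card //.
by apply/subsetP => A; rewrite !inE => /andP[].
Qed.

Lemma expnn_le n : (n ^ n <= 4 ^ n * n`!)%N.
Proof.
have le1 : (n ^ n <= (n + n) ^_ n)%N.
  rewrite ffact_prod -[X in (_ ^ X)%N]card_ord -prod_nat_const leq_prod // => i _.
  by rewrite -addnBA ?leq_addr // ltnW.
apply: leq_trans le1 _; rewrite -bin_ffact leq_mul2r.
apply/orP; right; apply: leq_trans (bin_le_exp2 _ _) _.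
by rewrite addnn -mul2n expnM.
Qed.

Lemma bin_expnn_le b s : ('C(b, s) * s ^ s <= (4 * b) ^ s)%N.
Proof.
apply: (@leq_trans ('C(b, s) * (4 ^ s * s`!))%N).
  by rewrite leq_mul2l expnn_le orbT.
rewrite mulnCA bin_ffact expnMn leq_mul2l; apply/orP; right.
rewrite ffact_prod -[X in (_ ^ X)%N]card_ord -prod_nat_const leq_prod // => i _.
exact: leq_subr.
Qed.

Variable R : realType.

Lemma bin_le_pow (b s u : nat) : (0 < u)%N -> (u <= s)%N ->
  ('C(b, s))%:R <= (4 * b%:R / u%:R) ^+ s :> R.
Proof.
move=> u0 us; rewrite expr_div_n ler_pdivlMr ?exprn_gt0 ?ltr0n //.
rewrite -natrM -!natrX -natrM ler_nat; apply: leq_trans (bin_expnn_le b s).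
by rewrite leq_mul2l; case: s us => [|s] us; rewrite ?expn0 ?orbT // leq_exp2r // us orbT.
Qed.

(** A set of [u.+1] vertices has all its edges in a set of size [u] with the
probability on the left, without the binomial factors.  These are at most
[(4 * b / u) ^ u.+1] each; as [u] is at most half of the degree bound [c * b],
raising the number of edges per vertex beats them, uniformly in [u]. *)
Lemma small_term (c rho : R) (b u Lc : nat) : 0 < c -> 0 < rho ->
  16 / c ^+ 2 * 2^-1 ^+ Lc <= rho ->
  (0 < b)%N -> (u <= b)%N -> u%:R <= c / 2 * b%:R ->
  ('C(b, u.+1))%:R * ('C(b, u))%:R * ((u%:R / (c * b%:R)) ^+ u.+1) ^+ Lc.+2
    <= rho ^+ u.+1.
Proof.
move=> c0 r0 LcP b0 ub small.
have [->|u0] := posnP u.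
  by rewrite mul0r expr1 expr0n /= mulr0 exprn_ge0 // ltW.
have bR : 0 < b%:R :> R by rewrite ltr0n.
have uR : 0 < u%:R :> R by rewrite ltr0n.
set z := u%:R / _.
have z0 : 0 < z by rewrite divr_gt0 // mulr_gt0.
have zE : 4 * b%:R / u%:R = 4 / (c * z).
  by rewrite /z; field; rewrite !gt_eqF.
have z2 : z <= 2^-1 by rewrite /z ler_pdivrMr ?mulr_gt0 //; lra.
have C1 : ('C(b, u.+1))%:R <= (4 / (c * z)) ^+ u.+1 by rewrite -zE bin_le_pow.
have C2 : ('C(b, u))%:R <= (4 / (c * z)) ^+ u.+1.
  rewrite -zE; apply: le_trans (bin_le_pow _ _ (leqnn _)) _ => //.
  rewrite ler_weXn2l // ler_pdivlMr // mul1r.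
  have : u%:R <= b%:R :> R by rewrite ler_nat.
  by lra.
apply: (@le_trans _ _ ((4 / (c * z)) ^+ u.+1 * (4 / (c * z)) ^+ u.+1 * (z ^+ u.+1) ^+ Lc.+2)).
  by rewrite ler_wpM2r ?exprn_ge0 ?(ltW z0) // ler_pM ?ler0n.
rewrite -exprM mulnC exprM -!exprMn lerXn2r ?nnegrE ?(ltW r0) //.
  have w0 : 0 <= 4 / (c * z) by rewrite divr_ge0 // mulr_ge0 // ltW.
  exact: mulr_ge0 (mulr_ge0 w0 w0) (exprn_ge0 _ (ltW z0)).
have -> : 4 / (c * z) * (4 / (c * z)) * z ^+ Lc.+2 = 16 / c ^+ 2 * z ^+ Lc.
  by rewrite !exprS; field; rewrite !gt_eqF.
apply: le_trans LcP; rewrite ler_wpM2l ?divr_ge0 ?exprn_ge0 ?(ltW c0) //.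
by rewrite lerXn2r ?nnegrE ?(ltW z0) // invr_ge0.
Qed.

Lemma geom_le (rho : R) n : 0 < rho -> rho <= 2^-1 ->
  \sum_(s < n) rho ^+ s.+1 <= 2 * rho.
Proof.
move=> r0 r2; suff : \sum_(s < n) rho ^+ s.+1 <= 2 * rho * (1 - rho ^+ n).
  move/le_trans; apply; rewrite ger_pMr; last lra.
  by rewrite gerBl exprn_ge0 // ltW.
elim: n => [|n IHn]; first by rewrite big_ord0 expr0 subrr mulr0.
rewrite big_ord_recr /=; move: IHn; rewrite !exprS; set S := \sum_(_ < n) _.
have : 0 <= rho ^+ n by rewrite exprn_ge0 // ltW.
set p := rho ^+ n => p0 IH.
have : rho * (rho * p) <= 2^-1 * (rho * p) by rewrite ler_wpM2r // mulr_ge0 // ltW.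
lra.
Qed.

Lemma pow_small (x y : R) : 0 <= x -> x < 1 -> 0 < y -> exists n, x ^+ n <= y.
Proof.
move=> x0 x1 y0.
have [->|xn0] := eqVneq x 0; first by exists 1%N; rewrite expr1 ltW.
have {xn0}x0 : 0 < x by rewrite lt_neqAle eq_sym xn0.
pose t := x^-1 - 1; have t0 : 0 < t by rewrite subr_gt0 invf_gt1.
(* Bernoulli's inequality for the inverse of [x]. *)
have bern n : 1 + n%:R * t <= x ^- n.
  elim: n => [|n IHn]; first by rewrite mul0r addr0 expr0 invr1.
  have e : x^-1 = 1 + t by rewrite /t addrC subrK.
  rewrite exprS invfM e; apply: (@le_trans _ _ ((1 + t) * (1 + n%:R * t))).
    rewrite -natr1; have := mulr_ge0 (ler0n R n) (sqr_ge0 t); rewrite expr2; nra.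
  by rewrite ler_wpM2l //; lra.
pose n := Num.bound (y^-1 / t); exists n.
have yt0 : 0 <= y^-1 / t by rewrite divr_ge0 ?invr_ge0 // ltW.
have := archi_boundP yt0; rewrite -/n ltr_pdivrMr // => nP.
rewrite -[_ ^+ n]invrK -[y]invrK lef_pV2 ?posrE ?invr_gt0 ?exprn_gt0 //.
by apply: le_trans (bern n); lra.
Qed.

End Arith.

Lemma exists_subset_card (T : finType) (A : {set T}) k :
  (k <= #|A|)%N -> exists2 B : {set T}, B \subset A & #|B| = k.
Proof.
rewrite -bin_gt0 -cards_draws card_gt0 => /set0Pn[B].
by rewrite inE => /andP[BA /eqP Bk]; exists B.
Qed.

Lemma sum_subsets_card (R : realType) (T : finType) (A : {set T}) (n : nat)
    (f : nat -> R) : #|A| = n ->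
  \sum_(S : {set T} | S \subset A) f #|S| = \sum_(s < n.+1) 'C(n, s)%:R * f s.
Proof.
move=> An; rewrite (partition_big (fun S : {set T} => inord #|S| : 'I_n.+1) xpredT) //=.
apply: eq_bigr => s _.
have -> : 'C(n, s) = #|[set S : {set T} | S \subset A & #|S| == s]|.
  by rewrite cards_draws An.
rewrite mulr_natl -sumr_const.
have e (S : {set T}) : S \subset A -> (inord #|S| == s) = (#|S| == s).
  move=> SA; rewrite -val_eqE /= inordK // ltnS -An; exact: subset_leq_card.
rewrite (eq_bigl (mem [set S : {set T} | S \subset A & #|S| == s])) => [|S] /=; last first.
  by rewrite inE; case: (boolP (S \subset A)) => //= SA; rewrite e.
by apply: eq_bigr => S; rewrite inE => /andP[_ /eqP->].
Qed.

Definition dirac_mass (R : realType) (T : finType) (a t : T) : R := (t == a)%:R.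

Lemma dirac_ge0 (R : realType) (T : finType) (a t : T) : 0 <= dirac_mass R a t.
Proof. exact: ler0n. Qed.

Lemma dirac_sum1 (R : realType) (T : finType) (a : T) :
  \sum_t dirac_mass R a t = 1.
Proof. by rewrite (bigD1 a) //= big1 /dirac_mass ?eqxx ?addr0 // => t /negPf->. Qed.

Definition dirac (R : realType) (T : finType) (a : T) : fdist R T :=
  FDist (@dirac_ge0 R T a) (dirac_sum1 R a).

Lemma Pr_dirac (R : realType) (T : finType) (a : T) (E : pred T) :
  Pr (dirac R a) E = (E a)%:R.
Proof.
rewrite /Pr /= /dirac_mass; case: (boolP (E a)) => Ea.
  rewrite (bigD1 a) //= big1 ?eqxx ?addr0 // => t /andP[_ /negPf->] //.
by rewrite big1 // => t Et; case: eqP => // ta; rewrite -ta Et in Ea.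
Qed.

(** * Spread perfect matchings *)

Section Matching.

Variables (R : realType) (r : nat) (X Y : finType).
Variables (h : X -> 'I_r) (g : Y -> 'I_r) (B : {set X}) (L : {set Y}).
Variables (E : X -> Y -> bool) (b : nat) (c d theta rho : R) (Lc : nat).

Definition nbX x : {set Y} := [set y in L | E x y].
Definition nbY y : {set X} := [set x in B | E x y].
Definition classX i : {set X} := [set x in B | h x == i].
Definition classY i : {set Y} := [set y in L | g y == i].

Hypothesis b_gt0 : (0 < b)%N.
Hypothesis E_class : forall x y, E x y -> h x = g y.
Hypothesis classX_card : forall i, #|classX i| = b.
Hypothesis classY_card : forall i, #|classY i| = b.
Hypothesis c_gt0 : 0 < c.
Hypothesis nbX_ge : forall x, x \in B -> c * b%:R <= #|nbX x|%:R.
Hypothesis nbY_ge : forall y, y \in L -> c * b%:R <= #|nbY y|%:R.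

(** The state of the process is the set of edges drawn so far; each vertex [t] of
either side draws one of its own edges, in each of [Lc] rounds. *)
Definition edges_at (t : X + Y) (G : {set X * Y}) : {set X * Y} :=
  match t with
  | inl x => pair x @: nbX x
  | inr y => (fun x => (x, y)) @: nbY y
  end.

Definition add_edge (t : X + Y) (G : {set X * Y}) (p : X * Y) : {set X * Y} := p |: G.

Lemma edges_at_inl x G : #|edges_at (inl x) G| = #|nbX x|.
Proof. by rewrite card_imset // => y y' [->]. Qed.

Lemma edges_at_inr y G : #|edges_at (inr y) G| = #|nbY y|.
Proof. by rewrite card_imset // => x x' [->]. Qed.

Definition one_round : seq (X + Y) := map inl (enum B) ++ map inr (enum L).
Definition rounds : seq (X + Y) := flatten (nseq Lc one_round).

Definition on_side (t : X + Y) := match t with inl x => x \in B | inr y => y \in L end.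

Lemma rounds_on_side t : t \in rounds -> on_side t.
Proof.
rewrite /rounds; elim: Lc => // n IHn /=; rewrite !mem_cat => /orP[|/IHn //].
by case/orP=> /mapP[z]; rewrite mem_enum => zP ->.
Qed.

Lemma degree_gt0 : 0 < c * b%:R.
Proof. by rewrite mulr_gt0 // ltr0n. Qed.

Lemma edges_at_ge t G : on_side t -> c * b%:R <= #|edges_at t G|%:R.
Proof. by case: t => z /= zP; rewrite ?edges_at_inl ?edges_at_inr ?nbX_ge ?nbY_ge. Qed.

Lemma edges_at_gt0 t G : on_side t -> (0 < #|edges_at t G|)%N.
Proof. by move=> /edges_at_ge-/(_ G); rewrite -(ltr0n R); apply: lt_le_trans degree_gt0. Qed.

Lemma edges_atE t G p : p \in edges_at t G -> [/\ p.1 \in B \/ t = inl p.1, p.2 \in L \/ t = inr p.2 & E p.1 p.2].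
Proof.
case: t => z /imsetP[w]; rewrite inE => /andP[wP Ezw ->] /=; split=> //; by [left|right].
Qed.

Lemma reach_edges (s : seq (X + Y)) (G G' : {set X * Y}) : (forall t, t \in s -> on_side t) ->
  (forall p, p \in G -> [/\ p.1 \in B, p.2 \in L & E p.1 p.2]) ->
  reach edges_at add_edge s G G' ->
  forall p, p \in G' -> [/\ p.1 \in B, p.2 \in L & E p.1 p.2].
Proof.
elim: s G => [|t s IHs] G /= sP GP; first by move=> ->.
case=> p pP; apply: IHs => [u us|q]; first by apply: sP; rewrite in_cons us orbT.
rewrite in_setU1 => /orP[/eqP->|/GP //].
have [P1 P2 P3] := edges_atE pP; have := sP t (mem_head _ _).
by split=> //; [case: P1|case: P2] => // te; move: (sP t (mem_head _ _)); rewrite te.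
Qed.

Definition miss_prob (S : {set X}) (T : {set Y}) (t : X + Y) : R :=
  #|edges_at t set0 :\: setX S T|%:R / #|edges_at t set0|%:R.

Lemma edges_at_set0 t G : edges_at t G = edges_at t set0. Proof. by case: t. Qed.

(** The event that no drawn edge joins [S] to [T] requires every single draw to
miss [setX S T]; the potential is the indicator of this event times the
probabilities that the remaining draws miss as well. *)
Lemma hole_prob_le S T (s : seq (X + Y)) : (forall t, t \in s -> on_side t) ->
  Ex edges_at add_edge s set0 (fun G => (G :&: setX S T == set0)%:R)
    <= \prod_(t <- s) miss_prob S T t.
Proof.
move=> sP; pose Psi (s : seq (X + Y)) (G : {set X * Y}) : R :=
  (G :&: setX S T == set0)%:R * \prod_(t <- s) miss_prob S T t.
rewrite (@eq_Ex _ _ _ _ _ _ _ _ _ (Psi [::])); last first.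
  by move=> G; rewrite /Psi big_nil mulr1.
pose Inv (s : seq (X + Y)) (G : {set X * Y}) := forall t, t \in s -> on_side t.
suff : Ex edges_at add_edge s set0 (Psi [::]) <= Psi s set0.
  by rewrite /Psi set0I eqxx mul1r.
apply: (@Ex_potential R _ _ _ edges_at add_edge Inv Psi s set0) => // t s' G InvP.
have tl : on_side t by apply: InvP; rewrite mem_head.
split; [exact: edges_at_gt0|by move=> o _ u us; apply: InvP; rewrite in_cons us orbT|].
rewrite /Psi big_cons.
set P := \prod_(_ <- _) _.
have P0 : 0 <= P by rewrite prodr_ge0 // => u _; rewrite divr_ge0 ?ler0n.
have e (p : X * Y) : (((add_edge t G p) :&: setX S T == set0)%:R * P) =
    (if p \notin setX S T then (G :&: setX S T == set0)%:R * P else 0).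
  rewrite /add_edge setIUl setU_eq0; case: ifPn => pP.
    by rewrite (_ : [set p] :&: _ == set0) // setI_eq0 disjoints1.
  by rewrite setI_eq0 disjoints1 (negPf pP) mul0r.
rewrite (eq_bigr _ (fun p _ => e p)) -big_mkcondr /=.
rewrite (eq_bigl (mem (edges_at t G :\: setX S T))) => [|p]; last by rewrite !inE andbC.
rewrite sumr_const -(mulr_natl (_ * P)) /miss_prob (edges_at_set0 t G).
set n : R := #|edges_at t set0|%:R; set m : R := #|_|%:R; set D : R := (_ == _)%:R.
have n0 : n != 0 by rewrite pnatr_eq0 -lt0n edges_at_gt0.
suff -> : m * (D * P) = n * (D * (m / n * P)) by [].
by field.
Qed.

Lemma miss_prob_ge0 S T t : 0 <= miss_prob S T t.
Proof. by rewrite divr_ge0 ?ler0n. Qed.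

Lemma miss_prob_le1 S T t : on_side t -> miss_prob S T t <= 1.
Proof.
move=> tl; rewrite ler_pdivrMr ?ltr0n ?edges_at_gt0 // mul1r ler_nat.
by rewrite subset_leq_card // subsetDl.
Qed.

Lemma prod_rounds (f : X + Y -> R) :
  \prod_(t <- rounds) f t =
  ((\prod_(x in B) f (inl x)) * (\prod_(y in L) f (inr y))) ^+ Lc.
Proof.
rewrite /rounds; elim: Lc => [|n IHn]; first by rewrite big_nil expr0.
by rewrite /= big_cat IHn exprS big_cat !big_map !big_enum.
Qed.

Lemma prod_le1 (T : finType) (P : pred T) (f : T -> R) :
  (forall x, P x -> 0 <= f x <= 1) -> \prod_(x | P x) f x <= 1.
Proof. by move=> f01; rewrite -[leRHS](@big1_eq R 1 *%R T (index_enum T) P); apply: ler_prod. Qed.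

Lemma prod_le_subset (T : finType) (A A' : {set T}) (f : T -> R) (z : R) : A \subset A' ->
  (forall x, x \in A' -> 0 <= f x <= 1) -> (forall x, x \in A -> f x <= z) ->
  \prod_(x in A') f x <= z ^+ #|A|.
Proof.
move=> sAA f01 fz; rewrite (big_setID A) /= (setIidPr sAA).
rewrite -[z ^+ _]mulr1 ler_pM ?prodr_ge0 //.
- by move=> x xA; case/andP: (f01 x (subsetP sAA x xA)).
- by move=> x /setDP[xA _]; case/andP: (f01 x xA).
- rewrite -prodr_const ler_prod // => x xA; rewrite fz // andbT.
  by case/andP: (f01 x (subsetP sAA x xA)).
- by apply: prod_le1 => x /setDP[xA _]; apply: f01.
Qed.

Hypothesis rho_gt0 : 0 < rho.
Hypothesis rho_le1 : rho <= 1.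
Hypothesis thetaE : theta = c / 2.
Hypothesis d01 : 0 <= d <= 1.
Hypothesis c_le1 : c <= 1.
Hypothesis Lc_ge2 : (1 < Lc)%N.
Hypothesis Lc_small : 16 / c ^+ 2 * 2^-1 ^+ (Lc - 2) <= rho.
Hypothesis Lc_mid : forall j : nat, theta / 2 * b%:R <= j%:R ->
  (1 - d * theta) ^+ j ^+ Lc <= (rho / 4) ^+ b.
Hypothesis lower_reg : forall i (T : {set Y}), T \subset classY i ->
  theta * b%:R <= #|T|%:R ->
  #|[set x in classX i | #|[set y in T | E x y]|%:R < d * #|T|%:R]|%:R
    <= theta / 2 * b%:R.

Section Pair.

Variables (i : 'I_r) (S : {set X}) (T : {set Y}).
Hypotheses (SP : S \subset classX i) (TP : T \subset classY i).
Hypothesis ST_card : (#|S| + #|T| = b.+1)%N.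

Let SB : S \subset B.
Proof. by apply: subset_trans SP _; apply/subsetP => x; rewrite inE => /andP[]. Qed.

Let TL : T \subset L.
Proof. by apply: subset_trans TP _; apply/subsetP => x; rewrite inE => /andP[]. Qed.

Let pX := \prod_(x in B) miss_prob S T (inl x).
Let pY := \prod_(y in L) miss_prob S T (inr y).

Lemma miss_prob_inl x : x \in S -> miss_prob S T (inl x) = #|nbX x :\: T|%:R / #|nbX x|%:R.
Proof.
move=> xS; rewrite /miss_prob edges_at_inl; congr (_%:R / _).
have -> : edges_at (inl x) set0 :\: setX S T = pair x @: (nbX x :\: T).
  apply/setP => -[x' y]; rewrite in_setD in_setX /=; apply/andP/imsetP.
    case=> zT /imsetP[z zN [ex ey]]; move: zT; rewrite ex ey xS /= => zT.
    by exists z; rewrite // inE zT.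
  case=> z; rewrite inE => /andP[zT zN] [-> ->]; rewrite xS zT; split=> //.
  exact: imset_f.
by rewrite card_imset // => y y' [->].
Qed.

Lemma miss_prob_inr y : y \in T -> miss_prob S T (inr y) = #|nbY y :\: S|%:R / #|nbY y|%:R.
Proof.
move=> yT; rewrite /miss_prob edges_at_inr; congr (_%:R / _).
have -> : edges_at (inr y) set0 :\: setX S T = (fun x => (x, y)) @: (nbY y :\: S).
  apply/setP => -[x y']; rewrite in_setD in_setX /=; apply/andP/imsetP.
    case=> zT /imsetP[z zN [ex ey]]; move: zT; rewrite ex ey yT andbT => zT.
    by exists z; rewrite // inE zT.
  case=> z; rewrite inE => /andP[zT zN] [-> ->]; rewrite yT andbT; split=> //.
  exact: imset_f.
by rewrite card_imset // => x x' [->].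
Qed.

Let cardS_gt0 : (0 < #|S|)%N.
Proof.
rewrite -(ltn_add2r #|T|) ST_card add0n ltnS -(classY_card i).
exact: subset_leq_card.
Qed.

Let cardT_gt0 : (0 < #|T|)%N.
Proof.
rewrite -(ltn_add2l #|S|) ST_card addn0 ltnS -(classX_card i).
exact: subset_leq_card.
Qed.

Lemma pX01 x : x \in B -> 0 <= miss_prob S T (inl x) <= 1.
Proof. by move=> xB; rewrite miss_prob_ge0 miss_prob_le1. Qed.

Lemma pY01 y : y \in L -> 0 <= miss_prob S T (inr y) <= 1.
Proof. by move=> yL; rewrite miss_prob_ge0 miss_prob_le1. Qed.

Lemma pX_ge0 : 0 <= pX. Proof. by rewrite prodr_ge0 // => x _; apply: miss_prob_ge0. Qed.
Lemma pY_ge0 : 0 <= pY. Proof. by rewrite prodr_ge0 // => x _; apply: miss_prob_ge0. Qed.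
Lemma pX_le1 : pX <= 1. Proof. exact: prod_le1 pX01. Qed.
Lemma pY_le1 : pY <= 1. Proof. exact: prod_le1 pY01. Qed.

(** Used for small [S]: avoiding [T] leaves to the vertices of [S] only the
[#|S|.-1] other vertices of their class. *)
Lemma pX_le : pX <= ((#|S|.-1)%:R / (c * b%:R)) ^+ #|S|.
Proof.
apply: prod_le_subset => // [|x xS]; first exact: pX01.
have xB := subsetP SB x xS.
rewrite miss_prob_inl // ler_pM ?ler0n ?invr_ge0 ?ler0n //; last first.
  rewrite lef_pV2 ?posrE ?degree_gt0 ?nbX_ge //.
  by apply: lt_le_trans (nbX_ge xB); apply: degree_gt0.
rewrite ler_nat.
have sub : nbX x :\: T \subset classY i :\: T.
  apply: setSD; apply/subsetP => y; rewrite !inE => /andP[-> /E_class <-] /=.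
  by have := subsetP SP x xS; rewrite inE => /andP[].
apply: leq_trans (subset_leq_card sub) _.
rewrite cardsD (setIidPr TP) classY_card leq_subLR -ltnS -ST_card addnC.
by rewrite -{1}(prednK cardS_gt0) addnS.
Qed.

Lemma pY_le : pY <= ((#|T|.-1)%:R / (c * b%:R)) ^+ #|T|.
Proof.
apply: prod_le_subset => // [|y yT]; first exact: pY01.
have yL := subsetP TL y yT.
rewrite miss_prob_inr // ler_pM ?ler0n ?invr_ge0 ?ler0n //; last first.
  rewrite lef_pV2 ?posrE ?degree_gt0 ?nbY_ge //.
  by apply: lt_le_trans (nbY_ge yL); apply: degree_gt0.
rewrite ler_nat.
have sub : nbY y :\: S \subset classX i :\: S.
  apply: setSD; apply/subsetP => x; rewrite !inE => /andP[-> /E_class ->] /=.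
  by have := subsetP TP y yT; rewrite inE => /andP[].
apply: leq_trans (subset_leq_card sub) _.
rewrite cardsD (setIidPr SP) classX_card leq_subLR -ltnS -ST_card.
by rewrite -{1}(prednK cardT_gt0) addnS.
Qed.

(** When [S] and [T] are both linear, lower regularity gives all but few vertices
of [S] a positive proportion of neighbours in [T]. *)
Lemma pX_middle : 0 <= d -> 0 <= theta -> d * theta <= 1 ->
  theta * b%:R <= #|T|%:R -> theta * b%:R <= #|S|%:R -> 
  #|[set x in classX i | #|[set y in T | E x y]|%:R < d * #|T|%:R]|%:R <= theta / 2 * b%:R ->
  exists2 j : nat, theta / 2 * b%:R <= j%:R & pX <= (1 - d * theta) ^+ j.
Proof.
move=> d0 th0 dth1 Tge Sge; set Bad := [set x in classX i | _] => Bad_le.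
exists #|S :\: Bad|.
  have : (#|S| <= #|S :\: Bad| + #|Bad|)%N.
    by rewrite -(cardsID Bad S) addnC leq_add2l subset_leq_card // subsetIr.
  rewrite -(ler_nat R) natrD; lra.
apply: prod_le_subset => [||x].
- by apply: subset_trans SB; apply: subsetDl.
- exact: pX01.
rewrite inE => /andP[xBad xS]; have xB := subsetP SB x xS.
rewrite miss_prob_inl // ler_pdivrMr; last first.
  by apply: lt_le_trans (nbX_ge xB); apply: degree_gt0.
have TE : nbX x :&: T = [set y in T | E x y].
  apply/setP => y; rewrite !inE; case: (boolP (y \in T)) => [/(subsetP TL)->|]; rewrite ?andbT ?andbF //.
have : d * #|T|%:R <= #|nbX x :&: T|%:R :> R.
  rewrite TE leNgt; apply: contra xBad => lt; rewrite inE lt.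
  by rewrite (subsetP SP).
have : #|nbX x|%:R <= b%:R :> R.
  rewrite ler_nat -(classY_card i) subset_leq_card //.
  apply/subsetP => y; rewrite !inE => /andP[-> /E_class <-] /=.
  by have := subsetP SP x xS; rewrite inE => /andP[].
rewrite cardsD natrB ?subset_leq_card ?subsetIl //.
set n := #|nbX x|%:R; set m := #|_ :&: _|%:R => nb mT.
have : d * (theta * b%:R) <= d * #|T|%:R by rewrite ler_wpM2l.
have : d * theta * n <= d * theta * b%:R by rewrite ler_wpM2l // mulr_ge0.
nra.
Qed.


(** Three regimes.  If [S] is small, the edges drawn by [S] suffice; if [T] is
small, those drawn by [T]; otherwise the probability is exponentially small
with an arbitrarily small base, which beats the [4 ^ b] pairs of sets. *)
Lemma hole_term_le :
  'C(b, #|S|)%:R * 'C(b, #|T|)%:R * (pX * pY) ^+ Lc <= rho ^+ #|S| + rho ^+ #|T|.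
Proof.
have Sb : (#|S| <= b)%N by rewrite -(classX_card i) subset_leq_card.
have Tb : (#|T| <= b)%N by rewrite -(classY_card i) subset_leq_card.
have LcE : Lc = (Lc - 2).+2 by rewrite -addn2 subnK.
have rS : 0 <= rho ^+ #|S| by rewrite exprn_ge0 // ltW.
have rT : 0 <= rho ^+ #|T| by rewrite exprn_ge0 // ltW.
have pX0 := pX_ge0; have pY0 := pY_ge0; have pX1 := pX_le1; have pY1 := pY_le1.
have [small|] := lerP (#|S|.-1)%:R (c / 2 * b%:R).
  apply: (@le_trans _ _ (rho ^+ #|S|)); last by rewrite lerDl.
  have -> : 'C(b, #|T|) = 'C(b, #|S|.-1).
    rewrite -bin_sub //; congr 'C(_, _); apply/eqP.
    by rewrite -(eqn_add2r #|T|) subnK // -eqSS -ST_card -addSn prednK.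
  apply: (@le_trans _ _ ('C(b, #|S|)%:R * 'C(b, #|S|.-1)%:R *
     (((#|S|.-1)%:R / (c * b%:R)) ^+ #|S|) ^+ Lc)).
    rewrite ler_wpM2l ?mulr_ge0 ?ler0n // lerXn2r ?nnegrE ?mulr_ge0 //.
      by rewrite exprn_ge0 // divr_ge0 ?ler0n // ltW // degree_gt0.
    by apply: le_trans pX_le; rewrite ler_piMr.
  rewrite LcE -{1 4 5}(prednK cardS_gt0); apply: small_term => //.
  exact: leq_trans (leq_pred _) Sb.
have [small _|big1 big2] := lerP (#|T|.-1)%:R (c / 2 * b%:R).
  apply: (@le_trans _ _ (rho ^+ #|T|)); last by rewrite lerDr.
  have -> : 'C(b, #|S|) = 'C(b, #|T|.-1).
    rewrite -bin_sub //; congr 'C(_, _); apply/eqP.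
    by rewrite -(eqn_add2l #|S|) subnKC // -eqSS -ST_card -addnS prednK.
  rewrite [_%:R * _%:R]mulrC.
  apply: (@le_trans _ _ ('C(b, #|T|)%:R * 'C(b, #|T|.-1)%:R *
     (((#|T|.-1)%:R / (c * b%:R)) ^+ #|T|) ^+ Lc)).
    rewrite ler_wpM2l ?mulr_ge0 ?ler0n // lerXn2r ?nnegrE ?mulr_ge0 //.
      by rewrite exprn_ge0 // divr_ge0 ?ler0n // ltW // degree_gt0.
    by apply: le_trans pY_le; rewrite ler_piMl.
  rewrite LcE -{1 4 5}(prednK cardT_gt0); apply: small_term => //.
  exact: leq_trans (leq_pred _) Tb.
have pred_le n : (n.-1)%:R <= n%:R :> R by rewrite ler_nat leq_pred.
have Tge : theta * b%:R <= #|T|%:R.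
  by rewrite thetaE; apply: le_trans (pred_le _); apply: ltW.
have Sge : theta * b%:R <= #|S|%:R.
  by rewrite thetaE; apply: le_trans (pred_le _); apply: ltW.
have [d0 d1] := andP d01; have th0 : 0 <= theta by rewrite thetaE divr_ge0 // ltW.
have dth : d * theta <= 1.
  by rewrite mulr_ile1 // thetaE; move: c_le1 c_gt0; lra.
have [j jP pXj] := pX_middle d0 th0 dth Tge Sge (lower_reg TP Tge).
apply: (@le_trans _ _ (rho ^+ #|S|)); last by rewrite lerDl.
apply: (@le_trans _ _ (2 ^+ b * 2 ^+ b * (rho / 4) ^+ b)).
  rewrite ler_pM ?mulr_ge0 ?ler0n ?exprn_ge0 ?mulr_ge0 //.
    by rewrite ler_pM ?ler0n // -natrX ler_nat bin_le_exp2.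
  apply: le_trans (Lc_mid jP); rewrite lerXn2r ?nnegrE ?mulr_ge0 ?exprn_ge0 //.
    by rewrite subr_ge0.
  by apply: le_trans pXj; rewrite ler_piMr.
rewrite -!exprMn (_ : 2 * 2 * (rho / 4) = rho); last by field.
by rewrite ler_wiXn2l // ltW.
Qed.

End Pair.

Lemma hole_sum_le i :
  \sum_(S : {set X} | S \subset classX i)
    \sum_(T : {set Y} | (T \subset classY i) && (#|T| == b.+1 - #|S|)%N)
      Ex edges_at add_edge rounds set0 (fun G => (G :&: setX S T == set0)%:R)
    <= 2 * \sum_(s < b) rho ^+ s.+1.
Proof.
have bound (S : {set X}) (T : {set Y}) : S \subset classX i -> T \subset classY i ->
    (#|T| == b.+1 - #|S|)%N ->
    Ex edges_at add_edge rounds set0 (fun G => (G :&: setX S T == set0)%:R) <=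
    (rho ^+ #|S| + rho ^+ (b.+1 - #|S|)) / ('C(b, #|S|)%:R * 'C(b, b.+1 - #|S|)%:R).
  move=> SP TP /eqP TE.
  have Sb : (#|S| <= b)%N by rewrite -(classX_card i) subset_leq_card.
  have ST : (#|S| + #|T| = b.+1)%N by rewrite TE subnKC // leqW.
  have Tb : (#|T| <= b)%N by rewrite -(classY_card i) subset_leq_card.
  rewrite -TE ler_pdivlMr ?mulr_gt0 ?ltr0n ?bin_gt0 // mulrC.
  apply: le_trans (hole_term_le SP TP ST); rewrite ler_wpM2l ?mulr_ge0 ?ler0n //.
  by rewrite -prod_rounds hole_prob_le // => t; apply: rounds_on_side.
pose f s : R := 'C(b, b.+1 - s)%:R * ((rho ^+ s + rho ^+ (b.+1 - s)) / ('C(b, s)%:R * 'C(b, b.+1 - s)%:R)).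
apply: (@le_trans _ _ (\sum_(S : {set X} | S \subset classX i) f #|S|)).
  apply: ler_sum => S SP.
  have -> : f #|S| = \sum_(T : {set Y} | (T \subset classY i) && (#|T| == b.+1 - #|S|)%N)
     ((rho ^+ #|S| + rho ^+ (b.+1 - #|S|)) / ('C(b, #|S|)%:R * 'C(b, b.+1 - #|S|)%:R)).
    rewrite /f -{1}(classY_card i) -cards_draws mulr_natl -sumr_const.
    by apply: eq_bigl => T; rewrite inE.
  by apply: ler_sum => T /andP[TP TE]; apply: bound.
rewrite (sum_subsets_card _ (classX_card i)) big_ord_recl /f subn0 (bin_small (ltnSn b)).
rewrite mul0r mulr0 add0r.
apply: (@le_trans _ _ (\sum_(s < b) (rho ^+ s.+1 + rho ^+ (b - s)))).
  apply: ler_sum => s _; rewrite !lift0 subSS.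
  have c1 : 'C(b, s.+1)%:R != 0 :> R by rewrite pnatr_eq0 -lt0n bin_gt0.
  have c2 : 'C(b, b - s)%:R != 0 :> R by rewrite pnatr_eq0 -lt0n bin_gt0 leq_subr.
  by rewrite le_eqVlt; apply/orP; left; apply/eqP; field; rewrite c1 c2.
rewrite big_split /= mulr_natl mulr2n lerD2l [leLHS](reindex_inj rev_ord_inj) /=.
by apply: ler_sum => s _; rewrite subKn.
Qed.

Variable f0 : {ffun X -> Y}.

Definition is_matching (G : {set X * Y}) (f : {ffun X -> Y}) : bool :=
  [&& [forall x, (x \notin B) ==> (f x == f0 x)],
      [forall x in B, [&& (x, f x) \in G, f x \in L & E x (f x)]] &
      [forall x in B, [forall x' in B, (f x == f x') ==> (x == x')]]].

Definition has_matching (G : {set X * Y}) : bool := [exists f, is_matching G f].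

(** By Hall's theorem applied to all classes at once: a deficient set is already
deficient within one class, and together with the places that it does not reach
there it yields a pair of sets without edges.  The sizes can be made to add up to [b.+1]
exactly. *)
Lemma no_hole_matching (G : {set X * Y}) :
  (forall p, p \in G -> [/\ p.1 \in B, p.2 \in L & E p.1 p.2]) ->
  (forall i (S : {set X}) (T : {set Y}), S \subset classX i -> T \subset classY i ->
     (#|T| == b.+1 - #|S|)%N -> G :&: setX S T != set0) ->
  has_matching G.
Proof.
move=> GP nohole; pose D x y := (x, y) \in G.
have [|f [ff0 fD fI]] := @hall X Y f0 D B; last first.
  apply/existsP; exists f; apply/and3P; split.
  - by apply/forallP => x; apply/implyP => xB; rewrite ff0.
  - by apply/forall_inP => x /fD; rewrite /D => xG; rewrite xG; have [_ -> ->] := GP _ xG.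
  - by apply/forall_inP => x xB; apply/forall_inP => x' x'B; apply/implyP => /eqP /fI->.
move=> S SB.
have cl i : (#|S :&: classX i| <= #|nbhd D S :&: classY i|)%N.
  rewrite leqNgt; apply/negP => lt.
  have Sb : (#|S :&: classX i| <= b)%N by rewrite -(classX_card i) subset_leq_card // subsetIr.
  have [|T] := @exists_subset_card _ (classY i :\: nbhd D S) (b.+1 - #|S :&: classX i|).
    by apply: (leq_trans (leq_sub2l b.+1 lt)); rewrite subSS cardsD classY_card (setIC (classY i)).
  rewrite subsetD => /andP[TP TN] TE.
  have := nohole i _ _ (subsetIr S (classX i)) TP; rewrite TE eqxx => /(_ isT)/set0Pn[[x y]].
  rewrite in_setI in_setX => /andP[xyG /andP[/= /setIP[xS _] yT]].
  by move/disjointFr: TN => /(_ _ yT)/nbhdP[]; exists x.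
have part (U : finType) (A : {set U}) (k : U -> 'I_r) :
    #|A| = (\sum_(i < r) #|[set u in A | k u == i]|)%N.
  rewrite -sum1_card (partition_big k xpredT) //=; apply: eq_bigr => i _.
  by rewrite -sum1_card; apply: eq_bigl => u; rewrite inE.
rewrite (part _ S h) (part _ (nbhd D S) g); apply: leq_sum => i _.
apply: leq_trans (leq_trans (cl i) _); apply: subset_leq_card.
  by apply/subsetP => x; rewrite !inE => /andP[xS ->]; rewrite xS (subsetP SB).
by apply/subsetP => x; rewrite !inE => /andP[-> /andP[_ ->]].
Qed.

Hypothesis rho_small : r%:R * (4 * rho) <= 2^-1.

Lemma has_matching_half :
  2^-1 <= Ex edges_at add_edge rounds set0 (fun G => (has_matching G)%:R) :> R.
Proof.
have live_ne (t : X + Y) (G : {set X * Y}) : t \in rounds -> (0 < #|edges_at t G|)%N.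
  by move=> /rounds_on_side; apply: edges_at_gt0.
have [r0|r_gt0] := posnP r.
  have e : (fun G : {set X * Y} => (has_matching G)%:R) =1 (fun=> 1 : R).
    move=> G; suff -> : has_matching G by [].
    by apply/existsP; exists f0; apply/and3P; split; apply/forallP => x;
      have := ltn_ord (h x); move: (nat_of_ord _) => z; rewrite r0.
  by rewrite (eq_Ex _ _ _ _ e) Ex_cst //; lra.
have rho2 : rho <= 2^-1.
  have : 1 <= r%:R :> R by rewrite ler1n.
  by move: rho_small rho_gt0; nra.
pose F (i : 'I_r) (S : {set X}) (T : {set Y}) (G : {set X * Y}) : R :=
  (G :&: setX S T == set0)%:R.
have le1 : 1 <= Ex edges_at add_edge rounds set0 (fun G => (has_matching G)%:R +
    \sum_(i < r) \sum_(S : {set X} | S \subset classX i)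
    \sum_(T : {set Y} | (T \subset classY i) && (#|T| == b.+1 - #|S|)%N) F i S T G).
  rewrite -[leLHS](@Ex_cst R _ _ _ edges_at add_edge rounds set0 1) //.
  apply: Ex_le => G /(reach_edges (@rounds_on_side)) GP.
  have [//|nG] := boolP (has_matching G).
    by rewrite lerDl !sumr_ge0 // => i _; rewrite sumr_ge0 // => S _; rewrite sumr_ge0 // => T _; apply: ler0n.
  rewrite add0r.
  have GP0 p : p \in G -> [/\ p.1 \in B, p.2 \in L & E p.1 p.2].
    by apply: GP => q; rewrite in_set0.
  have [/existsP[i /existsP[S /existsP[T /and4P[SP TP TE hole]]]]|nohole] :=
    boolP [exists i, [exists S : {set X}, [exists T : {set Y},
      [&& S \subset classX i, T \subset classY i, #|T| == (b.+1 - #|S|)%N &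
      G :&: setX S T == set0]]]].
    have F0 i' S' T' : 0 <= F i' S' T' G by apply: ler0n.
    rewrite (bigD1 i) //= (bigD1 S) //= (bigD1 T) /= ?TP //.
    rewrite {1}/F hole -!addrA lerDl !addr_ge0 ?sumr_ge0 //.
    - by move=> S' _; apply: sumr_ge0.
    - by move=> i' _; apply: sumr_ge0 => S' _; apply: sumr_ge0.
  case/negP: nG; apply: no_hole_matching => // i S T SP TP TE.
  apply: contra nohole => hole; apply/existsP; exists i; apply/existsP; exists S.
  by apply/existsP; exists T; rewrite SP TP TE.
rewrite ExD in le1.
have : Ex edges_at add_edge rounds set0 (fun G => \sum_(i < r) \sum_(S : {set X} | S \subset classX i)
    \sum_(T : {set Y} | (T \subset classY i) && (#|T| == b.+1 - #|S|)%N) F i S T G) <= r%:R * (4 * rho).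
  rewrite Ex_sum -[r in r%:R]card_ord mulr_natl -sumr_const; apply: ler_sum => i _.
  rewrite Ex_sum; under eq_bigr => S _ do rewrite Ex_sum.
  apply: le_trans (hole_sum_le i) _.
  have := geom_le b rho_gt0 rho2; set z := \sum_(_ < _) _; lra.
move: le1 rho_small; lra.
Qed.

Definition matching_of (G : {set X * Y}) : {ffun X -> Y} := odflt f0 [pick f | is_matching G f].

Lemma matching_ofP G : has_matching G -> is_matching G (matching_of G).
Proof.
rewrite /matching_of; case: pickP => [f //|no] /existsP[f]; by rewrite no.
Qed.

(** Each prescribed edge can only be drawn from one of its two ends, hence in at
most [2 * Lc] draws, and the prescribed edges have distinct ends on both sides,
so that a single draw concerns at most one of them.  The factor of an edge that
is still missing is the number of draws left to it times the chance of one
draw. *)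
Lemma rounds_spread (k : nat) (x : 'I_k -> X) (y : 'I_k -> Y) :
  injective x -> injective y ->
  Ex edges_at add_edge rounds set0
     (fun G => \prod_i (if x i \in B then ((x i, y i) \in G)%:R else 1 : R))
  <= \prod_i (if x i \in B then (2 * Lc)%:R / (c * b%:R) else 1).
Proof.
move=> xI yI; set q0 := (c * b%:R)^-1.
have q0_ge0 : 0 <= q0 by rewrite invr_ge0 ltW // degree_gt0.
pose rel i (t : X + Y) := (t == inl (x i)) || (t == inr (y i)).
pose F i (s : seq (X + Y)) (G : {set X * Y}) : R :=
  if x i \in B then (if (x i, y i) \in G then 1 else (count (rel i) s)%:R * q0) else 1.
pose Psi s G := \prod_i F i s G.
have F_ge0 i s G : 0 <= F i s G.
  by rewrite /F; do 2!case: ifP => // _; rewrite mulr_ge0 ?ler0n.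
pose Inv (s : seq (X + Y)) (G : {set X * Y}) := forall t, t \in s -> on_side t.
apply: (@le_trans _ _ (Ex edges_at add_edge rounds set0 (Psi [::]))).
  apply: Ex_le => G _; apply: ler_prod => i _; rewrite /F /= mul0r.
  by case: ifP => _; [case: ifP => _|]; apply/andP; split; rewrite // ler01.
apply: (@le_trans _ _ (Psi rounds set0)); last first.
  apply: ler_prod => i _; rewrite F_ge0 /F in_set0 /=; case: ifP => // _.
  rewrite ler_wpM2r // ler_nat.
  have cnt : (count (rel i) one_round <= 2)%N.
    pose a1 : pred (X + Y) := pred1 (inl (x i)).
    pose a2 : pred (X + Y) := pred1 (inr (y i)).
    apply: (@leq_trans (count (predU a1 a2) one_round + count (predI a1 a2) one_round)).
      by rewrite (@eq_count _ (rel i) (predU a1 a2)) // leq_addr.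
    rewrite count_predUI.
    have um : uniq one_round.
      rewrite cat_uniq !map_inj_uniq ?enum_uniq //=; try by move=> ? ? [].
      by rewrite andbT -all_predC; apply/allP => t /mapP[z _ ->]; apply/negP => /mapP[].
    by rewrite !count_uniq_mem //; case: (_ \in _); case: (_ \in _).
  rewrite /rounds; elim: Lc => // n IHn.
  by rewrite /= count_cat mulnS leq_add.
apply: (@Ex_potential R _ _ _ edges_at add_edge Inv Psi rounds set0); last exact: rounds_on_side.
move=> t s G InvP; have tl : on_side t by apply: InvP; rewrite mem_head.
split; [exact: edges_at_gt0|by move=> o _ u us; apply: InvP; rewrite in_cons us orbT|].
have optE p i : p \in edges_at t G -> p = (x i, y i) -> rel i t.
  move=> + pE; rewrite {p}pE; case: t {InvP tl} => z /imsetP[w _ [ex ey]]; rewrite /rel.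
    by rewrite ex eqxx.
  by rewrite ey eqxx orbT.
have mono i p : p \in edges_at t G -> p != (x i, y i) ->
    F i s (add_edge t G p) <= F i (t :: s) G.
  move=> pP pn; rewrite /F /add_edge in_setU1 eq_sym (negPf pn) /=.
  case: ifP => // _; case: ifP => // _.
  by rewrite ler_wpM2r // ler_nat leq_addl.
have [/existsP[j /and3P[jB jrel jG]]|none] :=
    boolP [exists j, [&& x j \in B, rel j t & (x j, y j) \notin G]]; last first.
  rewrite mulr_natl -sumr_const; apply: ler_sum => p pP.
  apply: ler_prod => i _; rewrite F_ge0 /=.
  have [pE|] := eqVneq p (x i, y i); last exact: mono.
  move: none; rewrite negb_exists => /forallP/(_ i).
  rewrite (optE _ _ pP pE) /= negb_and negbK /F.
  by case: ifP => //= _ iG; rewrite /add_edge in_setU1 iG orbT.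
have other i p : p \in edges_at t G -> i != j -> p != (x i, y i).
  move=> pP; apply: contraNneq => pE; have := optE _ _ pP pE.
  by case/orP: jrel => /eqP-> /orP[] // /eqP[e]; rewrite ?(xI _ _ e) ?(yI _ _ e).
set m := count (rel j) s.
have Fj : F j (t :: s) G = (m.+1)%:R * q0.
  by rewrite /F jB (negPf jG) /= jrel add1n.
(* Only the factor [j] can grow, and on average it does not. *)
have Pj : 0 <= \prod_(i | i != j) F i (t :: s) G by rewrite prodr_ge0.
apply: (@le_trans _ _ (\sum_(p in edges_at t G)
   ((m%:R * q0 + (p == (x j, y j))%:R) * \prod_(i | i != j) F i (t :: s) G))).
  apply: ler_sum => p pP; rewrite /Psi (bigD1 j) //= ler_pM ?prodr_ge0 //.
    rewrite /F jB /add_edge in_setU1 (negPf jG) orbF eq_sym.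
    by case: ifP => _; rewrite ?addr0 // lerDr mulr_ge0 ?ler0n.
  apply: ler_prod => i ij; rewrite F_ge0 /=; apply: mono => //; exact: other.
have PsiE : Psi (t :: s) G = F j (t :: s) G * \prod_(i | i != j) F i (t :: s) G.
  by rewrite /Psi (bigD1 j).
rewrite -mulr_suml PsiE mulrA ler_wpM2r // Fj.
rewrite big_split /= sumr_const -[leLHS]addrC.
have le1 : \sum_(p in edges_at t G) (p == (x j, y j))%:R <= 1 :> R.
  have [xy|xy] := boolP ((x j, y j) \in edges_at t G).
    rewrite (bigD1 (x j, y j)) //= eqxx big1 ?addr0 // => p /andP[_ /negPf->] //.
  rewrite big1 ?ler01 // => p pP; case: eqP => // pE; by rewrite -pE pP in xy.
have le2 : 1 <= #|edges_at t G|%:R * q0 by rewrite ler_pdivlMr ?degree_gt0 // mul1r edges_at_ge.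
rewrite -(mulr_natl (m%:R * q0)) -natr1 mulrDl mul1r mulrDr; lra.
Qed.

Lemma matching_dist : exists nu : fdist R {ffun X -> Y},
  (forall f, nu f != 0 ->
     [/\ forall x, x \notin B -> f x = f0 x,
         forall x, x \in B -> f x \in L /\ E x (f x) &
         {in B &, injective f}]) /\
  forall (k : nat) (x : 'I_k -> X) (y : 'I_k -> Y), injective x -> injective y ->
    Pr nu (fun f => [forall i, (x i \in B) ==> (f (x i) == y i)]) <=
      2 * \prod_i (if x i \in B then (2 * Lc)%:R / (c * b%:R) else 1).
Proof.
have [nu [nuS nuP]] := Ex_mixture (fun G => dirac R (matching_of G)) has_matching_half.
exists nu; split=> [f /nuS[G [_ /matching_ofP G_pm]]|k x y xI yI].
  rewrite /= /dirac_mass pnatr_eq0 eqb0 negbK => /eqP->.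
  have [/forallP H1 /forall_inP H2 /forall_inP H3] := and3P G_pm.
  split=> [x xB|x /H2/and3P[_ -> ->]//|x x' xB x'B e].
    by apply/eqP; have /implyP := H1 x; apply.
  have /forall_inP H3x := H3 x xB; have /implyP inj := H3x x' x'B.
  by apply/eqP/inj; rewrite e.
apply: le_trans (nuP _) _; rewrite ler_pM2l // (le_trans _ (rounds_spread xI yI)) //.
apply: Ex_le => G _; rewrite Pr_dirac.
have [/matching_ofP G_pm|_] := boolP (has_matching G); last first.
  by rewrite mul0r prodr_ge0 // => i _; case: ifP.
rewrite mul1r; case: (boolP [forall i, _]) => [/forallP ev|_]; last first.
  by rewrite prodr_ge0 // => i _; case: ifP.
rewrite big1 // => i _; case: ifP => // iB.
have [_ /forall_inP H2 _] := and3P G_pm.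
have /and3P[+ _ _] := H2 _ iB.
by have /implyP/(_ iB)/eqP-> := ev i => ->.
Qed.

End Matching.

(** Classes on both sides allow all parts of the host graph to be matched in one
go.  The maps are defined on all of [X] and equal [f0] outside [B], so that the
statement applies directly to the extension of a partial embedding. *)
Definition matching_constant (R : realType) (r : nat) (c d C : R) : Prop :=
  forall (X Y : finType) (h : X -> 'I_r) (g : Y -> 'I_r) (B : {set X}) (L : {set Y})
    (E : X -> Y -> bool) (b : nat),
    (0 < b)%N ->
    (forall x y, E x y -> h x = g y) ->
    (forall i, #|[set x in B | h x == i]| = b) ->
    (forall i, #|[set y in L | g y == i]| = b) ->
    (forall x, x \in B -> c * b%:R <= #|[set y in L | E x y]|%:R) ->
    (forall y, y \in L -> c * b%:R <= #|[set x in B | E x y]|%:R) ->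
    (forall i (T : {set Y}), T \subset [set y in L | g y == i] ->
       c / 2 * b%:R <= #|T|%:R ->
       #|[set x in B | (h x == i) && (#|[set y in T | E x y]|%:R < d * #|T|%:R)]|%:R
         <= c / 4 * b%:R) ->
  forall f0 : {ffun X -> Y}, exists nu : fdist R {ffun X -> Y},
    (forall f, nu f != 0 ->
       [/\ forall x, x \notin B -> f x = f0 x,
           forall x, x \in B -> f x \in L /\ E x (f x) &
           {in B &, injective f}]) /\
    forall (k : nat) (x : 'I_k -> X) (y : 'I_k -> Y), injective x -> injective y ->
      Pr nu (fun f => [forall i, (x i \in B) ==> (f (x i) == y i)]) <=
        2 * \prod_i (if x i \in B then C / b%:R else 1).

(** The number [Lc] of rounds is chosen after [c] and [d]: [L0] serves the small
sets and [L1 * L2] the linear ones in [hole_term_le]. *)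
Lemma spread_matching (R : realType) (r : nat) (c d : R) :
  0 < c <= 1 -> 0 < d <= 1 -> exists2 C : R, 0 < C & matching_constant r c d C.
Proof.
move=> /andP[c0 c1] /andP[d0 d1].
pose rho : R := (8 * r.+1%:R)^-1.
have rR : 1 <= r.+1%:R :> R by rewrite ler1n.
have rho0 : 0 < rho by rewrite invr_gt0 mulr_gt0.
have rho1 : rho <= 1 by rewrite invf_le1 ?mulr_gt0 //; lra.
have rhos : r%:R * (4 * rho) <= 2^-1.
  have : r%:R / r.+1%:R <= 1 :> R by rewrite ler_pdivrMr ?ltr0n // mul1r ler_nat.
  rewrite /rho invfM; set w := r.+1%:R^-1; set q := r%:R; lra.
pose theta := c / 2.
have dth : 0 < d * theta <= 2^-1.
  have t0 : 0 < theta by rewrite divr_gt0.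
  have t2 : theta <= 2^-1 by rewrite /theta; lra.
  by rewrite mulr_gt0 //= -[leRHS]mul1r ler_pM // ltW.
have [|||L0 L0P] := @pow_small R 2^-1 (rho * c ^+ 2 / 16); try lra.
  by rewrite divr_gt0 // mulr_gt0 // exprn_gt0.
have [|||L1 L1P] := @pow_small R (1 - d * theta) (rho / 4); try lra.
pose L2 := Num.bound (2 / theta).
have L2P : 2 / theta <= L2%:R.
  by apply/ltW/archi_boundP; rewrite divr_ge0 // divr_ge0 // ltW.
pose Lc := (L0 + L1 * L2).+2.
have Lc_small : 16 / c ^+ 2 * 2^-1 ^+ (Lc - 2) <= rho.
  rewrite /Lc !subSS subn0; apply: (@le_trans _ _ (16 / c ^+ 2 * 2^-1 ^+ L0)).
    rewrite ler_wpM2l ?divr_ge0 ?exprn_ge0 ?(ltW c0) // ler_wiXn2l ?leq_addr //; lra.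
  rewrite mulrAC ler_pdivrMr ?exprn_gt0 //; move: L0P; set z := 2^-1 ^+ _; lra.
exists ((2 * Lc)%:R / c); first by rewrite divr_gt0 // ltr0n.
move=> X Y h g B L E b b0 Ecl cXb cYb nXb nYb low f0.
have dth0 : 0 <= 1 - d * theta by lra.
have dth1 : 1 - d * theta <= 1 by lra.
have Lc_mid (j : nat) : theta / 2 * b%:R <= j%:R ->
    (1 - d * theta) ^+ j ^+ Lc <= (rho / 4) ^+ b.
  move=> jP; rewrite -exprM.
  apply: (@le_trans _ _ ((1 - d * theta) ^+ (L1 * (j * L2)))).
    rewrite ler_wiXn2l // mulnCA leq_mul2l; apply/orP; right.
    by rewrite /Lc !leqW // leq_addl.
  rewrite exprM; apply: (@le_trans _ _ ((rho / 4) ^+ (j * L2))).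
    by rewrite lerXn2r ?nnegrE ?exprn_ge0 // divr_ge0 // ltW.
  rewrite ler_wiXn2l //; try lra.
  have th0 : 0 < theta by rewrite divr_gt0.
  rewrite -(ler_nat R) natrM; apply: (@le_trans _ _ (theta / 2 * b%:R * (2 / theta))).
    by rewrite le_eqVlt; apply/orP; left; apply/eqP; field; rewrite gt_eqF.
  apply: ler_pM => //; last by rewrite divr_ge0 // ltW.
  by rewrite mulr_ge0 ?ler0n // divr_ge0 // ltW.
have d01 : 0 <= d <= 1 by rewrite ltW.
have low' i (T : {set Y}) : T \subset classY g L i -> theta * b%:R <= #|T|%:R ->
  #|[set x in classX h B i | #|[set y in T | E x y]|%:R < d * #|T|%:R]|%:R <= theta / 2 * b%:R.
  move=> TP Tb; rewrite (_ : theta / 2 = c / 4); last by rewrite /theta; field.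
  apply: le_trans (low i T TP Tb); rewrite ler_nat subset_leq_card //.
  by apply/subsetP => x; rewrite !inE andbA.
have [nu [nuS nuP]] := matching_dist b0 Ecl cXb cYb c0 nXb nYb rho0 rho1
  (erefl theta) d01 c1 (isT : (1 < Lc)%N) Lc_small Lc_mid low' f0 rhos.
exists nu; split=> // k x y xI yI; apply: le_trans (nuP k x y xI yI) _.
rewrite ler_pM2l // le_eqVlt; apply/orP; left; apply/eqP/eq_bigr => i _.
by case: ifP => // _; rewrite invfM mulrA.
Qed.

(** * The random greedy embedding *)

Section Greedy.

Variables (R : realType) (r : nat) (VH VG : finType).
Variables (H : rel VH) (G : rel VG) (h : VH -> 'I_r) (g : VG -> 'I_r).
Variables (N Delta : nat) (d eps : R).

Definition fibH i : {set VH} := [set x | h x == i].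
Definition fibG i : {set VG} := [set v | g v == i].
Definition nbH x : {set VH} := [set y | H x y].
Definition nbG v : {set VG} := [set u | G v u].

Hypothesis H_sym : symmetric H.
Hypothesis H_irr : irreflexive H.
Hypothesis G_sym : symmetric G.
Hypothesis degH : forall x, (#|nbH x| <= Delta)%N.
Hypothesis d01 : 0 < d <= 1.
Hypothesis eps_ge0 : 0 <= eps.
Hypothesis lower_reg : forall x y, H x y -> forall T : {set VG}, T \subset fibG (h y) ->
  eps * N%:R <= #|T|%:R ->
  #|[set v in fibG (h x) | #|T :&: nbG v|%:R < d * #|T|%:R]|%:R <= eps * N%:R.

Let d_gt0 : 0 < d. Proof. by case/andP: d01. Qed.
Let d_ge0 : 0 <= d. Proof. exact: ltW. Qed.
Let d_le1 : d <= 1. Proof. by case/andP: d01. Qed.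

Notation state := {ffun VH -> option VG}.
Implicit Types (p w : state) (x y z : VH) (u v : VG) (T : {set VG}).

Definition place y p v : state := [ffun z => if z == y then Some v else p z].

(** Places compatible with the neighbours placed so far.  Occupied places are not
removed: this keeps [cand] decreasing in time and determined by the images of
the neighbours. *)
Definition cand p x : {set VG} :=
  [set v in fibG (h x) | [forall y, H x y ==> (if p y is Some u then G u v else true)]].

Definition emb p x : nat := #|[set y in nbH x | p y]|.

(** Each placed neighbour may shrink the candidates in [T] by the factor [d].
The three uses are the zones, the free places of the union bound, and the
neighbourhoods in which the buffer has to land. *)
Definition typical p x T : bool := d ^+ emb p x * #|T|%:R <= #|cand p x :&: T|%:R.

Lemma cand_sub p x : cand p x \subset fibG (h x).
Proof. by apply/subsetP => v; rewrite inE => /andP[]. Qed.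

Lemma candP p x v : reflect (g v = h x /\ forall y u, H x y -> p y = Some u -> G u v)
                            (v \in cand p x).
Proof.
rewrite !inE; apply: (iffP andP) => [[/eqP-> /forallP A]|[-> A]]; split=> //.
  by move=> y u xy py; have := A y; rewrite xy py.
by apply/forallP => y; apply/implyP => xy; case py: (p y) => [u|] //; apply: A py.
Qed.

Lemma placeE y p v z : place y p v z = if z == y then Some v else p z.
Proof. by rewrite ffunE. Qed.

Lemma cand_place_same p x y v : ~~ H x y -> cand (place y p v) x = cand p x.
Proof.
move=> xy; apply/setP => u; rewrite !inE; congr (_ && _); apply: eq_forallb => z.
by rewrite placeE; case: eqP => // ->; rewrite (negPf xy).
Qed.

Lemma cand_place p x y v : H x y -> p y = None ->
  cand (place y p v) x = cand p x :&: nbG v.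
Proof.
move=> xy py; apply/setP => u; rewrite in_setI [u \in nbG _]inE.
apply/candP/andP => [[gu A]|[/candP[gu A] vu]]; split=> //.
- apply/candP; split=> // z t xz pz; apply: (A z t xz); rewrite placeE.
  by case: eqP pz => // ->; rewrite py.
- by apply: (A y v xy); rewrite placeE eqxx.
- by move=> z t xz; rewrite placeE; case: eqP => [_ [<-]|_ /A]; last by apply.
Qed.

Lemma emb_place_same p x y v : ~~ H x y -> emb (place y p v) x = emb p x.
Proof.
move=> xy; apply: eq_card => z; rewrite !inE placeE.
by case: eqP => // ->; rewrite (negPf xy).
Qed.

Lemma emb_place p x y v : H x y -> p y = None -> emb (place y p v) x = (emb p x).+1.
Proof.
move=> xy py; rewrite /emb.
have -> : [set z in nbH x | place y p v z] = y |: [set z in nbH x | p z].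
  by apply/setP => z; rewrite !inE placeE; case: eqP => // ->; rewrite xy.
by rewrite cardsU1 !inE py andbF.
Qed.

Lemma emb_le p x : (emb p x <= Delta)%N.
Proof.
by apply: leq_trans (degH x); rewrite subset_leq_card //; apply/subsetP => y; rewrite inE => /andP[].
Qed.

Let D : R := d ^+ Delta.

Let D_gt0 : 0 < D. Proof. exact: exprn_gt0. Qed.
Let D_le1 : D <= 1. Proof. exact: exprn_ile1. Qed.

Lemma D_le_emb p x : D <= d ^+ emb p x.
Proof. by rewrite ler_wiXn2l // emb_le. Qed.

Lemma typicalD p x T : typical p x T -> D * #|T|%:R <= #|cand p x :&: T|%:R.
Proof. by apply: le_trans; rewrite ler_wpM2r // D_le_emb. Qed.

Lemma typical_place_same p x y v T : ~~ H x y -> typical (place y p v) x T = typical p x T.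
Proof. by move=> xy; rewrite /typical emb_place_same // cand_place_same. Qed.

(** A bad choice for [y] has too few neighbours in the current candidates inside
[T], a set that is still linear because [x] is typical; lower regularity
applies to it. *)
Lemma atypical_choices_le p x y T : H y x -> p y = None -> T \subset fibG (h x) ->
  typical p x T -> eps * N%:R <= D * #|T|%:R ->
  #|[set v in fibG (h y) | ~~ typical (place y p v) x T]|%:R <= eps * N%:R.
Proof.
move=> yx py TP gT Tge.
have xy : H x y by rewrite H_sym.
have sT : cand p x :&: T \subset fibG (h x) by apply: subset_trans TP; apply: subsetIr.
apply: le_trans (lower_reg yx sT (le_trans Tge (typicalD gT))).
rewrite ler_nat subset_leq_card //; apply/subsetP => v; rewrite !inE => /andP[-> ] /=.
rewrite /typical emb_place // cand_place // -ltNge setIAC => /lt_le_trans; apply.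
by rewrite exprS -mulrA ler_wpM2l.
Qed.

Lemma card_bigcup_le (J : finType) (P : pred J) (F : J -> {set VG}) :
  (#|\bigcup_(j | P j) F j| <= \sum_(j | P j) #|F j|)%N.
Proof.
elim/big_rec2: _ => [|j n A _ le]; first by rewrite cards0.
by apply: leq_trans (leq_card_setU _ _) _; rewrite leq_add2l.
Qed.

Lemma union_nbr y (F : VH -> {set VG}) (c : R) : 0 <= c ->
  (forall x, H y x -> #|F x|%:R <= c) ->
  #|\bigcup_(x in nbH y) F x|%:R <= Delta%:R * c.
Proof.
move=> c0 Fc; apply: le_trans (_ : (\sum_(x in nbH y) #|F x|)%:R <= _).
  by rewrite ler_nat card_bigcup_le.
rewrite natr_sum; apply: (@le_trans _ _ (\sum_(x in nbH y) c)).
  by apply: ler_sum => x; rewrite inE; apply: Fc.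
by rewrite sumr_const -[leLHS]mulr_natl ler_wpM2r // ler_nat.
Qed.

(** * Zones and choice sets *)

Variables (B W : {set VH}) (Wf : VH -> {set VG}) (Q : {set VG}) (c1 : R).

Definition bufN : {set VH} := [set y | [exists x in B, H x y]].

(** The set in which the candidates of [x] are protected until [x] is placed. *)
Definition zone x : {set VG} :=
  if x \in bufN then fibG (h x) :\: Q else if x \in W then Wf x else fibG (h x) :&: Q.

Definition used p : {set VG} := [set v | [exists x, p x == Some v]].

Definition forbidden p y : {set VG} :=
  \bigcup_(x in nbH y)
     (if p x is None then [set v in fibG (h y) | ~~ typical (place y p v) x (zone x)] else set0).

Definition main_pool y p : {set VG} := cand p y :\: Q :\: used p :\: forbidden p y.
Definition zone_pool y p : {set VG} := (cand p y :&: zone y) :\: used p :\: forbidden p y.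

(** The last branch never occurs on the event studied below.  It keeps every
choice set inside the right class and of size at least [c1 * N], so that the
probability estimates hold without any condition. *)
Definition choices y p : {set VG} :=
  if [&& y \notin bufN, y \notin W & c1 * N%:R <= #|main_pool y p|%:R] then main_pool y p
  else if c1 * N%:R <= #|zone_pool y p|%:R then zone_pool y p else fibG (h y).

Hypothesis fibG_card : forall i, #|fibG i| = N.
Hypothesis fibH_card : forall i, #|fibH i| = N.
Hypothesis N_gt0 : (0 < N)%N.
Hypothesis c1_01 : 0 < c1 <= 1.

Let c1_gt0 : 0 < c1. Proof. by case/andP: c1_01. Qed.
Let n_gt0 : 0 < N%:R :> R. Proof. by rewrite ltr0n. Qed.

Lemma main_pool_sub y p : main_pool y p \subset cand p y.
Proof. by do 2![apply: subset_trans (subsetDl _ _) _]; exact: subsetDl. Qed.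

Lemma zone_pool_sub y p : zone_pool y p \subset cand p y.
Proof. by do 2![apply: subset_trans (subsetDl _ _) _]; exact: subsetIl. Qed.

Lemma choices_sub y p : choices y p \subset fibG (h y).
Proof.
rewrite /choices; do 2?case: ifP => _ //.
  exact: subset_trans (main_pool_sub _ _) (cand_sub _ _).
exact: subset_trans (zone_pool_sub _ _) (cand_sub _ _).
Qed.

Lemma choices_ge y p : c1 * N%:R <= #|choices y p|%:R.
Proof.
rewrite /choices; case: ifP => [/and3P[]//|_]; case: ifP => // _.
by rewrite fibG_card ger_pMl //; case/andP: c1_01.
Qed.

Lemma choices_gt0 y p : (0 < #|choices y p|)%N.
Proof. by rewrite -(ltr0n R); apply: lt_le_trans (choices_ge y p); rewrite mulr_gt0. Qed.

Definition fresh (s : seq VH) p := uniq s /\ forall x, x \in s -> p x = None.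

Lemma fresh_place y s p v : fresh (y :: s) p -> fresh s (place y p v).
Proof.
move=> [/andP[ys us] pn]; split=> // x xs; rewrite placeE.
by case: eqP => [e|_]; [rewrite -e xs in ys|apply: pn; rewrite in_cons xs orbT].
Qed.

Lemma fresh_head y s p : fresh (y :: s) p -> p y = None.
Proof. by case=> _; apply; rewrite mem_head. Qed.

Notation EX := (@Ex R VH state VG choices place).
Notation RE := (@reach VH state VG choices place).

(** * Atypical vertices and spread *)

Definition atypical i T p : {set VH} := [set x in fibH i | ~~ typical p x T].

(** One step can only affect the neighbours of the vertex being placed, and each
of them becomes atypical with probability at most [eps / c1].  So a step
multiplies the expected value of [K ^+ n], with [n] the number of atypical
vertices, by at most the stated factor. *)
Lemma atypical_tail (i : 'I_r) T (K : R) s p : 1 <= K -> T \subset fibG i ->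
  eps * N%:R <= D * #|T|%:R -> fresh s p ->
  EX s p (fun w => K ^+ #|atypical i T w|)
    <= (1 + K ^+ Delta * (Delta%:R * eps) / c1) ^+ size s * K ^+ #|atypical i T p|.
Proof.
move=> K1 TP Tge fr; have K0 : 0 <= K by apply: le_trans K1.
set th := K ^+ Delta * _ / _.
have th0 : 0 <= th by rewrite divr_ge0 ?mulr_ge0 ?exprn_ge0 ?ler0n ?(ltW c1_gt0).
pose Psi (s : seq VH) p : R := (1 + th) ^+ size s * K ^+ #|atypical i T p|.
rewrite (@eq_Ex _ _ _ _ _ _ _ _ _ (Psi [::])); last by move=> w; rewrite /Psi /= mul1r.
apply: (@Ex_potential R _ _ _ choices place fresh Psi s p) => // {s p fr} y s p fr.
split; [exact: choices_gt0|by move=> v _; apply: fresh_place|].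
have py := fresh_head fr.
pose U := \bigcup_(x in nbH y)
  (if (h x == i) && typical p x T then [set v in fibG (h y) | ~~ typical (place y p v) x T] else set0).
have Uc : #|U|%:R <= Delta%:R * (eps * N%:R).
  apply: union_nbr; first by rewrite mulr_ge0 ?ler0n.
  move=> x yx; case: ifP => [/andP[/eqP hx gx]|_]; last by rewrite cards0 mulr_ge0 ?ler0n.
  by apply: atypical_choices_le; rewrite // hx.
set k := #|atypical i T p|.
have bd v : v \in choices y p ->
    K ^+ #|atypical i T (place y p v)| <= K ^+ k + (if v \in U then K ^+ Delta * K ^+ k else 0).
  move=> vo; have vf := subsetP (choices_sub y p) v vo; case: ifPn => vU.
    rewrite -exprD -[leLHS]add0r lerD ?exprn_ge0 // ler_weXn2l //.
    apply: (@leq_trans #|nbH y :|: atypical i T p|).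
      apply: subset_leq_card; apply/subsetP => x; rewrite !inE => /andP[-> /=].
      by have [//|yx] := boolP (H y x); rewrite typical_place_same // H_sym.
    by apply: leq_trans (leq_card_setU _ _) _; rewrite leq_add2r.
  rewrite addr0 ler_weXn2l //; apply: subset_leq_card.
  apply/subsetP => x; rewrite !inE => /andP[hx] /=; rewrite hx /=.
  have [yx|yx] := boolP (H y x); last by rewrite typical_place_same // H_sym.
  apply: contra => gx; apply: contraR vU => nb; apply/bigcupP; exists x; rewrite ?inE //.
  by rewrite hx gx inE vf.
have -> : \sum_(v in choices y p) Psi s (place y p v) =
   (1 + th) ^+ size s * \sum_(v in choices y p) K ^+ #|atypical i T (place y p v)|.
  by rewrite mulr_sumr.
rewrite /Psi /= exprS mulrCA -/k [(1 + th) * _]mulrC -!mulrA.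
rewrite ler_wpM2l ?exprn_ge0 ?addr_ge0 //.
apply: le_trans (ler_sum _ bd) _; rewrite big_split /= sumr_const -[_ *+ _]mulr_natl.
rewrite -big_mkcondr /= (eq_bigl (mem (choices y p :&: U))) => [|v]; last by rewrite !inE.
rewrite sumr_const -(mulr_natl (_ * _)).
have Uo : #|choices y p :&: U|%:R <= Delta%:R * (eps * N%:R).
  by apply: le_trans Uc; rewrite ler_nat subset_leq_card // subsetIr.
have Nle : N%:R <= #|choices y p|%:R / c1 by rewrite ler_pdivlMr // mulrC choices_ge.
set o : R := #|choices y p|%:R in Nle *; set uo : R := #|_ :&: U|%:R in Uo *.
have -> : (1 + th) * (o * K ^+ k) = o * K ^+ k + Delta%:R * (eps * (o / c1)) * (K ^+ Delta * K ^+ k).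
  by rewrite /th; ring.
rewrite lerD2l ler_wpM2r ?mulr_ge0 ?exprn_ge0 // (le_trans Uo) //.
by rewrite !ler_wpM2l ?ler0n.
Qed.

(** The factor of an unplaced vertex is the bound on the probability of its
prescribed image. *)
Lemma greedy_spread (k : nat) (x : 'I_k -> VH) (y : 'I_k -> VG) s p : injective x ->
  (forall z, p z = None) -> uniq s ->
  EX s p (fun w => \prod_i (if w (x i) is Some v then (v == y i)%:R else 1 : R))
    <= \prod_i (if x i \in s then (c1 * N%:R)^-1 else 1).
Proof.
move=> xI p0 us; set q0 := (_ * _)^-1.
have q00 : 0 <= q0 by rewrite invr_ge0 mulr_ge0 // ltW.
pose F (s : seq VH) p i : R :=
  if p (x i) is Some v then (v == y i)%:R else if x i \in s then q0 else 1.
pose Psi s p := \prod_i F s p i.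
have F_ge0 s' p' i : 0 <= F s' p' i by rewrite /F; case: (p' _) => [v|]; [|case: ifP].
have -> : \prod_i (if x i \in s then q0 else 1) = Psi s p.
  by apply: eq_bigr => i _; rewrite /F p0.
rewrite (@eq_Ex _ _ _ _ _ _ _ _ _ (Psi [::])) //.
apply: (@Ex_potential R _ _ _ choices place fresh Psi s p); last by split=> // z _.
move=> {us p0 s p} z s p fr; split; [exact: choices_gt0|by move=> v _; apply: fresh_place|].
have pz := fresh_head fr; have zs : z \notin s by case: fr => /andP[].
have same i v : x i != z -> F s (place z p v) i = F (z :: s) p i.
  by move=> xz; rewrite /F placeE (negPf xz) in_cons (negPf xz).
have [/existsP[j /eqP xj]|none] := boolP [exists j, x j == z]; last first.
  rewrite mulr_natl -sumr_const; apply: ler_sum => v _.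
  rewrite /Psi (eq_bigr (F (z :: s) p)) // => i _; apply: same.
  by apply: contra none => e; apply/existsP; exists i.
have PE s' p' : Psi s' p' = F s' p' j * \prod_(i | i != j) F s' p' i by rewrite /Psi (bigD1 j).
have eqo v : \prod_(i | i != j) F s (place z p v) i = \prod_(i | i != j) F (z :: s) p i.
  by apply: eq_bigr => i ij; apply: same; rewrite -xj; apply: contra ij => /eqP/xI->.
under eq_bigr => v _ do rewrite PE eqo.
rewrite -mulr_suml PE mulrA ler_wpM2r ?prodr_ge0 //.
have -> : F (z :: s) p j = q0 by rewrite /F xj pz mem_head.
have le1 : \sum_(v in choices z p) F s (place z p v) j <= 1.
  rewrite (eq_bigr (fun v => (v == y j)%:R)) => [|v _]; last by rewrite /F xj placeE eqxx.
  have [yo|yo] := boolP (y j \in choices z p).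
    by rewrite (bigD1 (y j)) //= eqxx big1 ?addr0 // => v /andP[_ /negPf->].
  by rewrite big1 ?ler01 // => v vo; case: eqP => // e; rewrite -e vo in yo.
apply: le_trans le1 _; rewrite ler_pdivlMr ?mulr_gt0 // mul1r; exact: choices_ge.
Qed.

(** * Invariants and the two phases *)

(** What holds as long as the last branch of [choices] is not taken.  The set
[SV] will be the set of starved vertices of the final state; the last field
says who may occupy the reserve. *)
Record sound (SV : {set VH}) p : Prop := Sound {
  sound_class : forall x v, p x = Some v -> g v = h x;
  sound_inj : forall x y v, p x = Some v -> p y = Some v -> x = y;
  sound_hom : forall x y u v, H x y -> p x = Some u -> p y = Some v -> G u v;
  sound_zone : forall x, p x = None -> typical p x (zone x);
  sound_W : forall x v, x \in W -> p x = Some v -> v \in Wf x;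
  sound_Q : forall x v, p x = Some v -> v \in Q -> (x \in W) || (x \in SV)
}.

Lemma usedP p v : reflect (exists x, p x = Some v) (v \in used p).
Proof. by rewrite inE; apply: (iffP existsP) => -[x /eqP]; exists x => //; apply/eqP. Qed.

Lemma sound_place SV p y v : sound SV p -> p y = None -> v \in cand p y ->
  v \notin used p -> v \notin forbidden p y -> (y \in W -> v \in Wf y) ->
  (v \in Q -> (y \in W) || (y \in SV)) -> sound SV (place y p v).
Proof.
move=> I py vc vu vf yW vQ; have [gv cv] := candP _ _ _ vc.
split=> [x u|x z u|x z u t xz|x|x u xW|x u].
- by rewrite placeE; case: eqP => [-> [<-]//|_]; exact: (sound_class I).
- rewrite !placeE; case: eqP => [->|xy]; case: eqP => [->|zy] //.
  + by move=> [<-] pz; case/negP: vu; apply/usedP; exists z.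
  + by move=> px [vu']; case/negP: vu; apply/usedP; exists x; rewrite px vu'.
  + exact: (sound_inj I).
- rewrite !placeE; case: eqP => [xy|xy]; case: eqP => [zy|zy].
  + by rewrite xy zy H_irr in xz.
  + by move=> [<-] pz; rewrite G_sym; apply: cv pz; rewrite -xy.
  + by move=> px [<-]; apply: cv px; rewrite H_sym -zy.
  + exact: (sound_hom I xz).
- rewrite placeE; case: eqP => // xy px.
  have [yx|yx] := boolP (H y x); last by rewrite typical_place_same 1?H_sym //; exact: (sound_zone I).
  apply: contraR vf => ng; apply/bigcupP; exists x; rewrite ?inE // px inE ng andbT.
  by rewrite inE gv.
- by rewrite placeE; case: eqP => [xy [<-]|_]; [rewrite xy; apply: yW; rewrite -xy|exact: (sound_W I xW)].
- by rewrite placeE; case: eqP => [-> [<-]|_]; [apply: vQ|exact: (sound_Q I)].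
Qed.

Lemma used_card p (P : {set VG}) (D0 : {set VH}) :
  (forall x v, p x = Some v -> v \in P -> x \in D0) ->
  (#|used p :&: P| <= #|D0|)%N.
Proof.
move=> sub; rewrite -(card_imset (mem (used p :&: P)) (@Some_inj _)).
apply: (@leq_trans #|p @: D0|); last exact: leq_imset_card.
apply: subset_leq_card; apply/subsetP => o /imsetP[v /setIP[/usedP[x px] vP] ->].
by rewrite -px imset_f // (sub x v).
Qed.

Definition ext p w := forall x v, p x = Some v -> w x = Some v.

Lemma reach_ext s p w : fresh s p -> RE s p w -> ext p w.
Proof.
elim: s p => [|y s IHs] p fr /=; first by move=> ->.
case=> v vo /(IHs _ (fresh_place v fr)) sw x u px; apply: sw.
by rewrite placeE; case: eqP => // e; have := fresh_head fr; rewrite -e px.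
Qed.

Lemma reach_dom s p w x : RE s p w -> isSome (w x) = isSome (p x) || (x \in s).
Proof.
elim: s p => [|y s IHs] p /=; first by move=> ->; rewrite orbF.
case=> v vo /IHs ->; rewrite placeE in_cons.
by case: eqP => //= _; rewrite ?orbT.
Qed.

Lemma reach_class s p w : (forall x v, p x = Some v -> g v = h x) -> RE s p w ->
  forall x v, w x = Some v -> g v = h x.
Proof.
elim: s p => [|y s IHs] p cl /=; first by move=> ->.
case=> v vo; apply: IHs => x u; rewrite placeE; case: eqP => [-> [<-]|_]; last exact: cl.
by have := subsetP (choices_sub y p) v vo; rewrite inE => /eqP.
Qed.

Lemma ext_cand p w x : ext p w -> cand w x \subset cand p x.
Proof.
by move=> pw; apply/subsetP => v /candP[gv A]; apply/candP; split=> // y u xy /pw; apply: A.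
Qed.

Variables (eta zeta : R).
Hypothesis eta_gt0 : 0 < eta.
Hypothesis Wf_sub : forall x, x \in W -> Wf x \subset fibG (h x).
Hypothesis zone_ge : forall x, eta * N%:R <= #|zone x|%:R.
Hypothesis eps_D : eps <= D * eta.
Hypothesis eps_Delta : Delta%:R * eps <= D * eta / 4.
Hypothesis c1E : c1 = D * eta / 2.

Lemma zone_sub x : zone x \subset fibG (h x).
Proof.
rewrite /zone; case: ifP => _; first exact: subsetDl.
by case: ifP => [|_]; [apply: Wf_sub|apply: subsetIl].
Qed.

Lemma epsN_le T : eta * N%:R <= #|T|%:R -> eps * N%:R <= D * #|T|%:R.
Proof.
move=> Tge; apply: (@le_trans _ _ (D * (eta * N%:R))); last by rewrite ler_wpM2l // ltW.
by rewrite mulrA ler_wpM2r.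
Qed.

Lemma forbidden_card SV p y : sound SV p -> p y = None -> #|forbidden p y|%:R <= D * eta / 4 * N%:R.
Proof.
move=> I py; apply: (@le_trans _ _ (Delta%:R * (eps * N%:R))); last first.
  by rewrite mulrA ler_wpM2r.
apply: union_nbr; first by rewrite mulr_ge0.
move=> x yx; case px: (p x) => [v|]; first by rewrite cards0 mulr_ge0.
apply: atypical_choices_le => //; [exact: zone_sub|exact: (sound_zone I px)|exact/epsN_le/zone_ge].
Qed.

Lemma cardD_ge (A C : {set VG}) : #|A|%:R - #|C :&: A|%:R <= #|A :\: C|%:R :> R.
Proof. by rewrite cardsD natrB ?subset_leq_card ?subsetIl // setIC. Qed.

Lemma zone_pool_ge SV p y : sound SV p -> p y = None ->
  #|used p :&: zone y|%:R <= D / 4 * #|zone y|%:R -> c1 * N%:R <= #|zone_pool y p|%:R.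
Proof.
move=> I py us.
have g1 := typicalD (sound_zone I py); have g2 := forbidden_card I py.
have g3 := cardD_ge (cand p y :&: zone y) (used p).
have g4 := cardD_ge ((cand p y :&: zone y) :\: used p) (forbidden p y).
have g5 : #|used p :&: (cand p y :&: zone y)|%:R <= #|used p :&: zone y|%:R :> R.
  by rewrite ler_nat subset_leq_card // setIS // subsetIr.
have g6 : #|forbidden p y :&: ((cand p y :&: zone y) :\: used p)|%:R <= #|forbidden p y|%:R :> R.
  by rewrite ler_nat subset_leq_card // subsetIl.
have g7 : D * (eta * N%:R) <= D * #|zone y|%:R by rewrite ler_wpM2l // ltW.
rewrite c1E /zone_pool; lra.
Qed.

Lemma choices_zone_pool SV p y : sound SV p -> p y = None ->
  (y \in bufN) || (y \in W) ->
  #|used p :&: zone y|%:R <= D / 4 * #|zone y|%:R -> choices y p = zone_pool y p.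
Proof.
move=> I py yP us; rewrite /choices (zone_pool_ge I py us).
by case/orP: yP => ->; rewrite ?andbF.
Qed.

Lemma zone_poolP y p v : v \in zone_pool y p ->
  [/\ v \in cand p y, v \in zone y, v \notin used p & v \notin forbidden p y].
Proof. by rewrite !in_setD in_setI => /and3P[-> -> /andP[-> ->]]. Qed.

Lemma main_poolP y p v : v \in main_pool y p ->
  [/\ v \in cand p y, v \notin Q, v \notin used p & v \notin forbidden p y].
Proof. by rewrite !in_setD => /and4P[-> -> -> ->]. Qed.

Hypothesis bufNW : bufN :&: W = set0.
Hypothesis zeta_W : forall x, x \in W -> zeta * N%:R <= #|Wf x|%:R.
Hypothesis zeta_Q : forall i, zeta * N%:R <= #|fibG i :\: Q|%:R.
Hypothesis bufNW_small : #|bufN|%:R + #|W|%:R <= D / 4 * zeta * N%:R.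

Definition early p := forall x, isSome (p x) -> (x \in bufN) || (x \in W).

Lemma early_used p y : early p -> (y \in bufN) || (y \in W) ->
  #|used p :&: zone y|%:R <= D / 4 * #|zone y|%:R.
Proof.
move=> ep yP; apply: (@le_trans _ _ (#|bufN :|: W|%:R)).
  rewrite ler_nat; apply: used_card => x v px _; rewrite in_setU; apply: ep; by rewrite px.
apply: (@le_trans _ _ (#|bufN|%:R + #|W|%:R)).
  by rewrite -natrD ler_nat leq_card_setU.
apply: le_trans bufNW_small _; rewrite -mulrA ler_wpM2l ?divr_ge0 ?(ltW D_gt0) //.
rewrite /zone; case: ifP yP => [_ _|_ /= yW]; [exact: zeta_Q|rewrite yW; exact: zeta_W].
Qed.

Lemma phase1_step SV p y v : sound SV p -> early p -> p y = None ->
  (y \in bufN) || (y \in W) -> v \in choices y p ->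
  sound SV (place y p v) /\ early (place y p v).
Proof.
move=> I ep py yP; rewrite (choices_zone_pool I py yP (early_used ep yP)).
case/zone_poolP=> vc vZ vu vf; split; last first.
  by move=> x; rewrite placeE; case: eqP => [->|_]; last exact: ep.
apply: sound_place => // [yW|vQ].
  move: vZ; rewrite /zone yW; case: ifP => // yNB.
  by move/setP/(_ y): bufNW; rewrite !inE yW andbT; move: yNB; rewrite inE => ->.
move: yP; case: (boolP (y \in W)) => //= _; rewrite orbF => yNB.
by move: vZ; rewrite /zone yNB inE vQ.
Qed.

(** While only neighbours of the buffer and vertices of [W] are placed, the used
places are too few to exhaust a zone. *)
Lemma phase1 SV s p w : fresh s p -> {subset s <= bufN :|: W} -> sound SV p -> early p ->
  RE s p w -> sound SV w /\ early w.
Proof.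
elim: s p => [|y s IHs] p fr sP I ep /=; first by move=> ->.
case=> v vo; have yP : (y \in bufN) || (y \in W) by rewrite -in_setU sP ?mem_head.
have [I' ep'] := phase1_step I ep (fresh_head fr) yP vo.
apply: IHs => //; first exact: fresh_place.
by move=> x xs; apply: sP; rewrite in_cons xs orbT.
Qed.

Variables (b q m2 : nat) (tau : R).
Hypothesis B_card : forall i, #|B :&: fibH i| = b.
Hypothesis Q_card : forall i, #|Q :&: fibG i| = q.
Hypothesis eta_bq : eta * N%:R <= b%:R - q%:R.
Hypothesis tau_eta : tau <= eta.
Hypothesis Q_reserve : #|W|%:R + N%:R / m2%:R <= D / 4 * q%:R.
Hypothesis m2_gt0 : (0 < m2)%N.

(** A property of the final state only.  As candidates decrease in time, it also
controls the candidates at the moment when a vertex was placed. *)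
Definition regular_event w : bool := [forall i, forall T : {set VG},
  (T \subset fibG i) ==> (tau * N%:R <= #|T|%:R) ==> (m2 * #|atypical i T w| <= N)%N].

Lemma regular_eventP w i T : regular_event w -> T \subset fibG i -> tau * N%:R <= #|T|%:R ->
  (m2 * #|atypical i T w| <= N)%N.
Proof.
by move=> /forallP/(_ i)/forallP/(_ T)/implyP L /L/implyP.
Qed.

(** Places outside the reserve that stay free until the end; these were free when
any vertex chose its place. *)
Definition left_over w i : {set VG} := fibG i :\: Q :\: used w.

Definition starved w : {set VH} := [set x | ~~ typical w x (left_over w (h x))].

Lemma left_over_card w i : (forall x v, w x = Some v -> g v = h x) ->
  (forall x, isSome (w x) -> x \notin B) -> eta * N%:R <= #|left_over w i|%:R.
Proof.
move=> cl wB; apply: le_trans eta_bq _.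
have u1 : (#|used w :&: fibG i| <= #|fibH i :\: B|)%N.
  apply: used_card => x v wx; rewrite !inE => /eqP gv.
  by rewrite -(cl x v wx) gv eqxx wB ?wx.
have u2 : (#|fibH i :\: B| + b = N)%N.
  by rewrite cardsD fibH_card setIC B_card subnK // -(B_card i) -(fibH_card i) subset_leq_card // subsetIr.
have u3 := cardD_ge (fibG i) Q; have u4 := cardD_ge (fibG i :\: Q) (used w).
have u5 : (#|used w :&: (fibG i :\: Q)| <= #|used w :&: fibG i|)%N.
  by rewrite subset_leq_card // setIS // subsetDl.
move: u1 u2 u5; rewrite -!(ler_nat R) => u1 /(congr1 (fun n => n%:R : R)); rewrite natrD => u2 u5.
rewrite fibG_card Q_card in u3; rewrite /left_over; lra.
Qed.

Lemma starved_card w i : (forall x v, w x = Some v -> g v = h x) ->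
  (forall x, isSome (w x) -> x \notin B) -> regular_event w ->
  #|starved w :&: fibH i|%:R <= N%:R / m2%:R :> R.
Proof.
move=> cl wB Lw; rewrite ler_pdivlMr ?ltr0n // -natrM ler_nat mulnC.
apply: leq_trans (regular_eventP (i := i) (T := left_over w i) Lw _ _).
- rewrite leq_mul2l subset_leq_card ?orbT //.
  by apply/subsetP => x; rewrite !inE => /andP[+ /eqP hx]; rewrite hx eqxx.
- by apply: subset_trans (subsetDl _ _) (subsetDl _ _).
- by apply: le_trans (left_over_card i cl wB); rewrite ler_wpM2r.
Qed.

Lemma used_reserve p w i : (forall x v, w x = Some v -> g v = h x) ->
  (forall x, isSome (w x) -> x \notin B) -> regular_event w -> sound (starved w) p ->
  #|used p :&: (fibG i :&: Q)|%:R <= D / 4 * q%:R.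
Proof.
move=> wcl wB Lw I; apply: le_trans Q_reserve.
apply: (@le_trans _ _ (#|W :|: (starved w :&: fibH i)|%:R)).
  rewrite ler_nat; apply: used_card => x u px /setIP[ug uQ].
  have xf : x \in fibH i by move: ug; rewrite !inE (sound_class I px).
  by rewrite in_setU in_setI xf andbT (sound_Q I px uQ).
apply: (@le_trans _ _ (#|W|%:R + #|starved w :&: fibH i|%:R)).
  by rewrite -natrD ler_nat leq_card_setU.
by rewrite lerD2l starved_card.
Qed.

(** A vertex that finds its main pool too small is starved with respect to the
final state [w], because its main pool contains, up to forbidden places, its
final candidates in [left_over].  Starved vertices are few on [regular_event],
so the reserve is never exhausted. *)
Lemma phase2 s p w : fresh s p ->
  (forall x, x \in s -> [&& x \notin B, x \notin bufN & x \notin W]) ->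
  (forall x, isSome (p x) -> x \notin B) ->
  sound (starved w) p -> RE s p w -> regular_event w -> sound (starved w) w.
Proof.
elim: s p => [|y s IHs] p fr sP pB I; first by move=> /= e _; rewrite [X in sound _ X]e.
move=> rw Lw; have /and3P[yB yNB yW] := sP y (mem_head _ _).
have py := fresh_head fr.
have wcl := reach_class (sound_class I) rw.
have wB x : isSome (w x) -> x \notin B.
  rewrite (reach_dom x rw) => /orP[/pB//|/sP/and3P[]//].
have pw := reach_ext fr rw.
case: rw => v vo rw; apply: (IHs (place y p v)) => //; first exact: fresh_place.
- by move=> x xs; apply: sP; rewrite in_cons xs orbT.
- by move=> x; rewrite placeE; case: eqP => [->|_]; last exact: pB.
have Zy : zone y = fibG (h y) :&: Q by rewrite /zone (negPf yNB) (negPf yW).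
move: vo; rewrite /choices yNB yW /=; case: ifPn => [_ /main_poolP[vc vQ vu vf]|p1].
  by apply: sound_place => // [yW'|vQ']; [rewrite yW' in yW|rewrite vQ' in vQ].
(* The candidates of [y] at the end lie in its pool or among the forbidden
places. *)
have ySV : y \in starved w.
  rewrite inE /typical -ltNge; move: p1; rewrite -ltNge => p1.
  have f1 := forbidden_card I py.
  have f2 := cardD_ge (cand p y :\: Q :\: used p) (forbidden p y).
  have f3 : #|forbidden p y :&: (cand p y :\: Q :\: used p)|%:R <= #|forbidden p y|%:R :> R.
    by rewrite ler_nat subset_leq_card // subsetIl.
  have f4 : #|cand w y :&: left_over w (h y)|%:R <= #|cand p y :\: Q :\: used p|%:R :> R.
    rewrite ler_nat subset_leq_card //; apply/subsetP => u.
    rewrite !in_setI !in_setD => /andP[uc /and3P[uu -> _]] /=.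
    rewrite (subsetP (ext_cand y pw)) // !andbT; apply: contra uu => /usedP[x px].
    by apply/usedP; exists x; apply: pw.
  have f5 := left_over_card (h y) wcl wB.
  have f6 : D * #|left_over w (h y)|%:R <= d ^+ emb w y * #|left_over w (h y)|%:R.
    by rewrite ler_wpM2r // D_le_emb.
  have f7 : D * (eta * N%:R) <= D * #|left_over w (h y)|%:R by rewrite ler_wpM2l // ltW.
  have f8 : 0 < D * (eta * N%:R) by rewrite !mulr_gt0.
  rewrite c1E in p1; rewrite -/(main_pool y p) in f2; lra.
have us : #|used p :&: zone y|%:R <= D / 4 * #|zone y|%:R.
  by rewrite Zy (setIC (fibG _)) Q_card -(setIC (fibG _)) (used_reserve _ wcl wB Lw I).
rewrite (zone_pool_ge I py us) => /zone_poolP[vc vZ vu vf].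
by apply: sound_place => // [yW'|_]; [rewrite yW' in yW|rewrite ySV orbT].
Qed.

Hypothesis min_deg : forall x y, H x y -> forall v, v \in fibG (h x) ->
  2 * d * N%:R <= #|fibG (h y) :&: nbG v|%:R.
Hypothesis q_small : q%:R <= d * N%:R.
Hypothesis eta_d : eta <= d / 2.
Hypothesis bufN_small : #|bufN|%:R + #|W|%:R <= D * d / 4 * N%:R.
Hypothesis B_sep2 : forall x x' y, x \in B -> x' \in B -> H x y -> H x' y -> x = x'.
Hypothesis B_sep3 : forall x x' y y', x \in B -> x' \in B -> x != x' ->
  H x y -> H x' y' -> ~~ H y y'.

(** * Covering the vertices of the host graph *)

Definition target v y : {set VG} := (fibG (h y) :\: Q) :&: nbG v.

(** The buffer vertex [x] can still be given the place [v]: its placed neighbours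
are adjacent to [v], and its other neighbours have as many candidates in the
neighbourhood of [v] as can be expected. *)
Definition alive p x v : bool :=
  [forall y, H x y ==> (if p y is Some u then G v u else typical p y (target v y))].

Lemma aliveP p x v : reflect
  (forall y, H x y -> if p y is Some u then G v u else typical p y (target v y))
  (alive p x v).
Proof.
apply: (iffP forallP) => [al y xy|al y]; first by have := al y; rewrite xy.
by apply/implyP => /al.
Qed.

Definition pending p x : nat := #|[set y in nbH x | ~~ isSome (p y)]|.

Let p0 : R := D * d / 2.

Let p0_gt0 : 0 < p0. Proof. by rewrite divr_gt0 // mulr_gt0. Qed.
Let p0_le1 : p0 <= 1.
Proof.
have : D * d <= 1 by rewrite mulr_ile1 // ltW.
by rewrite /p0; lra.
Qed.

(** Bounds the expected value of [2 ^- n], where [n] is [1] or [0] according as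
[x] ends up with [v] as a candidate; each pending neighbour is placed well with
probability at least [p0]. *)
Definition cover_weight p x v : R := if alive p x v then 1 - p0 ^+ pending p x / 2 else 1.

Lemma cover_weight01 p x v : 0 <= cover_weight p x v <= 1.
Proof.
rewrite /cover_weight; case: ifP => _; last by rewrite ler01 lexx.
have : 0 <= p0 ^+ pending p x by rewrite exprn_ge0 // ltW.
have : p0 ^+ pending p x <= 1 by rewrite exprn_ile1 // ltW.
set z := p0 ^+ _; lra.
Qed.

Lemma target_ge x y v : H x y -> g v = h x -> d * N%:R <= #|target v y|%:R.
Proof.
move=> xy gv; have vf : v \in fibG (h x) by rewrite inE gv.
have m1 := min_deg xy vf; have m2' := cardD_ge (fibG (h y) :&: nbG v) Q.
have m3 : #|Q :&: (fibG (h y) :&: nbG v)|%:R <= q%:R :> R.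
  by rewrite ler_nat -(Q_card (h y)) subset_leq_card // setIS // subsetIl.
have -> : target v y = (fibG (h y) :&: nbG v) :\: Q by rewrite /target setIDAC.
by have := q_small; lra.
Qed.

(** The choices of [y] that keep [x] alive: candidates in the target, minus the
used, the forbidden, and those that spoil another neighbour of [x]. *)
Lemma alive_count SV p x y v : sound SV p -> early p -> p y = None -> y \in bufN ->
  H x y -> g v = h x -> alive p x v ->
  p0 * N%:R <= #|[set a in choices y p | alive (place y p a) x v]|%:R.
Proof.
move=> I ep py yNB xy gv al.
have yP : (y \in bufN) || (y \in W) by rewrite yNB.
rewrite (choices_zone_pool I py yP (early_used ep yP)).
pose U := \bigcup_(y' in nbH y)
  (if H x y' && ~~ isSome (p y') then [set a in fibG (h y) | ~~ typical (place y p a) y' (target v y')] else set0).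
have target_sub y' : target v y' \subset fibG (h y').
  by apply: subset_trans (subsetIl _ _) (subsetDl _ _).
have U_card : #|U|%:R <= D * eta / 4 * N%:R.
  apply: (@le_trans _ _ (Delta%:R * (eps * N%:R))); last by rewrite mulrA ler_wpM2r.
  apply: union_nbr => [|y' yy']; first by rewrite mulr_ge0.
  case: ifP => [/andP[xy' py']|_]; last by rewrite cards0 mulr_ge0.
  have := aliveP _ _ _ al y' xy'; case py'E: (p y') py' => // _ gd.
  apply: atypical_choices_le => //; apply: epsN_le.
  apply: le_trans (target_ge xy' gv); rewrite ler_wpM2r //.
  by move: eta_d d_gt0; lra.
have sub : (cand p y :&: target v y) :\: used p :\: forbidden p y :\: U
    \subset [set a in zone_pool y p | alive (place y p a) x v].
  apply/subsetP => a; rewrite !in_setD in_setI => /and4P[aU af au /andP[ac at_]].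
  have [aQ av] := setIP at_.
  have aZ : a \in zone y by rewrite /zone yNB.
  rewrite inE !in_setD in_setI af au ac aZ /=; apply/aliveP => z xz.
  rewrite placeE; case: eqP => [_|/eqP zy]; first by rewrite inE in av.
  have := aliveP _ _ _ al z xz; case pz: (p z) => [u|] // gd.
  have [yz|yz] := boolP (H y z); last by rewrite typical_place_same 1?H_sym.
  apply: contraR aU => ng; apply/bigcupP; exists z; first by rewrite inE.
  by rewrite xz pz /= inE ng (subsetP (cand_sub p y)).
have gy : typical p y (target v y) by have := aliveP _ _ _ al y xy; rewrite py.
have c1' := typicalD gy; have c2 := target_ge xy gv; have c3 := forbidden_card I py.
have c4 := cardD_ge (cand p y :&: target v y) (used p).
have c5 := cardD_ge ((cand p y :&: target v y) :\: used p) (forbidden p y).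
have c6 := cardD_ge ((cand p y :&: target v y) :\: used p :\: forbidden p y) U.
have c7 : #|used p :&: (cand p y :&: target v y)|%:R <= D * d / 4 * N%:R.
  apply: le_trans bufN_small; apply: (@le_trans _ _ (#|bufN :|: W|%:R)); last first.
    by rewrite -natrD ler_nat leq_card_setU.
  by rewrite ler_nat; apply: used_card => z u pz _; rewrite in_setU; apply: ep; rewrite pz.
have c8 : #|forbidden p y :&: ((cand p y :&: target v y) :\: used p)|%:R <= #|forbidden p y|%:R :> R.
  by rewrite ler_nat subset_leq_card // subsetIl.
have c9 : #|U :&: ((cand p y :&: target v y) :\: used p :\: forbidden p y)|%:R <= #|U|%:R :> R.
  by rewrite ler_nat subset_leq_card // subsetIl.
have c10 : D * (d * N%:R) <= D * #|target v y|%:R by rewrite ler_wpM2l // ltW.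
have c11 : D * eta / 2 * N%:R <= D * d / 4 * N%:R.
  rewrite ler_wpM2r //; have : D * eta <= D * (d / 2) by rewrite ler_wpM2l // ltW.
  lra.
apply: (@le_trans _ _ (#|cand p y :&: target v y :\: used p :\: forbidden p y :\: U|%:R)); last first.
  by rewrite ler_nat subset_leq_card.
rewrite /p0; lra.
Qed.

Lemma pending_place p x y a : H x y -> p y = None -> pending p x = (pending (place y p a) x).+1.
Proof.
move=> xy py; rewrite /pending.
have -> : [set z in nbH x | ~~ isSome (p z)] =
          y |: [set z in nbH x | ~~ isSome (place y p a z)].
  by apply/setP => z; rewrite !inE placeE; case: eqP => [->|_]; rewrite ?xy ?py.
by rewrite cardsU1 !inE placeE eqxx /= andbF.
Qed.

Definition cover_potential v p : R := \prod_(x in B | h x == g v) cover_weight p x v.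

Definition sound_early (s : seq VH) p : Prop :=
  [/\ fresh s p, {subset s <= bufN}, sound setT p & early p].

(** Placing [y] only concerns the buffer vertex adjacent to [y]: any other buffer
vertex is too far away for its neighbours to be, or to be adjacent to, [y]. *)
Lemma cover_potential_step v y s p : sound_early (y :: s) p ->
  \sum_(a in choices y p) cover_potential v (place y p a) <= #|choices y p|%:R * cover_potential v p.
Proof.
move=> [fr sNB I ep]; have py := fresh_head fr; have yNB := sNB y (mem_head _ _).
have := yNB; rewrite inE => /exists_inP[x0 x0B x0y].
have same x a : x \in B -> x != x0 -> cover_weight (place y p a) x v = cover_weight p x v.
  move=> xB xx0; have nxy z : H x z -> z != y.
    by move=> xz; apply: contraNneq xx0 => zy; apply/eqP/(B_sep2 xB x0B _ x0y); rewrite -zy.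
  rewrite /cover_weight; have -> : pending (place y p a) x = pending p x.
    apply: eq_card => z; rewrite !inE placeE; have [xz|//] := boolP (H x z).
    by rewrite (negPf (nxy z xz)).
  congr (if _ then _ else _); apply: eq_forallb => z.
  have [xz|//] := boolP (H x z); rewrite placeE (negPf (nxy z xz)) /=.
  case: (p z) => // ; apply: typical_place_same; exact: B_sep3 xB x0B xx0 xz x0y.
have [hx0|hx0] := boolP (h x0 == g v); last first.
  rewrite mulr_natl -sumr_const; apply: ler_sum => a _.
  rewrite le_eqVlt; apply/orP; left; apply/eqP/eq_bigr => x /andP[xB hx].
  by apply: same => //; apply: contraNneq hx0 => <-.
have PE p' : cover_potential v p' = cover_weight p' x0 v *
    \prod_(x in B | (h x == g v) && (x != x0)) cover_weight p' x v.
  rewrite /cover_potential (bigD1 x0) ?x0B //=; congr (_ * _); apply: eq_bigl => x.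
  by rewrite -andbA.
have eqo a : \prod_(x in B | (h x == g v) && (x != x0)) cover_weight (place y p a) x v =
             \prod_(x in B | (h x == g v) && (x != x0)) cover_weight p x v.
  by apply: eq_bigr => x /and3P[xB _ xx0]; apply: same.
under eq_bigr => a _ do rewrite PE eqo.
rewrite -mulr_suml PE mulrA ler_wpM2r ?prodr_ge0 //.
  by move=> x _; case/andP: (cover_weight01 p x v).
rewrite {2}/cover_weight; case: ifPn => [al|_]; last first.
  rewrite mulr_natl -sumr_const; apply: ler_sum => a _.
  by case/andP: (cover_weight01 (place y p a) x0 v).
have gv : g v = h x0 by apply/esym/eqP.
have cnt := alive_count I ep py yNB x0y gv al.
set Al := [set a in choices y p | _] in cnt.
have [n nE] : exists n, forall a, pending p x0 = n.+1 /\ pending (place y p a) x0 = n.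
  exists (pending p x0).-1 => a; by have := pending_place a x0y py => ->.
have ub a : a \in choices y p -> cover_weight (place y p a) x0 v <= 1 - (if a \in Al then p0 ^+ n / 2 else 0).
  move=> ao; rewrite /cover_weight inE ao /=; have [_ ->] := nE a.
  by case: ifP; rewrite ?subr0.
apply: le_trans (ler_sum _ ub) _; rewrite big_split /= sumr_const sumrN -big_mkcondr /=.
rewrite (eq_bigl (mem Al)) => [|a]; last by rewrite !inE andbA andbb.
have [-> _] : pending p x0 = n.+1 /\ True.
  case: (set_0Vmem (choices y p)) => [o0|[a _]]; last by split=> //; case: (nE a).
  by have := choices_gt0 y p; rewrite o0 cards0.
rewrite sumr_const -(mulr_natl (_ / _)) exprS.
have oN : #|choices y p|%:R <= N%:R :> R.
  by rewrite ler_nat -(fibG_card (h y)) subset_leq_card // choices_sub.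
have pn0 : 0 <= p0 ^+ n by rewrite exprn_ge0 // ltW.
have : p0 * #|choices y p|%:R * p0 ^+ n <= #|Al|%:R * p0 ^+ n.
  by rewrite ler_wpM2r // (le_trans _ cnt) // ler_wpM2l // ltW.
set o : R := #|choices y p|%:R; set A : R := #|Al|%:R; set z := p0 ^+ n; lra.
Qed.

Lemma cover_potential_le v s p : sound_early s p -> EX s p (cover_potential v) <= cover_potential v p.
Proof.
apply: (@Ex_potential R _ _ _ choices place sound_early (fun _ => cover_potential v) s p).
move=> y s' p' I; split; [exact: choices_gt0| |exact: cover_potential_step I].
case: I => fr sNB I ep a ao.
have yP : (y \in bufN) || (y \in W) by rewrite sNB ?mem_head.
have [I' ep'] := phase1_step I ep (fresh_head fr) yP ao.
split=> //; first exact: fresh_place.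
by move=> x xs; apply: sNB; rewrite in_cons xs orbT.
Qed.

(** * The whole process *)

Definition steps : seq VH := enum bufN ++ (enum W ++ enum (~: (B :|: bufN :|: W))).
Definition pinit : state := [ffun=> None].

Hypothesis B_indep : forall x y, x \in B -> y \in B -> ~~ H x y.
Hypothesis BW : B :&: W = set0.

Lemma in_bufN x y : x \in B -> H x y -> y \in bufN.
Proof. by move=> xB xy; rewrite inE; apply/exists_inP; exists x. Qed.

Lemma bufN_notB x : x \in bufN -> x \notin B.
Proof. by rewrite inE => /exists_inP[y yB yx]; apply: contraL yx => xB; apply: B_indep. Qed.

Lemma W_notB x : x \in W -> x \notin B.
Proof. by move=> xW; move/setP/(_ x): BW; rewrite !inE xW andbT => ->. Qed.

Lemma W_notbufN x : x \in W -> x \notin bufN.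
Proof. by move=> xW; move/setP/(_ x): bufNW; rewrite in_setI xW andbT in_set0 => ->. Qed.

Lemma mem_steps x : (x \in steps) = (x \notin B).
Proof.
rewrite !mem_cat !mem_enum !in_setC !in_setU !negb_or.
have [/bufN_notB -> //|_] := boolP (x \in bufN); rewrite andbT /=.
by have [/W_notB -> //|_] := boolP (x \in W); rewrite andbT.
Qed.

Lemma steps_uniq : uniq steps.
Proof.
rewrite !cat_uniq !enum_uniq /= andbT; apply/andP; split; rewrite -all_predC; apply/allP => x /=.
  rewrite mem_cat !mem_enum => /orP[/W_notbufN //|]; rewrite in_setC !in_setU !negb_or.
  by case/andP=> /andP[].
by rewrite !mem_enum in_setC !in_setU !negb_or => /andP[].
Qed.

Lemma pinitE x : pinit x = None. Proof. by rewrite ffunE. Qed.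

Lemma typical_init x T : T \subset fibG (h x) -> typical pinit x T.
Proof.
move=> TP; rewrite /typical; have -> : emb pinit x = 0%N.
  by apply/eqP; rewrite cards_eq0; apply/eqP/setP => y; rewrite !inE pinitE andbF.
rewrite expr0 mul1r ler_nat subset_leq_card // subsetI subxx andbT.
apply: subset_trans TP _; apply/subsetP => v vf; apply/candP; split.
  by apply/eqP; rewrite inE in vf.
by move=> y u _; rewrite pinitE.
Qed.

Lemma sound_init SV : sound SV pinit.
Proof.
by split=> [x v|x y v|x y u v _|x _|x v _|x v]; rewrite ?pinitE //; exact/typical_init/zone_sub.
Qed.

Lemma early_init : early pinit. Proof. by move=> x; rewrite pinitE. Qed.

Lemma greedy_sound w : RE steps pinit w -> regular_event w ->
  sound (starved w) w /\ (forall x, isSome (w x) = (x \notin B)).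
Proof.
move=> rw Lw; split; last first.
  by move=> x; rewrite (reach_dom x rw) pinitE mem_steps.
have fr : fresh steps pinit by split; [exact: steps_uniq|move=> x _; apply: pinitE].
move: rw; rewrite /steps catA => /reach_cat[p1 r1 r2].
have [I1 e1] : sound (starved w) p1 /\ early p1.
  apply: phase1 r1; [|by move=> x; rewrite mem_cat !mem_enum in_setU|exact: sound_init|exact: early_init].
  split; last by move=> x _; apply: pinitE.
  by have := steps_uniq; rewrite /steps catA cat_uniq => /andP[].
apply: phase2 r2 Lw => // [|x|x p1x].
- split; first exact: enum_uniq.
  move=> x; rewrite mem_enum in_setC !in_setU !negb_or => /andP[/andP[_ xNB] xW].
  by case px: (p1 x) => //; have := e1 x; rewrite px (negPf xNB) (negPf xW) => /(_ isT).
- by rewrite mem_enum in_setC !in_setU !negb_or => /andP[/andP[-> ->] ->].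
- by case/orP: (e1 x p1x) => [/bufN_notB|/W_notB].
Qed.

Variables (k : nat).

Definition covered_event w : bool :=
  [forall v, (k <= #|[set x in B | (h x == g v) && (v \in cand w x)]|)%N].

(** Once the neighbours of the buffer are placed the potential is [2 ^- n], with
[n] the number of alive buffer vertices, and these keep [v] as a candidate
until the end; Markov's inequality concludes. *)
Lemma uncovered_tail v :
  EX steps pinit (fun w => (#|[set x in B | (h x == g v) && (v \in cand w x)]| < k)%N%:R)
    <= 2 ^+ k * (1 - p0 ^+ Delta / 2) ^+ b.
Proof.
set F := fun w => _; rewrite /steps Ex_cat.
have vpot_ge0 p : 0 <= cover_potential v p.
  by apply: prodr_ge0 => x _; case/andP: (cover_weight01 p x v).
have frs : fresh (enum bufN) pinit by split; [exact: enum_uniq|move=> x _; apply: pinitE].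
have i1 : sound_early (enum bufN) pinit.
  by split=> //; [move=> x; rewrite mem_enum|exact: sound_init|exact: early_init].
apply: (@le_trans _ _ (EX (enum bufN) pinit (fun p => 2 ^+ k * cover_potential v p))).
  apply: Ex_le => p rp.
  rewrite -[leRHS](@Ex_cst R _ _ _ choices place (enum W ++ enum (~: (B :|: bufN :|: W))) p); last first.
    by move=> *; apply: choices_gt0.
  apply: Ex_le => w rw; rewrite /F; case: ltnP => [lt|_]; last by rewrite mulr_ge0 ?exprn_ge0.
  have pNB x : x \in bufN -> exists u, p x = Some u.
    move=> xNB; have := reach_dom x rp; rewrite mem_enum xNB orbT.
    by case: (p x) => // u _; exists u.
  have wp : ext p w.
    apply: reach_ext rw; split; first by have := steps_uniq; rewrite cat_uniq => /and3P[].
    move=> x xs; have := reach_dom x rp; rewrite pinitE mem_enum /=.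
    have := steps_uniq; rewrite cat_uniq => /and3P[_ /hasPn/(_ x xs) /=]; rewrite mem_enum => /negPf-> _.
    by case: (p x).
  have uvalE x : x \in B -> cover_weight p x v = if alive p x v then 2^-1 else 1.
    move=> xB; rewrite /cover_weight; have -> : pending p x = 0%N.
      apply/eqP; rewrite cards_eq0; apply/eqP/setP => y; rewrite !inE.
      by have [xy|//] := boolP (H x y); have [u ->] := pNB y (in_bufN xB xy).
    by rewrite expr0; case: ifP => // _; lra.
  set S := [set x in B | _] in lt.
  pose S' := [set x in B | (h x == g v) && alive p x v].
  have S'S : S' \subset S.
    apply/subsetP => x; rewrite !inE => /and3P[xB hx al]; rewrite xB hx eq_sym hx /=.
    apply/forallP => y; apply/implyP => xy; have [u pu] := pNB y (in_bufN xB xy).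
    by rewrite (wp y u pu); have := aliveP _ _ _ al y xy; rewrite pu G_sym.
  have -> : cover_potential v p = 2^-1 ^+ #|S'|.
    rewrite /cover_potential -prodr_const [RHS]big_mkcond [LHS]big_mkcond /=; apply: eq_bigr => x _.
    rewrite [x \in S']inE; case: (boolP (x \in B)) => //= xB; case: (h x == g v) => //=.
    by rewrite uvalE.
  apply: (@le_trans _ _ (2 ^+ k * 2^-1 ^+ k)).
    by rewrite -exprMn divff ?expr1n ?pnatr_eq0.
  rewrite ler_wpM2l ?exprn_ge0 // ler_wiXn2l //; try lra.
  exact: leq_trans (subset_leq_card S'S) (ltnW lt).
rewrite ExZ ler_wpM2l ?exprn_ge0 // (le_trans (cover_potential_le v i1)) //.
have nle : #|[set x in B | h x == g v]| = b.
  by rewrite -(B_card (g v)); apply: eq_card => x; rewrite !inE.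
rewrite -nle -prodr_const (eq_bigl (fun x => (x \in B) && (h x == g v))) => [|x]; last by rewrite !inE.
apply: ler_prod => x /andP[xB hx]; have /andP[-> _] := cover_weight01 pinit x v.
rewrite /cover_weight ifT; last first.
  apply/aliveP => y xy; rewrite pinitE; apply: typical_init.
  by apply: subset_trans (subsetIl _ _) (subsetDl _ _).
have : p0 ^+ Delta <= p0 ^+ pending pinit x.
  rewrite ler_wiXn2l ?(ltW p0_gt0) //; apply: leq_trans (degH x).
  by apply: subset_leq_card; apply/subsetP => y; rewrite inE => /andP[].
set z := _ ^+ pending _ _; set z' := _ ^+ Delta; rewrite /=; lra.
Qed.

Hypothesis eps_tau : eps <= D * tau.
Hypothesis growth_small : (1 + (16 ^+ m2) ^+ Delta * (Delta%:R * eps) / c1) ^+ r <= 2.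

Lemma cardVH : #|VH| = (r * N)%N.
Proof.
rewrite -sum1_card (partition_big h xpredT) //= (eq_bigr (fun=> N)).
  by rewrite sum_nat_const card_ord.
by move=> i _; rewrite -(fibH_card i) -sum1_card; apply: eq_bigl => x; rewrite inE.
Qed.

Lemma cardVG : #|VG| = (r * N)%N.
Proof.
rewrite -sum1_card (partition_big g xpredT) //= (eq_bigr (fun=> N)).
  by rewrite sum_nat_const card_ord.
by move=> i _; rewrite -(fibG_card i) -sum1_card; apply: eq_bigl => x; rewrite inE.
Qed.

(** Markov's inequality for [K ^+ n] with [K = 16 ^+ m2]: more than [N / m2]
atypical vertices make this at least [16 ^+ N], while its expected value is at
most [2 ^+ N]. *)
Lemma irregular_tail i T : T \subset fibG i -> tau * N%:R <= #|T|%:R ->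
  EX steps pinit (fun w => (N < m2 * #|atypical i T w|)%N%:R) <= 8^-1 ^+ N.
Proof.
move=> TP Tge; set K : R := 16 ^+ m2.
have K1 : 1 <= K by rewrite exprn_ege1 //; lra.
pose th := K ^+ Delta * (Delta%:R * eps) / c1.
have thS : (1 + th) ^+ r <= 2 := growth_small.
have th0 : 0 <= th by rewrite divr_ge0 ?mulr_ge0 ?exprn_ge0 ?ler0n ?(ltW c1_gt0) //; lra.
have eT : eps * N%:R <= D * #|T|%:R.
  apply: (@le_trans _ _ (D * (tau * N%:R))); last by rewrite ler_wpM2l // ltW.
  by rewrite mulrA ler_wpM2r.
have fr : fresh steps pinit by split; [exact: steps_uniq|move=> x _; apply: pinitE].
have tail := atypical_tail K1 TP eT fr.
have b0 : atypical i T pinit = set0.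
  apply/setP => x; rewrite !inE; apply/negP => /andP[/eqP hx /negP[]].
  by apply: typical_init; rewrite hx.
rewrite b0 cards0 expr0 mulr1 -/th in tail.
have tail2 : (1 + th) ^+ size steps <= 2 ^+ N.
  apply: (@le_trans _ _ ((1 + th) ^+ (r * N))).
    rewrite ler_weXn2l //; first lra.
    rewrite -cardVH cardE uniq_leq_size ?steps_uniq // => x _; exact: mem_enum.
  by rewrite exprM lerXn2r ?nnegrE ?exprn_ge0 //; lra.
apply: (@le_trans _ _ (EX steps pinit (fun w => 16^-1 ^+ N * K ^+ #|atypical i T w|))).
  apply: Ex_le => w _; case: ltnP => lt; last by rewrite mulr_ge0 ?exprn_ge0 // ?invr_ge0.
  rewrite /K -exprM; apply: (@le_trans _ _ (16^-1 ^+ N * 16 ^+ N)).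
    by rewrite -exprMn (_ : 16^-1 * 16 = 1) ?expr1n //; field.
  rewrite ler_wpM2l ?exprn_ge0 ?invr_ge0 // ler_weXn2l //; first lra.
  exact: ltnW.
rewrite ExZ; apply: (@le_trans _ _ (16^-1 ^+ N * 2 ^+ N)).
  by rewrite ler_wpM2l ?exprn_ge0 ?invr_ge0 // (le_trans tail).
by rewrite -exprMn (_ : 16^-1 * 2 = 8^-1) //; field.
Qed.

Hypothesis irregular_small : r%:R * 4^-1 ^+ N <= 4^-1 :> R.
Hypothesis uncovered_small : (r * N)%:R * (2 ^+ k * (1 - p0 ^+ Delta / 2) ^+ b) <= 4^-1.

(** There are at most [2 ^ N] sets [T] in each class and [r * N] vertices [v]. *)
Lemma good_event_half : 2^-1 <= EX steps pinit (fun w => (regular_event w && covered_event w)%:R).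
Proof.
pose F1 w : R := \sum_(i < r) \sum_(T : {set VG} | (T \subset fibG i) && (tau * N%:R <= #|T|%:R))
   (N < m2 * #|atypical i T w|)%N%:R.
pose F2 w : R := \sum_(v : VG) (#|[set x in B | (h x == g v) && (v \in cand w x)]| < k)%N%:R.
have F1_ge0 w : 0 <= F1 w by rewrite sumr_ge0 // => i _; rewrite sumr_ge0 // => T _; apply: ler0n.
have F2_ge0 w : 0 <= F2 w by rewrite sumr_ge0 // => v _; apply: ler0n.
have le1 : 1 <= EX steps pinit (fun w => (regular_event w && covered_event w)%:R + (F1 w + F2 w)).
  rewrite -[leLHS](@Ex_cst R _ _ _ choices place steps pinit); last by move=> *; apply: choices_gt0.
  apply: Ex_le => w _.
  have [Lw|nL] := boolP (regular_event w); last first.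
    suff : 1 <= F1 w by have := F2_ge0 w; rewrite /=; lra.
    move: nL; rewrite negb_forall => /existsP[i]; rewrite negb_forall => /existsP[T].
    rewrite !negb_imply -ltnNge => /and3P[TP Tge lt].
    rewrite /F1 (bigD1 i) //= (bigD1 T) /= ?TP // lt -addrA lerDl addr_ge0 ?sumr_ge0 //.
    by move=> j _; apply: sumr_ge0.
  have [Vw|nV] := boolP (covered_event w).
    by have := F1_ge0 w; have := F2_ge0 w; rewrite /=; lra.
  suff : 1 <= F2 w by have := F1_ge0 w; rewrite /=; lra.
  move: nV; rewrite negb_forall => /existsP[v]; rewrite -ltnNge => lt.
  by rewrite /F2 (bigD1 v) //= lt lerDl sumr_ge0.
have E1 : EX steps pinit F1 <= 4^-1.
  apply: le_trans irregular_small; rewrite Ex_sum.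
  have -> : r%:R * 4^-1 ^+ N = \sum_(i < r) 4^-1 ^+ N :> R.
    by rewrite sumr_const card_ord mulr_natl.
  apply: ler_sum => i _; rewrite Ex_sum.
  apply: (@le_trans _ _ (\sum_(T : {set VG} | T \subset fibG i) 8^-1 ^+ N)).
    rewrite [leLHS](bigID (fun T : {set VG} => tau * N%:R <= #|T|%:R)) /=.
    rewrite [leRHS](bigID (fun T : {set VG} => tau * N%:R <= #|T|%:R)) /= lerD //.
      rewrite (eq_bigl (fun T : {set VG} => (T \subset fibG i) && (tau * N%:R <= #|T|%:R))).
        by apply: ler_sum => T /andP[TP Tge]; apply: irregular_tail.
      by move=> T; rewrite -andbA andbb.
    rewrite big_pred0 => [|T]; last by rewrite -andbA andbN andbF.
    by rewrite sumr_ge0 // => T _; rewrite exprn_ge0 // invr_ge0.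
  rewrite (eq_bigl (fun T : {set VG} => T \in powerset (fibG i))) => [|T]; last first.
    by rewrite powersetE.
  rewrite sumr_const card_powerset fibG_card -[leLHS]mulr_natl natrX -exprMn.
  by rewrite (_ : 2 * 8^-1 = 4^-1 :> R) //; field.
have E2 : EX steps pinit F2 <= 4^-1.
  apply: le_trans uncovered_small; rewrite Ex_sum -cardVG.
  set z := _ * (1 - _) ^+ b.
  have -> : #|VG|%:R * z = \sum_(v : VG) z by rewrite sumr_const mulr_natl.
  by apply: ler_sum => v _; apply: uncovered_tail.
move: le1 E1 E2; rewrite !ExD.
move: (EX _ _ F1) (EX _ _ F2) (EX _ _ _) => a1 a2 a3 {F1 F2 F1_ge0 F2_ge0}.
lra.
Qed.

(** * Completion by a matching *)

Variables (c' C2 : R).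
Hypothesis b_gt0 : (0 < b)%N.
Hypothesis C2_ge0 : 0 <= C2.
Hypothesis match_c : matching_constant r c' D C2.
Hypothesis c'_q : c' * b%:R <= D / 2 * q%:R.
Hypothesis c'_k : c' * b%:R <= k%:R.
Hypothesis c'_tau : tau * N%:R <= c' / 2 * b%:R.
Hypothesis c'_m2 : N%:R / m2%:R <= c' / 4 * b%:R.

Lemma used_fib_card w i : RE steps pinit w -> regular_event w ->
  #|used w :&: fibG i| = (N - b)%N.
Proof.
move=> rw Lw; have [I dw] := greedy_sound rw Lw.
have -> : (N - b)%N = #|fibH i :\: B|.
  by rewrite cardsD fibH_card setIC B_card.
rewrite -(card_imset (mem (used w :&: fibG i)) (@Some_inj _)).
have dom x : x \in fibH i :\: B -> exists v, w x = Some v.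
  by rewrite inE => /andP[xB _]; move: (dw x); rewrite xB; case: (w x) => // v _; exists v.
rewrite -(@card_in_imset _ _ (fun x => w x) (mem (fibH i :\: B))); last first.
  by move=> x y /dom[v wx] /dom[u wy] e; apply: (sound_inj I wx); rewrite -e.
apply: eq_card => o; apply/imsetP/imsetP => [[v /setIP[/usedP[x wx] vi] ->]|[x xf ->]].
  exists x => //; rewrite !inE; have := dw x; rewrite wx => <- /=.
  by move: vi; rewrite inE (sound_class I wx).
have [v wx] := dom x xf; rewrite wx; exists v => //; rewrite inE; apply/andP; split.
  by apply/usedP; exists x.
by move: xf; rewrite !inE (sound_class I wx) => /andP[].
Qed.

(** The unused vertices are in number [b] in every class by injectivity.  The
degrees of buffer vertices come from the reserve [Q], those of the unused
vertices from [covered_event], lower regularity from [regular_event]. *)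
Lemma left_matching (def : {ffun VH -> VG}) w : RE steps pinit w -> regular_event w && covered_event w ->
  exists nu : fdist R {ffun VH -> VG},
    (forall f, nu f != 0 ->
       [/\ forall x, x \notin B -> w x = Some (f x),
           forall x, x \in B -> f x \notin used w /\ f x \in cand w x &
           {in B &, injective f}]) /\
    forall (l : nat) (x : 'I_l -> VH) (y : 'I_l -> VG), injective x -> injective y ->
      Pr nu (fun f => [forall i, (x i \in B) ==> (f (x i) == y i)]) <=
        2 * \prod_i (if x i \in B then C2 / b%:R else 1).
Proof.
move=> rw /andP[Lw /forallP Vw]; have [I dw] := greedy_sound rw Lw.
have wB x : isSome (w x) -> x \notin B by rewrite dw.
have wcl := sound_class I.
pose f0 : {ffun VH -> VG} := [ffun x => odflt (def x) (w x)].
have [|i|i|x xB|v vL|i T TP Tge|] := @match_c VH VG h g B (~: used w)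
  (fun x v => v \in cand w x) b b_gt0 _ _ _ _ _ _ f0.
- by move=> x v /candP[].
- by rewrite -(B_card i); apply: eq_card => x; rewrite !inE.
- have -> : [set v in ~: used w | g v == i] = fibG i :\: used w.
    by apply/setP => v; rewrite !inE.
  rewrite cardsD fibG_card setIC (used_fib_card i rw Lw) subKn //.
  by rewrite -(B_card i) -(fibH_card i) subset_leq_card // subsetIr.
- have ZE : zone x = Q :&: fibG (h x).
    rewrite /zone (negPf (contraL (@bufN_notB x) xB)) (negPf (contraL (@W_notB x) xB)).
    by rewrite setIC.
  have wx : w x = None by have := dw x; rewrite xB; case: (w x).
  have g1 := typicalD (sound_zone I wx); rewrite ZE Q_card in g1.
  have g2 := used_reserve (h x) wcl wB Lw I.
  have g3 := cardD_ge (cand w x :&: (Q :&: fibG (h x))) (used w).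
  have g4 : #|used w :&: (cand w x :&: (Q :&: fibG (h x)))|%:R
      <= #|used w :&: (fibG (h x) :&: Q)|%:R :> R.
    by rewrite (setIC (fibG _)) ler_nat subset_leq_card // setIS // subsetIr.
  have g5 : #|cand w x :&: (Q :&: fibG (h x)) :\: used w|%:R
      <= #|[set v in ~: used w | v \in cand w x]|%:R :> R.
    rewrite ler_nat subset_leq_card //; apply/subsetP => v.
    by rewrite in_setD in_setI inE in_setC => /andP[-> /andP[->]].
  have g6 := c'_q; have g7 : 0 <= D * q%:R by rewrite mulr_ge0 // ltW.
  lra.
- apply: le_trans c'_k _; rewrite ler_nat; apply: leq_trans (Vw v) _.
  apply: subset_leq_card; apply/subsetP => x; rewrite !inE => /and3P[-> _ ->] //.
- apply: le_trans c'_m2; rewrite ler_pdivlMr ?ltr0n // -natrM ler_nat mulnC.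
  have TP' : T \subset fibG i.
    by apply: subset_trans TP _; apply/subsetP => v; rewrite !inE => /andP[].
  apply: leq_trans (regular_eventP Lw TP' (le_trans c'_tau Tge)).
  rewrite leq_mul2l subset_leq_card ?orbT //; apply/subsetP => x.
  rewrite inE => /and3P[xB hx lt]; rewrite 2!inE hx /=.
  apply: contraTN lt => /typicalD; rewrite -leNgt => /le_trans; apply.
  by rewrite ler_nat subset_leq_card //; apply/subsetP => v; rewrite !inE andbC.
move=> nu [nuS nuP]; exists nu; split=> // f /nuS[f1 f2 f3]; split=> // [x xB|x /f2[fL fc]].
  by rewrite f1 // ffunE; have := dw x; rewrite xB; case: (w x).
by rewrite -in_setC.
Qed.

Theorem greedy_dist (def : {ffun VH -> VG}) :
  exists lambda : fdist R {ffun VH -> VG},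
  (forall f, lambda f != 0 ->
     [/\ injective f, forall x y, H x y -> G (f x) (f y),
         forall x, g (f x) = h x & forall x, x \in W -> f x \in Wf x]) /\
  forall (l : nat) (x : 'I_l -> VH) (y : 'I_l -> VG), injective x -> injective y ->
    Pr lambda (fun f => [forall i, f (x i) == y i])
      <= 4 * \prod_i (if x i \in B then C2 / b%:R else (c1 * N%:R)^-1).
Proof.
have ex w : exists nu : fdist R {ffun VH -> VG},
    RE steps pinit w -> regular_event w && covered_event w ->
    (forall f, nu f != 0 ->
       [/\ forall x, x \notin B -> w x = Some (f x),
           forall x, x \in B -> f x \notin used w /\ f x \in cand w x &
           {in B &, injective f}]) /\
    forall (l : nat) (x : 'I_l -> VH) (y : 'I_l -> VG), injective x -> injective y ->
      Pr nu (fun f => [forall i, (x i \in B) ==> (f (x i) == y i)]) <=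
        2 * \prod_i (if x i \in B then C2 / b%:R else 1).
  have [ok|nok] := boolP (regular_event w && covered_event w); last by exists (dirac R def).
  have [rw|nrw] := boolp.pselect (RE steps pinit w); last by exists (dirac R def).
  by have [nu nuP] := left_matching def rw ok; exists nu.
have [nu nuP] := fin_all_exists ex.
have [lambda [lS lP]] := Ex_mixture nu good_event_half.
exists lambda; split=> [f /lS[w [rw ok nf]]|l x y xI yI].
  have [nuS _] := nuP w rw ok; have [f1 f2 f3] := nuS f nf.
  have /andP[Lw _] := ok; have [I dw] := greedy_sound rw Lw.
  have fcl x : g (f x) = h x.
    have [xB|xB] := boolP (x \in B); last exact: (sound_class I (f1 x xB)).
    by have [_ /candP[]] := f2 x xB.
  split=> // [x y e|x y xy|x xW]; last first.
  - by apply: (sound_W I xW); apply: f1; apply: W_notB.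
  - have [xB|xB] := boolP (x \in B); have [yB|yB] := boolP (y \in B).
    + by have := B_indep xB yB; rewrite xy.
    + by have [_ /candP[_ A]] := f2 x xB; rewrite G_sym; apply: A xy (f1 y yB).
    + have [_ /candP[_ A]] := f2 y yB; apply: A (f1 x xB); by rewrite H_sym.
    + exact: (sound_hom I xy (f1 x xB) (f1 y yB)).
  - have [xB|xB] := boolP (x \in B); have [yB|yB] := boolP (y \in B).
    + exact: f3.
    + have [/negP[]] := f2 x xB; apply/usedP; exists y; rewrite e; exact: f1.
    + have [/negP[]] := f2 y yB; apply/usedP; exists x; rewrite -e; exact: f1.
    + by apply: (sound_inj I (f1 x xB)); rewrite e; apply: f1.
set PB := \prod_i (if x i \in B then C2 / b%:R else 1).
pose M w : R := \prod_i (if w (x i) is Some v then (v == y i)%:R else 1).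
have PB0 : 0 <= PB by apply: prodr_ge0 => i _; case: ifP => // _; rewrite divr_ge0.
have M0 w : 0 <= M w by apply: prodr_ge0 => i _; case: (w _).
apply: le_trans (lP _) _.
apply: (@le_trans _ _ (2 * EX steps pinit (fun w => 2 * PB * M w))).
  rewrite ler_pM2l //; apply: Ex_le => w rw.
  have [ok|_] := boolP (regular_event w && covered_event w); last by rewrite mul0r !mulr_ge0.
  have /andP[Lw _] := ok; have [I dw] := greedy_sound rw Lw.
  rewrite mul1r; have [nuS nuQ] := nuP w rw ok.
  case: (boolP [forall i, (x i \notin B) ==> (w (x i) == Some (y i))]) => [/forallP al|nal].
    have -> : M w = 1.
      apply: big1 => i _; have /implyP := al i; rewrite -dw.
      by case: (w (x i)) => // v /(_ isT)/eqP[->]; rewrite eqxx.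
    rewrite mulr1; apply: le_trans (nuQ l x y xI yI).
    rewrite /Pr [leLHS]big_mkcond [leRHS]big_mkcond; apply: ler_sum => f _.
    case: (boolP [forall i, f (x i) == y i]) => [/forallP fa|_].
      by rewrite ifT //; apply/forallP => i; rewrite fa implybT.
    by case: ifP => // _; apply: mass_ge0.
  rewrite [leLHS](_ : _ = 0) ?mulr_ge0 // /Pr big1 // => f /forallP fa.
  apply/eqP; apply: contraNT nal => /nuS[f1 _ _].
  by apply/forallP => i; apply/implyP => /f1 ->; rewrite (eqP (fa i)).
rewrite ExZ mulrA; apply: (@le_trans _ _ (2 * (2 * PB) * \prod_i (if x i \in steps then (c1 * N%:R)^-1 else 1))).
  rewrite ler_wpM2l ?mulr_ge0 //; apply: greedy_spread => //; [exact: pinitE|exact: steps_uniq].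
rewrite !mulrA (_ : 2 * 2 = 4 :> R); last by rewrite -natrM.
rewrite -mulrA ler_pM2l // le_eqVlt; apply/orP; left; apply/eqP.
rewrite -big_split /=; apply: eq_bigr => i _; rewrite mem_steps.
by case: (x i \in B); rewrite /= ?mulr1 ?mul1r.
Qed.

End Greedy.

(** * Choice of the buffer *)

Section Buffer.

Variables (VH : finType) (r N Delta : nat) (H : rel VH) (h : VH -> 'I_r).
Hypothesis H_sym : symmetric H.
Hypothesis degH : forall x, (#|nbH H x| <= Delta)%N.
Hypothesis fibH_card : forall i, #|fibH h i| = N.

(** Closed neighbourhood; three iterations give the balls of radius three. *)
Definition closed_nb (S : {set VH}) : {set VH} := S :|: \bigcup_(x in S) nbH H x.

Lemma closed_nb_card S : (#|closed_nb S| <= Delta.+1 * #|S|)%N.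
Proof.
apply: leq_trans (leq_card_setU _ _) _; rewrite mulSn leq_add2l.
apply: leq_trans (card_bigcup_le _ _) _.
apply: (@leq_trans (\sum_(x in S) Delta)); first by apply: leq_sum => x _; apply: degH.
by rewrite sum_nat_const mulnC.
Qed.

Lemma sub_closed_nb (S : {set VH}) x : x \in S -> x \in closed_nb S.
Proof. by rewrite in_setU => ->. Qed.

Lemma nb_closed_nb (S : {set VH}) x y : x \in S -> H x y -> y \in closed_nb S.
Proof.
by move=> xS xy; rewrite in_setU; apply/orP; right; apply/bigcupP; exists x; rewrite ?inE.
Qed.

Definition ball3 x := closed_nb (closed_nb (closed_nb [set x])).

Lemma ball3_card x : (#|ball3 x| <= Delta.+1 ^ 3)%N.
Proof.
apply: leq_trans (closed_nb_card _) _; rewrite expnS leq_mul2l; apply/orP; right.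
apply: leq_trans (closed_nb_card _) _; rewrite expnS leq_mul2l; apply/orP; right.
by apply: leq_trans (closed_nb_card _) _; rewrite cards1 expn1 muln1.
Qed.

Lemma far_props x x' : x' \notin ball3 x ->
  [/\ ~~ H x x', forall y, H x y -> ~~ H x' y &
      forall y y', H x y -> H x' y' -> ~~ H y y'].
Proof.
move=> far; have x0 : x \in [set x] by rewrite inE.
split=> [|y xy|y y' xy xy']; apply: contra far => e.
- by do 2!apply: sub_closed_nb; apply: nb_closed_nb e.
- by apply: sub_closed_nb; apply: nb_closed_nb (nb_closed_nb x0 xy) _; rewrite H_sym.
- apply: nb_closed_nb (nb_closed_nb (nb_closed_nb x0 xy) e) _; by rewrite H_sym.
Qed.

(** Greedy choice: each chosen vertex excludes a ball of bounded size. *)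
Lemma separated_set (F : {set VH}) (l : seq 'I_r) :
  (size l * Delta.+1 ^ 3 + #|F| < N)%N ->
  exists B : {set VH}, [/\ forall i, #|B :&: fibH h i| = count_mem i l,
    #|B| = size l, [disjoint B & F] &
    forall x x', x \in B -> x' \in B -> x != x' ->
      (x' \notin ball3 x) || (x \notin ball3 x')].
Proof.
elim: l => [|i l IHl] /= lt.
  exists set0; split=> [i||| x x']; rewrite ?set0I ?cards0 ?inE //.
  by rewrite -setI_eq0 set0I.
have [|B [Bc Bs BF Bfar]] := IHl.
  by apply: leq_ltn_trans lt; rewrite leq_add2r leq_mul2r leqnSn orbT.
pose U := F :|: \bigcup_(x in B) ball3 x.
have Ule : (#|U| < N)%N.
  apply: leq_ltn_trans lt; apply: leq_trans (leq_card_setU _ _) _.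
  rewrite addnC leq_add2r; apply: leq_trans (card_bigcup_le _ _) _.
  apply: (@leq_trans (\sum_(x in B) Delta.+1 ^ 3)).
    by apply: leq_sum => x _; apply: ball3_card.
  by rewrite sum_nat_const Bs leq_mul2r leqnSn orbT.
have [x] : exists x, x \in fibH h i :\: U.
  apply/set0Pn; rewrite -card_gt0 cardsD subn_gt0 fibH_card.
  by apply: leq_ltn_trans Ule; rewrite subset_leq_card // subsetIr.
rewrite in_setD in_setU negb_or => /andP[/andP[xF xU] xi].
have far z : z \in B -> x \notin ball3 z.
  by move=> zB; apply: contra xU => xz; apply/bigcupP; exists z.
have xB : x \notin B.
  by apply/negP => /[dup] /far /negP[]; do 3!apply: sub_closed_nb; rewrite inE.
exists (x |: B); split.
- move=> j; rewrite setIUl -Bc; have [<-|ij] := eqVneq i j.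
    rewrite (setIidPl _) ?sub1set // cardsU1 in_setI (negPf xB) /=.
    by [].
  rewrite (_ : [set x] :&: _ = set0) ?set0U //; apply/eqP; rewrite setI_eq0 disjoints1.
  by move: xi; rewrite !inE => /eqP->.
- by rewrite cardsU1 xB Bs.
- by rewrite -setI_eq0 setIUl setU_eq0 !setI_eq0 BF disjoints1 xF.
- move=> y z; rewrite !in_setU1 => /orP[/eqP->|yB] /orP[/eqP->|zB] yz.
  + by rewrite eqxx in yz.
  + by rewrite (far z zB) orbT.
  + by rewrite (far y yB).
  + exact: Bfar.
Qed.

Lemma buffer_exists (W : {set VH}) b :
  (r * b * Delta.+1 ^ 3 + Delta.+1 * #|W| < N)%N ->
  exists B : {set VH},
    [/\ forall i, #|B :&: fibH h i| = b, (#|B| = r * b)%N,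
        B :&: closed_nb W = set0 &
        forall x x', x \in B -> x' \in B -> x != x' ->
        [/\ ~~ H x x', forall y, H x y -> ~~ H x' y &
          forall y y', H x y -> H x' y' -> ~~ H y y'] ].
Proof.
move=> lt; pose l := flatten [seq nseq b i | i <- enum 'I_r].
have cl i : count_mem i l = b.
  rewrite count_flatten -map_comp (eq_map (g := fun j => (j == i) * b)%N).
    rewrite sumnE big_map big_enum /= (bigD1 i) //= eqxx mul1n big1 ?addn0 //.
    by move=> j /negPf->.
  by move=> j /=; rewrite count_nseq.
have sl : size l = (r * b)%N.
  rewrite size_flatten /shape -map_comp (eq_map (g := fun=> b)).
    by rewrite sumnE big_map big_enum /= sum_nat_const card_ord.
  by move=> j /=; rewrite size_nseq.
have [|B [Bc Bs BF Bfar]] := @separated_set (closed_nb W) l.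
  by rewrite sl; apply: leq_ltn_trans lt; rewrite leq_add2l closed_nb_card.
exists B; split=> [i|||x x' xB x'B xx']; rewrite ?Bc ?Bs //.
  by apply/eqP; rewrite setI_eq0.
case/orP: (Bfar x x' xB x'B xx') => /far_props[f1 f2 f3]; split=> //.
- by rewrite H_sym.
- by move=> y; apply: contraL; apply: f2.
- by move=> y y' xy xy'; rewrite H_sym; apply: f3.
Qed.

End Buffer.

(** * Class-preserving injections and numerical facts *)

Section SmallFacts.

Variables (r : nat) (VH VG : finType) (h : VH -> 'I_r) (g : VG -> 'I_r).

Lemma class_section (N : nat) : (0 < N)%N -> (forall i, #|fibG g i| = N) ->
  exists def : {ffun VH -> VG}, forall x, g (def x) = h x.
Proof.
move=> N0 gN; have ex x : exists v, g v == h x.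
  have : (0 < #|fibG g (h x)|)%N by rewrite gN.
  by rewrite card_gt0 => /set0Pn[v]; rewrite inE; exists v.
by exists [ffun x => xchoose (ex x)] => x; rewrite ffunE; apply/eqP/(xchooseP (ex x)).
Qed.

Lemma class_injection (def : {ffun VH -> VG}) :
  (forall i, #|fibH h i| <= #|fibG g i|)%N -> (forall x, g (def x) = h x) ->
  exists f : {ffun VH -> VG}, injective f /\ forall x, g (f x) = h x.
Proof.
move=> le defP.
pose f := [ffun x => nth (def x) (enum (fibG g (h x))) (index x (enum (fibH h (h x))))].
have lt x : (index x (enum (fibH h (h x))) < size (enum (fibG g (h x))))%N.
  rewrite -cardE; apply: leq_trans (le (h x)); rewrite cardE index_mem mem_enum.
  by rewrite inE.
have fP x : g (f x) = h x.
  apply/eqP; have := mem_nth (def x) (lt x); rewrite mem_enum inE ffunE.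
  by [].
exists f; split=> // x y e; have hxy : h x = h y by rewrite -!fP e.
move: e; rewrite !ffunE (set_nth_default (def x) (def y) (lt y)) -hxy.
move/eqP; rewrite nth_uniq ?enum_uniq //; last by rewrite hxy.
move/eqP/(congr1 (nth x (enum (fibH h (h x))))).
by rewrite !nth_index // mem_enum inE // hxy.
Qed.

End SmallFacts.

Section NumFacts.

Variable R : realType.

Lemma pow_one_le2 (x : R) r : 0 <= x -> 2 * r%:R * x <= 1 -> (1 + x) ^+ r <= 2.
Proof.
move=> x0 rx; suff le j : (j <= r)%N -> (1 + x) ^+ j <= 1 + 2 * j%:R * x.
  by apply: le_trans (le r (leqnn r)) _; lra.
elim: j => [|j IHj] jr; first by rewrite expr0 mulr0 mul0r addr0.
rewrite exprSr; apply: (@le_trans _ _ ((1 + 2 * j%:R * x) * (1 + x))).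
  by rewrite ler_wpM2r ?addr_ge0 // IHj // ltnW.
have jx : 2 * j%:R * x <= 1.
  apply: le_trans rx; rewrite ler_wpM2r // ler_wpM2l // ler_nat; exact: ltnW.
have : 2 * j%:R * x * x <= 1 * x by rewrite ler_wpM2r.
rewrite -natr1; set J := j%:R; lra.
Qed.

Lemma sqr_le_exp2 n : (n.+1 ^ 2 <= 4 * 2 ^ n)%N.
Proof.
elim: n => // n IHn; case: n IHn => [|[|n]] IHn //.
(* The inequality [n.+3 ^ 2 <= 2 * n.+2 ^ 2] fails for small values, which are
checked separately. *)
rewrite expnS mulnCA; apply: (@leq_trans (2 * n.+3 ^ 2)%N); last by rewrite leq_mul2l.
nia.
Qed.

End NumFacts.

(** * The blow-up lemma for classes of equal size *)

(** The blow-up lemma for given constants, with super-regularity replaced by its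
two consequences and [H] padded to full classes. *)
Definition spread_blowup (R : realType) (r Delta : nat) (d alpha eps beta C : R) : Prop :=
  forall (N : nat), (0 < N)%N ->
  forall (VH VG : finType) (H : rel VH) (G : rel VG) (h : VH -> 'I_r) (g : VG -> 'I_r),
    symmetric H -> irreflexive H -> symmetric G ->
    (forall x, (#|nbH H x| <= Delta)%N) ->
    (forall x y, H x y -> forall T : {set VG}, T \subset fibG g (h y) ->
       eps * N%:R <= #|T|%:R ->
       #|[set v in fibG g (h x) | #|T :&: nbG G v|%:R < d * #|T|%:R]|%:R <= eps * N%:R) ->
    (forall x y, H x y -> forall v, v \in fibG g (h x) ->
       2 * d * N%:R <= #|fibG g (h y) :&: nbG G v|%:R) ->
    (forall i, #|fibG g i| = N) -> (forall i, #|fibH h i| = N) ->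
  forall (W : {set VH}) (Wf : VH -> {set VG}),
    #|W|%:R <= beta * N%:R ->
    (forall x, x \in W -> Wf x \subset fibG g (h x)) ->
    (forall x, x \in W -> alpha * N%:R <= #|Wf x|%:R) ->
  exists lambda : fdist R {ffun VH -> VG},
    (forall f, lambda f != 0 ->
       [/\ injective f, forall x y, H x y -> G (f x) (f y),
           forall x, g (f x) = h x & forall x, x \in W -> f x \in Wf x]) /\
    forall (l : nat) (x : 'I_l -> VH) (y : 'I_l -> VG), injective x -> injective y ->
      Pr lambda (fun f => [forall i, f (x i) == y i]) <= Num.min 1 (C / N%:R) ^+ l.

Section PrFacts.

Variables (R : realType) (T : finType) (P : fdist R T).

Lemma Pr_le (E F : pred T) : subpred E F -> Pr P E <= Pr P F.
Proof.
move=> EF; rewrite /Pr [leLHS]big_mkcond [leRHS]big_mkcond; apply: ler_sum => t _.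
case: ifP => [/EF->//|_]; by case: ifP => // _; apply: mass_ge0.
Qed.

Lemma Pr_le1 (E : pred T) : Pr P E <= 1.
Proof. by rewrite -(mass_sum1 P); apply: (@Pr_le E xpredT). Qed.

End PrFacts.

(** Since [eps * N < 1], lower regularity applies to single vertices and leaves no
exception, so that adjacent classes are completely joined; [beta * N < 1]
leaves [W] empty. *)
Lemma small_embedding (R : realType) (r N : nat) (d eps beta C : R) :
  (0 < N)%N -> 0 < d -> eps * N%:R < 1 -> beta * N%:R < 1 -> N%:R <= C ->
  forall (VH VG : finType) (H : rel VH) (G : rel VG) (h : VH -> 'I_r) (g : VG -> 'I_r),
    (forall x y, H x y -> forall T : {set VG}, T \subset fibG g (h y) ->
       eps * N%:R <= #|T|%:R ->
       #|[set v in fibG g (h x) | #|T :&: nbG G v|%:R < d * #|T|%:R]|%:R <= eps * N%:R) ->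
    (forall i, #|fibG g i| = N) -> (forall i, #|fibH h i| = N) ->
  forall (W : {set VH}) (Wf : VH -> {set VG}),
    #|W|%:R <= beta * N%:R ->
  exists lambda : fdist R {ffun VH -> VG},
    (forall f, lambda f != 0 ->
       [/\ injective f, forall x y, H x y -> G (f x) (f y),
           forall x, g (f x) = h x & forall x, x \in W -> f x \in Wf x]) /\
    forall (l : nat) (x : 'I_l -> VH) (y : 'I_l -> VG), injective x -> injective y ->
      Pr lambda (fun f => [forall i, f (x i) == y i]) <= Num.min 1 (C / N%:R) ^+ l.
Proof.
move=> N_gt0 d0 epsN betaN NC VH VG H G h g lower_reg fG fH W Wf Wb.
have W0 : W = set0.
  apply/eqP; rewrite -cards_eq0 -leqn0 -ltnS -(ltr_nat R); exact: le_lt_trans Wb betaN.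
have [def defP] := class_section h N_gt0 fG.
have [|f [fI fP]] := class_injection _ defP; first by move=> i; rewrite fG fH.
exists (dirac R f); split=> [f'|l x y _ _].
  rewrite /= /dirac_mass pnatr_eq0 eqb0 negbK => /eqP->; split=> // [x y xy|x]; last first.
    by rewrite W0 inE.
  have TP : [set f y] \subset fibG g (h y) by rewrite sub1set inE fP.
  have := lower_reg x y xy _ TP; rewrite cards1 => /(_ (ltW epsN))/le_lt_trans/(_ epsN).
  rewrite ltrn1 ltnS leqn0 cards_eq0 => /eqP/setP/(_ (f x)).
  rewrite !inE fP eqxx mulr1 /= => /negbT; apply: contraNT => nG.
  rewrite (_ : _ :&: _ = set0) ?cards0 //; apply/setP => u; rewrite !inE.
  by case: eqP => // ->; apply/negbTE.
rewrite (@le_trans _ _ 1) ?Pr_le1 //.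
have -> : Num.min 1 (C / N%:R) = 1; last by rewrite expr1n.
by apply/min_idPl; rewrite ler_pdivlMr ?ltr0n // mul1r.
Qed.

Lemma exists_nat_ge (R : realType) (x : R) : exists n : nat, x <= n%:R.
Proof.
have [x0|x0] := lerP 0 x; last by exists 0%N; exact: ltW.
by exists (Num.bound x); apply/ltW/archi_boundP.
Qed.

Lemma exists_below (R : realType) (s : seq R) : all (fun x => 0 < x) s ->
  exists2 e : R, 0 < e & all (fun x => e <= x) s.
Proof.
elim: s => [|x s IHs] /=; first by exists 1.
case/andP=> x0 /IHs[e e0 es]; exists (Num.min x e); first by rewrite lt_min x0.
rewrite ge_min lexx /=; apply: sub_all es => y; rewrite /= ge_min => ->; by rewrite orbT.
Qed.

(** As [2 ^ k] grows quadratically at least, it beats [N], which is linear in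
[k]. *)
Lemma uncovered_bound (R : realType) (r K1 N : nat) : (0 < K1)%N -> (16 * r * K1 * K1 <= N)%N ->
  (r * N)%:R * 2^-1 ^+ (N %/ K1) <= 4^-1 :> R.
Proof.
move=> K0 NK; set k := (N %/ K1)%N.
have Nlt : (N < K1 * k.+1)%N by rewrite mulnC ltn_ceil.
rewrite exprVn ler_pdivrMr ?exprn_gt0 //.
suff : (4 * (r * N) <= 2 ^ k)%N.
  by rewrite -(ler_nat R) natrX natrM; lra.
have h1 := sqr_le_exp2 k.
have h2 : (16 * r * K1 <= k.+1)%N.
  rewrite -(leq_pmul2l K0); apply: leq_trans (ltnW Nlt); rewrite mulnC; exact: NK.
have h3 : (4 * (4 * (r * N)) <= k.+1 ^ 2)%N.
  apply: (@leq_trans (16 * r * K1 * k.+1)%N); last by rewrite -mulnn leq_mul2r h2 orbT.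
  rewrite (_ : 4 * (4 * (r * N)) = 16 * r * N)%N; last by rewrite !mulnA.
  by rewrite -[leqRHS]mulnA leq_mul2l (ltnW Nlt) orbT.
by rewrite -(leq_pmul2l (isT : (0 < 4)%N)); apply: leq_trans h3 h1.
Qed.

Lemma irregular_bound (R : realType) (r N : nat) : (4 * r <= N)%N ->
  r%:R * 4^-1 ^+ N <= 4^-1 :> R.
Proof.
move=> rN; rewrite exprVn ler_pdivrMr ?exprn_gt0 //.
have : (4 * r <= 4 ^ N)%N by apply: leq_trans rN _; apply/ltnW/ltn_expl.
by rewrite -(ler_nat R) natrX natrM; lra.
Qed.

Lemma leq_three_half b : (2 <= b)%N -> (b <= 3 * (b %/ 2))%N.
Proof. by move=> b2; have := ltn_ceil b (isT : (0 < 2)%N); have := b2; lia. Qed.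

Lemma leq_twice_trunc m n : (0 < m)%N -> (m <= n)%N -> (n <= 2 * (n %/ m * m))%N.
Proof.
move=> m0 mn; have k0 : (0 < n %/ m)%N by rewrite divn_gt0.
have := ltn_ceil n m0; rewrite mulSn => lt.
rewrite mul2n -addnn; apply: leq_trans (ltnW lt) _; rewrite leq_add2r.
by rewrite -{1}[m]mul1n leq_mul2r k0 orbT.
Qed.

Lemma lt_of_quarters x y n : (0 < n)%N -> (4 * x <= n)%N -> (4 * y <= n)%N -> (x + y < n)%N.
Proof. lia. Qed.

(** Order of the constants: the buffer has [b = N %/ k0] vertices per class, of
which [k0] bounds the effect on degrees and the size of their neighbourhood;
[m] turns the success probability of a buffer vertex into a guaranteed fraction
[1 / m] of successes; [c'] is the degree constant of the final bipartite graph;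
[eta], [tau] are the relative sizes of zones and of the sets in
[regular_event]; [m2] bounds the number of atypical vertices; [N0] bounds the
values of [N] for which rounding or the union bounds could fail.  Last come
[eps] and [beta], small enough to make these values of [N] trivial. *)
Lemma spread_blowup_exists (R : realType) (r Delta : nat) (d alpha : R) :
  0 < d -> d <= 2^-1 -> 0 < alpha -> alpha <= 1 ->
  exists eps beta C : R,
    [/\ 0 < eps, 0 < beta, 0 < C & spread_blowup r Delta d alpha eps beta C].
Proof.
move=> d0 d2 a0 a1.
have d1 : d <= 1 by lra.
have [D DE] : exists z : R, z = d ^+ Delta by eexists.
have D0 : 0 < D by rewrite DE exprn_gt0.
have D1 : D <= 1 by rewrite DE exprn_ile1 // ltW.
have [zeta zetaE] : exists z : R, z = Num.min alpha d by eexists.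
have z0 : 0 < zeta by rewrite zetaE lt_min a0.
have za : zeta <= alpha by rewrite zetaE ge_min lexx.
have zd : zeta <= d by rewrite zetaE ge_min lexx orbT.
have Dz0 : 0 < D * zeta by apply: mulr_gt0.
(* The three terms bound the neighbourhood of the buffer, make [kap <= zeta], and
leave room for the choice of the buffer. *)
have [k0 k0P] := exists_nat_ge (8 * Delta%:R * r%:R / (D * zeta) + zeta^-1 + (4 * r * Delta.+1 ^ 3)%:R).
have zi0 : 1 <= zeta^-1 by rewrite invf_ge1 //; lra.
have t1 : 0 <= 8 * Delta%:R * r%:R / (D * zeta) by rewrite divr_ge0 ?mulr_ge0 // ltW.
have t2 : 0 <= (4 * r * Delta.+1 ^ 3)%:R :> R by apply: ler0n.
have k0R : 0 < k0%:R :> R by move: t1 t2 zi0 k0P; set A := _ / _; set A' := _%:R; set A'' := zeta^-1; lra.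
have k0_gt0 : (0 < k0)%N by rewrite -(ltr0n R).
have [kap kapE] : exists z : R, z = k0%:R^-1 by eexists.
have kap0 : 0 < kap by rewrite kapE invr_gt0.
have kap1 : 8 * Delta%:R * r%:R * kap <= D * zeta.
  rewrite kapE ler_pdivrMr // [leRHS]mulrC -ler_pdivrMr //; apply: le_trans k0P.
  by rewrite -addrA lerDl addr_ge0 // ltW // invr_gt0.
have kap2 : kap <= zeta.
  rewrite kapE -[leRHS]invrK lef_pV2 ?posrE ?invr_gt0 //; apply: le_trans k0P.
  by rewrite -addrA addrCA lerDl addr_ge0.
have kap3 : (4 * r * Delta.+1 ^ 3 <= k0)%N.
  rewrite -(ler_nat R); apply: le_trans k0P; rewrite lerDr addr_ge0 //; lra.
have [p0 p0E] : exists z : R, z = D * d / 2 by eexists.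
have p00 : 0 < p0 by rewrite p0E divr_gt0 // mulr_gt0.
have p01 : p0 <= 1.
  have : D * d <= 1 by rewrite mulr_ile1 // ltW.
  by rewrite p0E; lra.
have pD0 : 0 < p0 ^+ Delta by apply: exprn_gt0.
have pD1 : p0 ^+ Delta <= 1 by apply: exprn_ile1 => //; apply: ltW.
(* This base beats the factor [2 ^+ k] of [uncovered_tail] with [k = b %/ m]. *)
have [|||m mP] := @pow_small R (1 - p0 ^+ Delta / 2) 4^-1; try lra.
have m0 : (0 < m)%N by case: m mP => //; rewrite expr0; lra.
have mR : 1 <= m%:R :> R by rewrite ler1n.
have mR0 : 0 < m%:R :> R by rewrite ltr0n.
have [c' cpE] : exists z : R, z = D / 12 / m%:R by eexists.
have c'0 : 0 < c' by rewrite cpE !divr_gt0.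
have c'D : c' <= D / 12 by rewrite cpE ler_pdivrMr // ler_peMr // divr_ge0 // ltW.
have c'm : c' * m%:R = D / 12 by rewrite cpE divfK // gt_eqF.
have [||C2 C20 C2P] := @spread_matching R r c' D; [|by rewrite D0|].
  by rewrite c'0 (le_trans c'D) //; move: D1; clear; lra.
have [eta etaE] : exists z : R, z = kap / 6 by eexists.
have [tau tauE] : exists z : R, z = c' * kap / 4 by eexists.
have [c1 c1E] : exists z : R, z = D * eta / 2 by eexists.
have eta0 : 0 < eta by rewrite etaE divr_gt0.
have Deta0 : 0 < D * eta by apply: mulr_gt0.
have c'k0 : 0 < c' * kap by apply: mulr_gt0.
have tau0 : 0 < tau by rewrite tauE divr_gt0.
have c10 : 0 < c1 by rewrite c1E divr_gt0.
have [m2 m2P] := exists_nat_ge (8 / (c' * kap)).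
have m2R : 0 < m2%:R :> R by apply: lt_le_trans m2P; rewrite divr_gt0.
have m2_gt0 : (0 < m2)%N by rewrite -(ltr0n R).
have m2V : m2%:R^-1 <= c' * kap / 8.
  rewrite -[leRHS]invrK lef_pV2 ?posrE ?invr_gt0 ?divr_gt0 //.
  by rewrite invf_div.
(* The summands give [m + 2 <= b] and the hypotheses of [uncovered_bound] and
[irregular_bound]. *)
have [N0 N0E] : exists n, n = (k0 * (m + 2) + (16 * r * (k0 * m) * (k0 * m) + (4 * r + 1)))%N by eexists.
have N0R : 0 < N0%:R :> R by rewrite ltr0n N0E !addn1 !addnS.
have [Kc KcE] : exists z : R, z = (16 ^+ m2) ^+ Delta * Delta%:R / c1 by eexists.
have Kc0 : 0 <= Kc.
  rewrite KcE.
  apply: divr_ge0; last exact: ltW.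
  by apply: mulr_ge0; rewrite ?ler0n // !exprn_ge0.
have e1 : 0 < D * tau by apply: mulr_gt0.
have e2 : 0 < D * eta / 4 / Delta.+1%:R by rewrite !divr_gt0.
have e3 : 0 < (2 * r.+1%:R * (Kc + 1))^-1 by rewrite invr_gt0 !mulr_gt0 // ltr_wpDl.
have e4 : 0 < N0%:R^-1 :> R by rewrite invr_gt0.
have [eps eps0 /and5P[eps1 eps2 eps3 eps4 _]] : exists2 e : R, 0 < e & all (fun x => e <= x)
    [:: D * tau; D * eta / 4 / Delta.+1%:R; (2 * r.+1%:R * (Kc + 1))^-1; N0%:R^-1].
  by apply: exists_below; rewrite /= e1 e2 e3 e4.
have f1 : 0 < D * zeta / 8 by rewrite divr_gt0.
have f2 : 0 < (4 * Delta.+1%:R)^-1 :> R by rewrite invr_gt0 mulr_gt0.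
have f3 : 0 < D * kap / 48 by rewrite divr_gt0 // mulr_gt0.
have [beta beta0 /and5P[beta1 beta2 beta3 beta4 _]] : exists2 e : R, 0 < e & all (fun x => e <= x)
    [:: D * zeta / 8; (4 * Delta.+1%:R)^-1; D * kap / 48; N0%:R^-1].
  by apply: exists_below; rewrite /= f1 f2 f3 e4.
have [C' CpE] : exists z : R, z = 2 * k0%:R * C2 + c1^-1 by eexists.
have C'0 : 0 < C' by rewrite CpE addr_gt0 ?invr_gt0 // !mulr_gt0.
have [C CE] : exists z : R, z = N0%:R + 4 * C' by eexists.
have C0 : 0 < C by rewrite CE addr_gt0 // mulr_gt0.
exists eps, beta, C; split=> // N N_gt0 VH VG H G h g Hs Hi Gs degH lower_reg min_deg fG fH W Wf Wb WfS Wfa.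
have nR : 0 < N%:R :> R by rewrite ltr0n.
have [ltN|geN] := ltnP N N0.
  have lt1 (e : R) : e <= N0%:R^-1 -> e * N%:R < 1.
    move=> eN; apply: (@le_lt_trans _ _ (N0%:R^-1 * N%:R)); first by rewrite ler_wpM2r.
    by rewrite mulrC ltr_pdivrMr // mul1r ltr_nat.
  apply: (@small_embedding R r N d eps beta C) => //; try exact: lt1.
  rewrite CE (@le_trans _ _ N0%:R) ?ler_nat ?(ltnW ltN) // lerDl mulr_ge0 //.
  exact: ltW.
have [b bE] : exists z, z = (N %/ k0)%N by eexists.
have [q qE] : exists z, z = (b %/ 2)%N by eexists.
have [k kE] : exists z, z = (b %/ m)%N by eexists.
have b_ge : (m + 2 <= b)%N.
  by rewrite bE leq_divRL // mulnC; apply: leq_trans geN; rewrite N0E leq_addr.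
have b0 : (0 < b)%N by apply: leq_trans b_ge; rewrite addn2.
have q0 : (0 < q)%N by rewrite qE divn_gt0 //; apply: leq_trans b_ge; rewrite leq_addl.
have k_gt0 : (0 < k)%N by rewrite kE divn_gt0 //; apply: leq_trans b_ge; rewrite leq_addr.
have b_le : (b * k0 <= N)%N by rewrite bE; apply: leq_trunc_div.
have b_lt : (N <= 2 * (b * k0))%N.
  rewrite bE; apply: leq_twice_trunc => //; apply: leq_trans geN.
  by rewrite N0E addnS mulnS -addnA leq_addr.
have q_le : (q * 2 <= b)%N by rewrite qE; apply: leq_trunc_div.
have q_ge : (b <= 3 * q)%N.
  by rewrite qE; apply: leq_three_half; apply: leq_trans b_ge; rewrite leq_addl.
have k_ge : (b <= 2 * (k * m))%N.
  by rewrite kE; apply: leq_twice_trunc => //; apply: leq_trans b_ge; rewrite leq_addr.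
have [n nE] : exists z : R, z = N%:R by eexists.
rewrite -nE in Wb Wfa lower_reg min_deg nR.
have rb1 : b%:R <= kap * n.
  by rewrite kapE nE mulrC ler_pdivlMr // -natrM ler_nat.
have rb2 : kap * n <= 2 * b%:R.
  by rewrite kapE nE mulrC ler_pdivrMr // -!natrM ler_nat -mulnA.
have rq1 : 2 * q%:R <= b%:R :> R by rewrite -natrM ler_nat mulnC.
have rq2 : b%:R <= 3 * q%:R :> R by rewrite -natrM ler_nat.
have rk : b%:R <= 2 * (k%:R * m%:R) :> R by rewrite -!natrM ler_nat.
have bR : 0 < b%:R :> R by rewrite ltr0n.
have kn0 : 0 < kap * n by apply: mulr_gt0.
have [|B [Bc Bs BW Bfar]] := @buffer_exists VH r N Delta H h Hs degH fH W b.
  apply: lt_of_quarters => //.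
    rewrite (_ : 4 * (r * b * Delta.+1 ^ 3) = b * (4 * r * Delta.+1 ^ 3))%N.
      by apply: leq_trans b_le; rewrite leq_mul2l kap3 orbT.
    by rewrite (mulnC r) -!mulnA mulnCA.
  rewrite -(ler_nat R) !natrM -nE; apply: (@le_trans _ _ (4 * Delta.+1%:R * (beta * n))).
    by rewrite mulrA ler_wpM2l // mulr_ge0.
  rewrite mulrA ger_pMl // mulrC; apply: (@le_trans _ _ ((4 * Delta.+1%:R)^-1 * (4 * Delta.+1%:R))).
    by rewrite ler_wpM2r // mulr_ge0.
  by rewrite mulVf // mulf_neq0 // pnatr_eq0.
have exQ i : exists Qi : {set VG}, Qi \subset fibG g i /\ #|Qi| = q.
  have [|A AP Aq] := @exists_subset_card _ (fibG g i) q; last by exists A.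
  by rewrite fG qE bE; apply: leq_trans (leq_div _ _) (leq_div _ _).
have [Qf QfP] := fin_all_exists exQ.
pose Q := [set v | v \in Qf (g v)].
have Qc i : #|Q :&: fibG g i| = q.
  have [QS <-] := QfP i; apply: eq_card => v; rewrite !inE.
  apply/andP/idP => [[vQ /eqP <-]|vQ] //.
  by have := subsetP QS v vQ; rewrite inE => /eqP ->.
have [def defP] := class_section h N_gt0 fG.
have NBc : #|bufN H B|%:R <= Delta%:R * r%:R * b%:R :> R.
  rewrite -!natrM ler_nat; apply: (@leq_trans #|\bigcup_(x in B) nbH H x|).
    apply: subset_leq_card; apply/subsetP => y; rewrite inE => /exists_inP[x xB xy].
    by apply/bigcupP; exists x; rewrite ?inE.
  apply: leq_trans (card_bigcup_le _ _) _.
  apply: (@leq_trans (\sum_(x in B) Delta)); first by apply: leq_sum => x _; apply: degH.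
  by rewrite sum_nat_const Bs mulnC mulnA.
have Q_ge i : n - q%:R <= #|fibG g i :\: Q|%:R.
  by have := cardD_ge R (fibG g i) Q; rewrite fG Qc nE.
have Dk0 : 0 < D * (kap * n) by apply: mulr_gt0.
have ck0 : 0 < c' * (kap * n) by apply: mulr_gt0.
have etan : eta * n <= q%:R by rewrite etaE; move: rb2 rq2; clear; lra.
have kzn : kap * n <= zeta * n by rewrite ler_wpM2r // ltW.
have zdn : zeta * n <= d * n by rewrite ler_wpM2r // ltW.
have dn2 : d * n <= 2^-1 * n by rewrite ler_wpM2r // ltW.
have qn : zeta * n <= n - q%:R by move: zdn dn2 rq1 rb1 kzn nR; clear; lra.
have zWf x : x \in W -> zeta * n <= #|Wf x|%:R.
  by move=> xW; apply: le_trans (Wfa x xW); rewrite ler_wpM2r // ltW.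
have NBW : bufN H B :&: W = set0.
  apply/setP => y; rewrite in_setI in_set0; apply/negP => /andP[].
  rewrite inE => /exists_inP[x xB xy] yW; move/setP/(_ x): BW.
  by rewrite in_setI xB (@nb_closed_nb _ H W y x) ?in_set0 // Hs.
have H_BW : B :&: W = set0.
  apply/setP => y; rewrite in_setI in_set0; apply/negP => /andP[yB yW].
  by move/setP/(_ y): BW; rewrite in_setI yB sub_closed_nb ?in_set0.
have h_zone x : eta * n <= #|zone H h g B W Wf Q x|%:R.
  rewrite /zone; case: ifP => _; first apply: le_trans (le_trans qn (Q_ge _)).
    by rewrite etaE; move: kzn kn0; clear; lra.
  case: ifP => [xW|_]; first by apply: le_trans (zWf x xW); rewrite etaE; move: kzn kn0; clear; lra.
  by rewrite setIC Qc.
have Dtau : D * tau <= D * eta.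
  rewrite ler_wpM2l ?(ltW D0) // tauE etaE.
  have : c' * kap <= 12^-1 * kap by rewrite ler_wpM2r ?(ltW kap0) // (le_trans c'D) //; move: D1; clear; lra.
  by move: kap0; clear; lra.
have tau_eta : tau <= eta by rewrite -(ler_pM2l D0).
have h_Deps : Delta%:R * eps <= D * eta / 4.
  have : eps * Delta.+1%:R <= D * eta / 4 by rewrite -ler_pdivlMr.
  by rewrite -natr1 mulrDr mulr1; move: eps0; clear; lra.
have h_NBW1 : #|bufN H B|%:R + #|W|%:R <= D / 4 * zeta * n.
  have g1 : beta * n <= D * zeta / 8 * n by rewrite ler_wpM2r // ltW.
  have g2 : Delta%:R * r%:R * b%:R <= Delta%:R * r%:R * (kap * n).
    by rewrite ler_wpM2l // mulr_ge0.
  have g3 : 8 * Delta%:R * r%:R * kap * n <= D * zeta * n by rewrite ler_wpM2r // ltW.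
  by move: NBc Wb g1 g2 g3; clear; lra.
have h_NBW2 : #|bufN H B|%:R + #|W|%:R <= D * d / 4 * n.
  apply: le_trans h_NBW1 _; have : D * (zeta * n) <= D * (d * n) by rewrite ler_wpM2l // ltW.
  by clear; lra.
have Nm2 : n / m2%:R <= c' * kap / 8 * n.
  by rewrite mulrC ler_wpM2r // ltW.
have ckD : c' * (kap * n) <= D / 12 * (kap * n) by rewrite ler_wpM2r // ltW.
have Dq : D * b%:R <= D * (3 * q%:R) by rewrite ler_wpM2l // ltW.
have Db : D * (kap * n) <= D * (2 * b%:R) by rewrite ler_wpM2l // ltW.
have cb : c' * (kap * n) <= c' * (2 * b%:R) by rewrite ler_wpM2l // ltW.
have cbD : c' * b%:R <= D / 12 * b%:R by rewrite ler_wpM2r.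
have h_res : #|W|%:R + n / m2%:R <= D / 4 * q%:R.
  have : beta * n <= D * kap / 48 * n by rewrite ler_wpM2r // ltW.
  by move: Wb Nm2 Dk0 ckD Dq Db; clear; lra.
have h_theta : (1 + (16 ^+ m2) ^+ Delta * (Delta%:R * eps) / c1) ^+ r <= 2.
  have -> : (16 ^+ m2) ^+ Delta * (Delta%:R * eps) / c1 = Kc * eps by rewrite KcE; ring.
  apply: pow_one_le2; first by rewrite mulr_ge0 // ltW.
  have : eps * (2 * r.+1%:R * (Kc + 1)) <= 1 by rewrite -ler_pdivlMr ?mul1r // !mulr_gt0 // ltr_wpDl.
  have g1 : 0 <= eps * r%:R by rewrite mulr_ge0 // ltW.
  have g2 : 0 <= eps * Kc by rewrite mulr_ge0 // ltW.
  by rewrite -natr1; move: g1 g2 eps0; clear; lra.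
have h_irregular : r%:R * 4^-1 ^+ N <= 4^-1 :> R.
  apply: irregular_bound; apply: leq_trans geN; rewrite N0E addnA addnC -addnA; apply: leq_addr.
have h_uncovered : (r * N)%:R * (2 ^+ k * (1 - p0 ^+ Delta / 2) ^+ b) <= 4^-1.
  apply: le_trans (@uncovered_bound R r (k0 * m) N _ _); last first.
  - by apply: leq_trans geN; rewrite N0E addnCA; apply: leq_addr.
  - by rewrite muln_gt0 k0_gt0.
  rewrite divnMA -bE -kE ler_wpM2l //.
  have g1 : (1 - p0 ^+ Delta / 2) ^+ b <= 4^-1 ^+ k.
    apply: (@le_trans _ _ ((1 - p0 ^+ Delta / 2) ^+ (m * k))).
      rewrite ler_wiXn2l //; try by move: pD0 pD1; clear; lra.
      by rewrite mulnC kE; apply: leq_trunc_div.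
    by rewrite exprM lerXn2r ?nnegrE ?exprn_ge0 //; move: pD0 pD1; clear; lra.
  apply: (@le_trans _ _ (2 ^+ k * 4^-1 ^+ k)); first by rewrite ler_wpM2l ?exprn_ge0.
  by rewrite -exprMn (_ : 2 * 4^-1 = 2^-1 :> R) //; field.
have h_ck : c' * b%:R <= k%:R.
  have : c' * b%:R <= c' * (2 * (k%:R * m%:R)) by rewrite ler_wpM2l // ltW.
  have : c' * m%:R * k%:R <= 2^-1 * k%:R by rewrite ler_wpM2r // c'm; move: D1; clear; lra.
  by have := ler0n R k; clear; lra.
have [lambda [lS lP]] : exists lambda : fdist R {ffun VH -> VG},
  (forall f, lambda f != 0 ->
     [/\ injective f, forall x y, H x y -> G (f x) (f y),
         forall x, g (f x) = h x & forall x, x \in W -> f x \in Wf x]) /\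
  forall (l : nat) (x : 'I_l -> VH) (y : 'I_l -> VG), injective x -> injective y ->
    Pr lambda (fun f => [forall i, f (x i) == y i])
      <= 4 * \prod_i (if x i \in B then C2 / b%:R else (c1 * N%:R)^-1).
  have BD x x' : x \in B -> x' \in B -> H x x' -> x = x'.
    by move=> xB x'B xx'; apply/eqP; apply: contraTT xx' => /(Bfar x x' xB x'B)[].
  have bq : eta * n <= b%:R - q%:R by rewrite etaE; move: rb2 rq1 rq2 bR; clear; lra.
  have q_small : q%:R <= d * n by move: rq1 rb1 kzn zdn bR; clear; lra.
  have eta_d : eta <= d / 2 by rewrite etaE; move: kap2 zd kap0; clear; lra.
  have Deta1 : D * eta <= 1.
    by rewrite mulr_ile1 ?(ltW D0) ?(ltW eta0) //; move: eta_d d2; clear; lra.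
  have c1_01 : 0 < c1 <= 1 by rewrite c10 c1E; move: Deta1; clear; lra.
  have eps_eta : eps <= D * eta by apply: le_trans eps1 Dtau.
  have c'q : c' * b%:R <= D / 2 * q%:R.
    have Dq0 : 0 <= D * q%:R by rewrite mulr_ge0 // ltW.
    by apply: le_trans cbD _; move: Dq Dq0; clear; lra.
  have c'tau : tau * n <= c' / 2 * b%:R by rewrite tauE; move: cb; clear; lra.
  have c'm2 : n / m2%:R <= c' / 4 * b%:R by apply: le_trans Nm2 _; move: cb; clear; lra.
  subst D n p0.
  apply: (@greedy_dist R r VH VG H G h g N Delta d eps Hs Hi Gs degH _ (ltW eps0) lower_reg
    B W Wf Q c1 fG fH N_gt0 c1_01 eta zeta eta0 WfS h_zone eps_eta h_Deps c1E NBW zWf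
    (fun i => le_trans qn (Q_ge i)) h_NBW1 b q m2 tau Bc Qc bq tau_eta h_res m2_gt0 min_deg
    q_small eta_d h_NBW2 _ _ _ H_BW k eps1 h_theta h_irregular h_uncovered c' C2 b0 (ltW C20) C2P
    c'q h_ck c'tau c'm2 def).
  - by rewrite d0.
  - move=> x x' y xB x'B xy x'y; apply/eqP; apply: contraTT x'y => /(Bfar x x' xB x'B)[_ f _].
    exact: f.
  - by move=> x x' y y' xB x'B /(Bfar x x' xB x'B)[_ _]; apply.
  - move=> x y xB yB; have [->|/(Bfar x y xB yB)[]//] := eqVneq x y; by rewrite Hi.
exists lambda; split=> // l x y xI yI; have := lP l x y xI yI.
set P := Pr _ _ => Ple.
have P1 : P <= 1 by apply: Pr_le1.
have [Cn|Cn] := lerP 1 (C / N%:R); first by rewrite expr1n.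
case: l x y xI yI P Ple P1 => [|l] x y xI yI P Ple P1; first by rewrite expr0.
have NR : 0 < N%:R :> R by rewrite ltr0n.
have Cn0 : 0 < C' / N%:R by rewrite divr_gt0.
apply: le_trans Ple _; apply: (@le_trans _ _ (4 * (C' / N%:R) ^+ l.+1)).
  rewrite ler_pM2l // -[X in _ ^+ X]card_ord -prodr_const; apply: ler_prod => i _.
  case: ifP => _; last first.
    rewrite invr_ge0 mulr_ge0 ?(ltW c10) //= invfM CpE mulrDl lerDr.
    by rewrite divr_ge0 // mulr_ge0 ?(ltW C20) // mulr_ge0.
  rewrite divr_ge0 ?(ltW C20) //= CpE mulrDl.
  apply: (@le_trans _ _ (2 * k0%:R * C2 / N%:R)); last first.
    by rewrite lerDl divr_ge0 // invr_ge0 ltW.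
  have bN : b%:R^-1 <= 2 * k0%:R / N%:R :> R.
    by rewrite ler_pdivlMr // mulrC ler_pdivrMr // -!natrM ler_nat -mulnA (mulnC k0).
  have -> : 2 * k0%:R * C2 / N%:R = C2 * (2 * k0%:R / N%:R) by ring.
  by rewrite ler_wpM2l // ltW.
apply: (@le_trans _ _ ((4 * (C' / N%:R)) ^+ l.+1)).
  rewrite [leRHS]exprMn ler_wpM2r ?exprn_ge0 ?(ltW Cn0) // exprS ler_peMr // exprn_ege1 //.
  by rewrite ler1n.
have Cn1 : 0 <= C / N%:R by rewrite divr_ge0 // ltW.
have Cn2 : 0 <= 4 * (C' / N%:R) by rewrite mulr_ge0 // ltW.
rewrite lerXn2r ?nnegrE // mulrA ler_wpM2r ?invr_ge0 // CE lerDr; exact: ltW.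
Qed.

(** * From super-regular pairs to the general case *)

Lemma pushforward (R : realType) (T U : finType) (P : fdist R T) (F : T -> U) :
  exists Q : fdist R U, (forall u, Q u != 0 -> exists2 t, F t = u & P t != 0) /\
    forall E : pred U, Pr Q E = Pr P (fun t => E (F t)).
Proof.
pose m u := \sum_(t | F t == u) P t.
have m0 u : 0 <= m u by apply: sumr_ge0 => t _; apply: mass_ge0.
have m1 : \sum_u m u = 1.
  by rewrite -(mass_sum1 P) [RHS](partition_big F xpredT).
exists (FDist m0 m1); split=> [u /= mu|E].
  have [/existsP[t /andP[/eqP Ft Pt]]|no] := boolP [exists t, (F t == u) && (P t != 0)].
    by exists t.
  case/eqP: mu; apply: big1 => t Ft; apply/eqP; apply: contraNT no => Pt.
  by apply/existsP; exists t; rewrite Ft.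
rewrite /Pr /= [RHS](partition_big F E) //=; apply: eq_bigr => u Eu.
by apply: eq_bigl => t; case: eqP => [->|]; rewrite ?Eu ?andbF.
Qed.

Section LowerRegularity.

Variables (R : realType) (V : finType) (G : sgraph V).

Lemma nedges_sum (X1 X2 : {set V}) :
  nedges G X1 X2 = (\sum_(v in X1) #|X2 :&: nbr G v|)%N.
Proof.
rewrite /nedges -sum1_card; under [RHS]eq_bigr => v _ do rewrite -sum1_card.
rewrite pair_big_dep /=; apply: eq_bigl => -[u v]; by rewrite !inE -andbA.
Qed.

(** Otherwise the exceptional vertices and [T] would form a pair of density below
[d <= delta / 2], whereas the density of the whole pair is at least [delta] by
the minimum degree. *)
Lemma super_regular_lower (eps delta d : R) (A1 A2 T : {set V}) :
  0 < eps -> eps <= delta / 2 -> d <= delta / 2 ->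
  super_regular_pair eps delta G A1 A2 -> (0 < #|A1|)%N ->
  T \subset A2 -> eps * #|A1|%:R <= #|T|%:R ->
  #|[set v in A1 | #|T :&: nbr G v|%:R < d * #|T|%:R]|%:R <= eps * #|A1|%:R.
Proof.
move=> e0 ed dd [[dis reg] eqA deg1 deg2] A0 TA Tge; set Bad := [set v in A1 | _].
rewrite leNgt; apply/negP => lt.
have A0R : 0 < #|A1|%:R :> R by rewrite ltr0n.
have eA0 : 0 < eps * #|A1|%:R by apply: mulr_gt0.
have BadA : Bad \subset A1 by apply/subsetP => v; rewrite inE => /andP[].
have B0R : 0 < #|Bad|%:R :> R by apply: lt_trans lt.
have T0R : 0 < #|T|%:R :> R by apply: lt_le_trans Tge.
have B0 : (0 < #|Bad|)%N by rewrite -(ltr0n R).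
have := reg Bad T BadA TA (ltW lt); rewrite -eqA => /(_ Tge).
rewrite ler_norml => /andP[lo _].
have dA : delta <= density R G A1 A2.
  rewrite /density -eqA ler_pdivlMr ?mulr_gt0 // nedges_sum natr_sum.
  apply: (@le_trans _ _ (\sum_(v in A1) delta * #|A1|%:R)).
    by rewrite sumr_const -[leRHS]mulr_natl mulrCA.
  by apply: ler_sum => v vA; rewrite setIC deg1.
have dB : density R G Bad T < d.
  rewrite /density ltr_pdivrMr ?mulr_gt0 // nedges_sum natr_sum.
  have [v vB] := card_gt0P B0.
  apply: (@lt_le_trans _ _ (\sum_(v in Bad) d * #|T|%:R)); last first.
    by rewrite sumr_const -[leLHS]mulr_natl mulrCA.
  apply: ltr_sum => [|u]; last by rewrite inE => /andP[].
  by apply/hasP; exists v; rewrite ?mem_index_enum.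
by move: lo dA dB dd ed; set x := density _ _ _ _; set y := density _ _ _ _; clear; lra.
Qed.

End LowerRegularity.

Section Padding.

Variables (r N Delta : nat) (VH : finType) (H : sgraph VH) (h : VH -> 'I_r).
Hypothesis degH : max_degree H = Delta.
Hypothesis fib_le : forall i, (#|[set x | h x == i]| <= N)%N.

(** Isolated vertices that raise the size of each class of [H] to [N]. *)
Definition padding : finType := {p : 'I_r * 'I_N | (#|[set x | h x == p.1]| <= p.2)%N}.

Definition padH (a b : VH + padding) : bool :=
  if (a, b) is (inl x, inl y) then H x y else false.

Definition padh (a : VH + padding) : 'I_r :=
  match a with inl x => h x | inr p => (val p).1 end.

Lemma padH_sym : symmetric padH.
Proof. by case=> [x|p] [y|q] //=; apply: adj_sym. Qed.

Lemma padH_irr : irreflexive padH.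
Proof. by case=> [x|p] //=; apply: adj_irrefl. Qed.

Lemma padH_deg a : (#|nbH padH a| <= Delta)%N.
Proof.
case: a => [x|p]; last by rewrite (_ : nbH _ _ = set0) ?cards0 //; apply/setP => -[y|q]; rewrite !inE.
rewrite -degH; apply: leq_trans (leq_bigmax x).
rewrite (_ : nbH _ _ = inl @: nbr H x) ?leq_imset_card //.
apply/setP => -[y|q]; rewrite !inE /=.
  by rewrite mem_imset ?inE // => u v [].
by apply/esym/negP => /imsetP[].
Qed.

Lemma padh_card i : #|fibH padh i| = N.
Proof.
rewrite -sum1_card big_sumType /=.
have -> : (\sum_(x | inl x \in fibH padh i) 1 = #|[set x | h x == i]|)%N.
  by rewrite -sum1_card; apply: eq_bigl => x; rewrite !inE.
have -> : (\sum_(p | inr p \in fibH padh i) 1 = N - #|[set x | h x == i]|)%N.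
  set n := #|[set x | h x == i]|.
  have -> : (\sum_(p | inr p \in fibH padh i) 1 = #|[set p : padding | (val p).1 == i]|)%N.
    by rewrite -sum1_card; apply: eq_bigl => p; rewrite !inE.
  rewrite -(card_in_imset (f := fun p : padding => (val p).2)); last first.
    move=> p q; rewrite !inE => /eqP pi /eqP qi pq; apply: val_inj.
    by rewrite [LHS]surjective_pairing [RHS]surjective_pairing pi qi pq.
  have -> : (fun p : padding => (val p).2) @: [set p : padding | (val p).1 == i] =
            [set k : 'I_N | (n <= k)%N].
    apply/setP => k; rewrite inE; apply/imsetP/idP => [[p pi ->]|nk].
      by have := valP p; move: pi; rewrite inE => /eqP->.
    by exists (Sub (i, k) nk); rewrite ?inE SubK.
  rewrite -sum1_card (eq_bigl (fun k : 'I_N => (n <= k)%N)) => [|k]; last by rewrite inE.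
  rewrite -(big_mkord (fun k => n <= k)%N (fun=> 1%N)) -(@big_nat_widenl _ _ _ n 0 N xpredT) //.
  by rewrite sum_nat_const_nat muln1.
by rewrite subnKC.
Qed.

End Padding.

Theorem lemma2 (R : realType) (r Delta : nat) (delta alpha : R)
    (delta_gt0 : 0 < delta) (alpha_gt0 : 0 < alpha) :
  exists eps beta C : R, [/\ 0 < eps, 0 < beta, 0 < C &
    forall (N : nat), (0 < N)%N ->
    forall (Rg : sgraph 'I_r)
           (VG : finType) (G : sgraph VG) (V_ : 'I_r -> {set VG}),
      (forall i j, i != j -> [disjoint V_ i & V_ j]) ->
      \bigcup_i V_ i = [set: VG] ->
      (forall i, #|V_ i| = N) ->
      (forall i j, Rg i j -> super_regular_pair eps delta G (V_ i) (V_ j)) ->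
    forall (VH : finType) (H : sgraph VH) (h : VH -> 'I_r),
      max_degree H = Delta ->
      is_hom H Rg h ->
      (forall i, (#|[set x | h x == i]| <= N)%N) ->
    forall (W : {set VH}) (W_ : VH -> {set VG}),
      #|W|%:R <= beta * N%:R ->
      (forall x, x \in W ->
         W_ x \subset V_ (h x) /\ alpha * N%:R <= #|W_ x|%:R) ->
      (forall x, x \notin W -> W_ x = V_ (h x)) ->
    exists lambda : fdist R {ffun VH -> VG},
      vertex_spread (Num.min 1 (C / N%:R)) lambda /\
      supported_on lambda (fun phi =>
        is_embedding H G phi /\ forall x, phi x \in W_ x)].
Proof.
pose d := Num.min (delta / 2) 2^-1; pose alpha1 := Num.min alpha 1.
have d0 : 0 < d by rewrite lt_min divr_gt0 //= invr_gt0.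
have dd : d <= delta / 2 by rewrite ge_min lexx.
have d2 : d <= 2^-1 by rewrite ge_min lexx orbT.
have a0 : 0 < alpha1 by rewrite lt_min alpha_gt0 /=.
have a1 : alpha1 <= 1 by rewrite ge_min lexx orbT.
have aa : alpha1 <= alpha by rewrite ge_min lexx.
have [eps' [beta [C [e0 b0 C0 emb]]]] := @spread_blowup_exists R r Delta d alpha1 d0 d2 a0 a1.
pose eps := Num.min eps' (delta / 2).
have ee : eps <= eps' by rewrite ge_min lexx.
have ed : eps <= delta / 2 by rewrite ge_min lexx orbT.
have eps0 : 0 < eps by rewrite lt_min e0 divr_gt0.
exists eps, beta, C; split=> // N N_gt0 Rg VG G V_ Vdis Vcov Vcard Vreg VH H h degH hom fib_le W W_ Wb WP WnP.
have exg v : exists i, v \in V_ i.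
  have : v \in \bigcup_i V_ i by rewrite Vcov inE.
  by case/bigcupP => i _ vi; exists i.
have [g gP] := fin_all_exists exg.
have gV v i : (g v == i) = (v \in V_ i).
  apply/eqP/idP => [<- //|vi]; apply/eqP; apply: contraT => /Vdis.
  by move/disjointFr => /(_ v (gP v)); rewrite vi.
have fV i : fibG g i = V_ i by apply/setP => v; rewrite inE gV.
pose h' := @padh r N VH h; pose H' := @padH r N VH H h.
have homH a b : H' a b -> Rg (h' a) (h' b).
  by case: a b => [x|p] [y|q] //=; apply: hom.
pose W' : {set VH + padding N h} := inl @: W.
pose Wf (a : VH + padding N h) : {set VG} := if a is inl x then W_ x else set0.
have inW x : (inl x \in W') = (x \in W) by rewrite mem_imset // => u v [].
have notW p : inr p \notin W' by apply/negP => /imsetP[].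
have reg a b : H' a b -> super_regular_pair eps delta G (V_ (h' a)) (V_ (h' b)).
  by move/homH/Vreg.
have [|||||a|lambda' [lS lP]] := emb N N_gt0 _ VG H' G h' g (@padH_sym r N VH H h)
    (@padH_irr r N VH H h) (@adj_sym _ G) (padH_deg degH) _ _ _ (padh_card fib_le) W' Wf.
- move=> a b ab T; rewrite !fV => TV Tge.
  have le : eps * N%:R <= eps' * N%:R by rewrite ler_wpM2r.
  apply: le_trans le.
  have := @super_regular_lower R VG G eps delta d (V_ (h' a)) (V_ (h' b)) T eps0 ed dd (reg a b ab).
  rewrite Vcard; apply => //; apply: le_trans Tge; by rewrite ler_wpM2r.
- move=> a b ab v; rewrite !fV => va; have [_ _ + _] := reg a b ab.
  move/(_ v va); rewrite Vcard setIC; apply: le_trans.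
  rewrite ler_wpM2r //; move: dd; clear; lra.
- by move=> i; rewrite fV.
- by rewrite card_imset // => u v [].
- by case=> [x|p]; rewrite ?(negPf (notW p)) // inW fV => /WP[].
- case: a => [x|p]; rewrite ?(negPf (notW p)) // inW => /WP[_]; apply: le_trans.
  by rewrite ler_wpM2r.
have [lambda [pS pP]] := pushforward lambda' (fun f : {ffun (VH + padding N h) -> VG} => [ffun x => f (inl x)]).
exists lambda.
have emb_of phi : lambda phi != 0 -> is_embedding H G phi /\ forall x, phi x \in W_ x.
  move=> /pS[f <- /lS[fI fH fcl fW]]; split; first split.
  - by move=> x y; rewrite !ffunE => /fI[].
  - by move=> x y xy; rewrite !ffunE; apply: fH.
  - move=> x; rewrite ffunE; have [xW|xW] := boolP (x \in W).
      by apply: (fW (inl x)); rewrite inW.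
    by rewrite (WnP x xW) -gV fcl.
split; last exact: emb_of.
split; first by move=> phi /emb_of[[]].
move=> k x y xI yI; rewrite pP.
have xI' : injective (fun i => inl (x i) : VH + padding N h) by move=> i j [/xI].
apply: le_trans (lP k _ y xI' yI); apply: Pr_le => f /=.
by move=> /forallP fx; apply/forallP => i; have := fx i; rewrite ffunE.
Qed.
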